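(* Let $N\ge1$ and let $T^1$ be the Kuranishi space of the simple $N$-dimensional singular point $0\in f^{-1}(0)$ with $$f(x_1,\ldots,x_{N+1})=\sum_{i=1}^{N-1}x_i^2+x_N^3+x_{N+1}^4.$$ The subset of $T^1$ parameterizing small deformations of $0\in f^{-1}(0)$ to a simple node is the union of $6$ hypersurfaces (one for each critical point $p_\Lambda$ of the generic deformation $f_\Lambda$). Moreover, calling $\mathcal{L}$ any of those hypersurfaces, there exists a stratification of nested algebraic subsets giving rise to the following inclusions and c.i.p. squares: $$\mathcal{L}\supset\mathcal{W}_2\supset\mathcal{W}_2^3\supset\widetilde{\mathcal{W}}_2^4\supset\mathcal{W}\cap(\mathcal{V}_0\cap\mathcal{V}_2\cap\mathcal{V}_4),\qquad \mathcal{V}_0^2\supset\mathcal{V}\cap\mathcal{V}_0^2\supset\{0\},$$ $$\mathcal{V}_0^2\subset\mathcal{W}_2^3,\qquad \mathcal{V}\cap\mathcal{V}_0^2\subset\widetilde{\mathcal{W}}_2^4,\qquad \{0\}\subset\mathcal{W}\cap(\mathcal{V}_0\cap\mathcal{V}_2\cap\mathcal{V}_4),$$ where every square is a c.i.p. square, i.e. $\widetilde{\mathcal{W}}_2^4\cap\mathcal{V}_0^2=\mathcal{V}\cap\mathcal{V}_0^2$ and $\bigl(\mathcal{W}\cap(\mathcal{V}_0\cap\mathcal{V}_2\cap\mathcal{V}_4)\bigr)\cap(\mathcal{V}\cap\mathcal{V}_0^2)=\{0\}$. This diagram verifies the Arnol'd adjacency diagram $$A_1\leftarrow A_2\leftarrow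 A_3\leftarrow A_4\leftarrow A_5,\quad D_4\leftarrow D_5\leftarrow E_6,\quad A_3\leftarrow D_4,\quad A_4\leftarrow D_5,\quad A_5\leftarrow E_6,$$ under the correspondence $\mathcal{L}\mapsto A_1$, $\mathcal{W}_2\mapsto A_2$, $\mathcal{W}_2^3\mapsto A_3$, $\widetilde{\mathcal{W}}_2^4\mapsto A_4$, $\mathcal{W}\cap(\mathcal{V}_0\cap\mathcal{V}_2\cap\mathcal{V}_4)\mapsto A_5$, $\mathcal{V}_0^2\mapsto D_4$, $\mathcal{V}\cap\mathcal{V}_0^2\mapsto D_5$, $\{0\}\mapsto E_6$. (All these subsets are defined in the context.)
   Context: The Kuranishi space of the isolated hypersurface singularity $0\in f^{-1}(0)$ is $T^1=\mathbb{C}\{x_1,\ldots,x_{N+1}\}/(f,\partial f/\partial x_1,\ldots,\partial f/\partial x_{N+1})$, the base of its versal deformation. Put $y=x_N$, $z=x_{N+1}$. Here $T^1\cong\langle1,y,z,yz,z^2,yz^2\rangle_{\mathbb{C}}$, and to $\Lambda=(\lambda_0,\ldots,\lambda_5)\in T^1$ is associated the deformation $U_\Lambda=\{f_\Lambda=0\}$ with $$f_\Lambda=f+\lambda_0+\lambda_1y+\lambda_2z+\lambda_3yz+\lambda_4z^2+\lambda_5yz^2.$$ The critical points of $f_\Lambda$ are $p_\Lambda=(0,\ldots,0,y_\Lambda,z_\Lambda)$ with $(y_\Lambda,z_\Lambda)$ one of the $6$ solutions of $$3y^2+\lambda_1+\lambda_3z+\lambda_5z^2=0,\qquad 4z^3+2\lambda_4z+\lambda_2+y(\lambda_3+2\lambda_5z)=0.$$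 Having chosen one of these critical points, $\mathcal{L}$ is the hypersurface of $T^1$ expressing $p_\Lambda\in U_\Lambda$: $$\mathcal{L}=\{y_\Lambda^3+z_\Lambda^4+\lambda_0+\lambda_1y_\Lambda+\lambda_2z_\Lambda+\lambda_3y_\Lambda z_\Lambda+\lambda_4z_\Lambda^2+\lambda_5y_\Lambda z_\Lambda^2=0\}\subset T^1.$$ Set $$v_0=\lambda_3+2\lambda_5z_\Lambda,\quad v_1=3y_\Lambda,\quad v_2=6z_\Lambda^2+\lambda_4+\lambda_5y_\Lambda,\quad v_3=\lambda_5,\quad v_4=4z_\Lambda,$$ and define the following subsets of $\mathcal{L}$: $\mathcal{V}_k=\{v_k=0\}$, $\mathcal{V}_0^m=\bigcap_{k=0}^m\mathcal{V}_k$, $$\mathcal{W}_2=\{4v_1v_2-v_0^2=0\},\quad \mathcal{W}_3=\{v_1^3v_4^2-v_2(v_1v_3+v_2)^2=0\},\quad \mathcal{W}_4=\{4v_1^3-(v_1v_3+3v_2)^2=0\},$$ $\mathcal{W}_2^m=\bigcap_{k=2}^m\mathcal{W}_k$, $\mathcal{V}=\{4v_3^3+27v_4^2=0\}$, $\mathcal{W}=\{v_3^2-4v_1=0\}$, and $\widetilde{\mathcal{W}}_2^4=\overline{\mathcal{W}_2^4\setminus\mathcal{V}_0^2}$ (Zariski closure; a codimension $3$ closed subset of $\mathcal{L}$). Simple singularities: an isolated hypersurface singularity is of type $A_m$, $D_m$ ($m\ge 4$), $E_6$ if it is equivalent, up to a local biholomorphic change of coordinates, to $\sum_{i=1}^Nx_i^2+x_{N+1}^{m+1}=0$,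 $\sum_{i=1}^{N-1}x_i^2+x_N^2x_{N+1}+x_{N+1}^{m-1}=0$, $\sum_{i=1}^{N-1}x_i^2+x_N^3+x_{N+1}^4=0$ at the origin, respectively. A simple node is an $A_1$ singularity. A class $B$ of singularities is adjacent to a class $A$ (written $A\leftarrow B$) if every singularity in $B$ can be deformed to a singularity in $A$ by an arbitrarily small deformation. A diagram of inclusions of algebraic subsets of $T^1$ ''verifies'' a given adjacency diagram of the same shape if inclusions correspond to adjacency arrows and, for generic $\Lambda$ in each subset, $p_\Lambda\in U_\Lambda$ is a singularity of the type in the corresponding position. A square of subset inclusions $A\subset B\subset D$, $A\subset C\subset D$ is a c.i.p. square (complete intersection property) if $A=B\cap C$.
   Formalization: The node subset is replaced by its Zariski closure; strata and generic types are taken on pairs (Λ, critical point); for W_2^3 (A_3) and W̃_2^4 (A_4), which are reducible with a component of worse fit, generic means on a nonempty Zariski open subset. *)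

(* Defs.v *)
(* mpoly is required but not imported, because its notations clash with those
   of all_analysis: mpoly.mpoly n K is {mpoly K[n]} and mpoly.meval v g is
   g.@[v]. *)
From HB Require Import structures.
From mathcomp Require Import all_boot all_order all_algebra.
From mathcomp Require mpoly.
From mathcomp Require Import complex.
From mathcomp Require Import all_classical all_reals all_analysis.
Set Implicit Arguments.
Unset Strict Implicit.
Unset Printing Implicit Defensive.
Import Order.TTheory GRing.Theory Num.Theory numFieldNormedType.Exports.
Local Open Scope classical_set_scope.
Local Open Scope ring_scope.

(* R[i] packaged as a numClosedFieldType, so that it inherits the topology and
   the norm that MathComp-Analysis puts on every numFieldType; differentiable
   below therefore means C-differentiable. *)
Definition Cx (R : realType) : numClosedFieldType := (complex R : Type).

Section ZariskiTopology.
Variables (K : fieldType) (n : nat).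
Implicit Types S Z O : set 'rV[K]_n.

Definition zeros (I : set (mpoly.mpoly n K)) : set 'rV[K]_n :=
  [set x | forall g, I g -> mpoly.meval (fun i => x ord0 i) g = 0].

Definition zclosed Z := exists I, Z = zeros I.

Definition zopen O := zclosed (~` O).

Definition zclosure S : set 'rV[K]_n :=
  zeros [set g | forall x, S x -> mpoly.meval (fun i => x ord0 i) g = 0].

(* P holds at the generic point of S: on a nonempty Zariski open subset of S.
   When S is irreducible such a subset is dense. *)
Definition generically S (P : 'rV[K]_n -> Prop) :=
  exists O, [/\ zopen O, S `&` O !=set0 & S `&` O `<=` P].

Definition densely_generically S (P : 'rV[K]_n -> Prop) :=
  exists O, [/\ zopen O, S `<=` zclosure (S `&` O) & S `&` O `<=` P].

End ZariskiTopology.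

(* A is the small corner and D the large one. *)
Definition cip_square (T : Type) (A B C D : set T) :=
  [/\ A `<=` B, B `<=` D, A `<=` C, C `<=` D & A = B `&` C].

Section HypersurfaceGerms.
Variable R : realType.
Local Notation C := (Cx R).

Definition holo_near m n (g : 'rV[C]_m.+1 -> 'rV[C]_n.+1) (a : 'rV[C]_m.+1) :=
  \forall x \near a, differentiable g x.

Definition holo_near_scalar m (u : 'rV[C]_m.+1 -> C) (a : 'rV[C]_m.+1) :=
  \forall x \near a, differentiable u x.

(* The hypersurface germs ({F = 0}, a) and ({G = 0}, 0) are isomorphic: a
   biholomorphic germ psi : (C^(N+1), 0) -> (C^(N+1), a), with inverse phi,
   carries F to a unit multiple of G. *)
Definition germ_equiv N (F : 'rV[C]_N.+1 -> C) (a : 'rV[C]_N.+1)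
    (G : 'rV[C]_N.+1 -> C) :=
  exists (phi psi : 'rV[C]_N.+1 -> 'rV[C]_N.+1) (u : 'rV[C]_N.+1 -> C),
  [/\ [/\ holo_near phi a, holo_near psi 0, phi a = 0 & psi 0 = a],
      \forall x \near a, psi (phi x) = x,
      \forall x \near (0 : 'rV[C]_N.+1), phi (psi x) = x,
      holo_near_scalar u 0 /\ u 0 != 0 &
      \forall x \near (0 : 'rV[C]_N.+1), F (psi x) = u x * G x].

Inductive simple_type := TypeA of nat | TypeD of nat | TypeE6.

(* With 0-based indices x_1, ..., x_(N+1) become x 0 0, ..., x 0 N. *)
Definition ycoord N (x : 'rV[C]_N.+1) : C := x ord0 (inord N.-1).
Definition zcoord N (x : 'rV[C]_N.+1) : C := x ord0 ord_max.
Definition squares N k (x : 'rV[C]_N.+1) : C :=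
  \sum_(i < N.+1 | (i < k)%N) x ord0 i ^+ 2.

(* TypeD m is meant for 4 <= m. *)
Definition normal_form N (t : simple_type) (x : 'rV[C]_N.+1) : C :=
  match t with
  | TypeA m => squares N x + zcoord x ^+ m.+1
  | TypeD m =>
      squares N.-1 x + ycoord x ^+ 2 * zcoord x + zcoord x ^+ m.-1
  | TypeE6 => squares N.-1 x + ycoord x ^+ 3 + zcoord x ^+ 4
  end.

Definition has_type N (t : simple_type) (F : 'rV[C]_N.+1 -> C)
    (a : 'rV[C]_N.+1) :=
  germ_equiv F a (normal_form t).

End HypersurfaceGerms.

Section KuranishiE6.
Variable R : realType.
Local Notation C := (Cx R).

(* T^1 in the basis 1, y, z, yz, z^2, yz^2; the coordinate lambda_k. *)
Local Notation T1 := 'rV[C]_6.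
Definition lam (l : T1) (k : nat) : C := l ord0 (inord k).

Definition f_def N (l : T1) (x : 'rV[C]_N.+1) : C :=
  let y := ycoord x in let z := zcoord x in
  normal_form TypeE6 x + lam l 0 + lam l 1 * y + lam l 2 * z
  + lam l 3 * y * z + lam l 4 * z ^+ 2 + lam l 5 * y * z ^+ 2.

(* A pair (y, z) : 'rV_2 stands for the point (0, ..., 0, y, z). *)
Definition pointN N (q : 'rV[C]_2) : 'rV[C]_N.+1 :=
  \row_i (if i == N :> nat then q ord0 ord_max
          else if i == N.-1 :> nat then q ord0 ord0 else 0).

Definition critical (l : T1) (q : 'rV[C]_2) : Prop :=
  let y := q ord0 ord0 in let z := q ord0 ord_max in
  3%:R * y ^+ 2 + lam l 1 + lam l 3 * z + lam l 5 * z ^+ 2 = 0 /\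
  4%:R * z ^+ 3 + 2%:R * lam l 4 * z + lam l 2
    + y * (lam l 3 + 2%:R * lam l 5 * z) = 0.

Definition crit_value (l : T1) (q : 'rV[C]_2) : C :=
  let y := q ord0 ord0 in let z := q ord0 ord_max in
  y ^+ 3 + z ^+ 4 + lam l 0 + lam l 1 * y + lam l 2 * z
  + lam l 3 * y * z + lam l 4 * z ^+ 2 + lam l 5 * y * z ^+ 2.

Definition nodal N : set T1 :=
  [set l | exists a : 'rV[C]_N.+1, has_type (TypeA 1) (f_def l) a].

(* The choice of a critical point is multivalued on T^1 and has monodromy, so
   y_Lambda, z_Lambda and v_0, ..., v_4 are functions not on T^1 but on the
   6-sheeted cover of pairs (Lambda, critical point of f_Lambda).  The loci
   below are subsets of this cover; it lies in C^(6+2), with coordinates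
   (lambda_0, ..., lambda_5, y, z). *)
Local Notation Cover := 'rV[C]_(6 + 2).
Implicit Type x : Cover.

Definition Lcal : set Cover :=
  [set x | critical (lsubmx x) (rsubmx x)
           /\ crit_value (lsubmx x) (rsubmx x) = 0].

(* The subset of T^1 cut out by a locus S of the cover once a critical point
   p l of f_l has been chosen for every l. *)
Definition along (p : T1 -> 'rV[C]_2) (S : set Cover) : set T1 :=
  [set l | S (row_mx l (p l))].

Definition lamx x (k : nat) : C := lam (lsubmx x) k.
Definition yx x : C := rsubmx x ord0 ord0.
Definition zx x : C := rsubmx x ord0 ord_max.

Definition v0 x : C := lamx x 3 + 2%:R * lamx x 5 * zx x.
Definition v1 x : C := 3%:R * yx x.
Definition v2 x : C := 6%:R * zx x ^+ 2 + lamx x 4 + lamx x 5 * yx x.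
Definition v3 x : C := lamx x 5.
Definition v4 x : C := 4%:R * zx x.

Definition zero_on_L (w : Cover -> C) : set Cover :=
  Lcal `&` [set x | w x = 0].

Definition V0 := zero_on_L v0.
Definition V1 := zero_on_L v1.
Definition V2 := zero_on_L v2.
Definition V4 := zero_on_L v4.
Definition V02 := V0 `&` V1 `&` V2.

Definition W2 := zero_on_L (fun x => 4%:R * v1 x * v2 x - v0 x ^+ 2).
Definition W3 := zero_on_L (fun x =>
  v1 x ^+ 3 * v4 x ^+ 2 - v2 x * (v1 x * v3 x + v2 x) ^+ 2).
Definition W4 := zero_on_L (fun x =>
  4%:R * v1 x ^+ 3 - (v1 x * v3 x + 3%:R * v2 x) ^+ 2).

(* On W2, where f_Lambda is (a y + b z)^2 + ... at p_Lambda, a point outside V02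
   is A_3 or worse iff v0 (v1 v3 + v2) = 2 v1^2 v4.  W3 is the square of this
   equation, so W23 and W24t each have a second component, with the opposite
   sign, at whose generic point p_Lambda is only A_2. *)
Definition W23 := W2 `&` W3.
Definition W24 := W2 `&` W3 `&` W4.
Definition V := zero_on_L (fun x => 4%:R * v3 x ^+ 3 + 27%:R * v4 x ^+ 2).
Definition W := zero_on_L (fun x => v3 x ^+ 2 - 4%:R * v1 x).

Definition W24t := zclosure (W24 `\` V02).

End KuranishiE6.

Inductive vertex := vA1 | vA2 | vA3 | vA4 | vA5 | vD4 | vD5 | vE6.

Definition vertex_type (v : vertex) : simple_type :=
  match v with
  | vA1 => TypeA 1 | vA2 => TypeA 2 | vA3 => TypeA 3 | vA4 => TypeA 4
  | vA5 => TypeA 5 | vD4 => TypeD 4 | vD5 => TypeD 5 | vE6 => TypeE6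
  end.

(* arnold_arrow a b is the arrow a <- b of the adjacency diagram. *)
Inductive arnold_arrow : vertex -> vertex -> Prop :=
| arrow_A1_A2 : arnold_arrow vA1 vA2
| arrow_A2_A3 : arnold_arrow vA2 vA3
| arrow_A3_A4 : arnold_arrow vA3 vA4
| arrow_A4_A5 : arnold_arrow vA4 vA5
| arrow_D4_D5 : arnold_arrow vD4 vD5
| arrow_D5_E6 : arnold_arrow vD5 vE6
| arrow_A3_D4 : arnold_arrow vA3 vD4
| arrow_A4_D5 : arnold_arrow vA4 vD5
| arrow_A5_E6 : arnold_arrow vA5 vE6.

(* The inclusions along the arrows, and the two squares of the diagram. *)
Definition cip_diagram (T : Type) (S : vertex -> set T) :=
  [/\ (forall a b, arnold_arrow a b -> S b `<=` S a),
      cip_square (S vD5) (S vA4) (S vD4) (S vA3) &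
      cip_square (S vE6) (S vA5) (S vD5) (S vA4)].

Section Diagram.
Variables (R : realType) (N : nat).
Local Notation C := (Cx R).
Implicit Type S : vertex -> set 'rV[C]_(6 + 2).

Definition type_at (t : simple_type) (x : 'rV[C]_(6 + 2)) : Prop :=
  has_type t (f_def (lsubmx x)) (pointN N (rsubmx x)).

Definition verifies (arrow : vertex -> vertex -> Prop) S :=
  (forall a b, arrow a b -> S b `<=` S a) /\
  (forall a, generically (S a) (type_at (vertex_type a))).

Definition stratum (v : vertex) : set 'rV[C]_(6 + 2) :=
  match v with
  | vA1 => @Lcal R
  | vA2 => @W2 R
  | vA3 => @W23 R
  | vA4 => @W24t R
  | vA5 => @W R `&` (@V0 R `&` @V2 R `&` @V4 R)
  | vD4 => @V02 R
  | vD5 => @V R `&` @V02 R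
  | vE6 => [set 0]
  end.

End Diagram.

Arguments nodal R N : clear implicits.
Arguments Lcal R : clear implicits.
Arguments stratum R v : clear implicits.
Arguments type_at R N t x : clear implicits.

(* Main.v *)
Require Import Defs.
From HB Require Import structures.
From mathcomp Require Import all_boot all_order all_algebra.
From mathcomp Require mpoly.
Import (canonicals, coercions) mpoly.
From mathcomp Require Import complex.
From mathcomp Require Import all_classical all_reals all_analysis.
From mathcomp Require Import spectral ring lra.
Import Order.TTheory GRing.Theory Num.Theory numFieldNormedType.Exports.
Local Open Scope classical_set_scope.
Local Open Scope ring_scope.
Set Implicit Arguments.
Unset Strict Implicit.
Unset Printing Implicit Defensive.

(** Write y_L, z_L for the chosen critical point and expand f_Lambda there: on the
locus where the critical value vanishes,
  f_Lambda = sum of squares + s^3 + v1 s^2 + v0 s t + v2 t^2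
               + v3 s t^2 + v4 t^3 + t^4,    s = y - y_L,  t = z - z_L,
so the quantities v0, ..., v4 are the Taylor coefficients at the critical
point.  They are also coordinates: the equations of the locus can be solved for
the lambdas, and of_v is a polynomial inverse of (v0, ..., v4), so the locus is
an affine 5-space.  All statements on strata become statements on the
coefficients of the plane germ cubic_germ.

Types.  Each stratum is a condition on the low order terms of that germ, and the
type is obtained by completing the square.  When v1 is nonzero and 4 v1 v2 =
v0^2, the quadratic part is v1 (s + c t)^2; the germ is then a unit times a
square plus a function of order 3 in t (A_2), whose coefficient of t^3 vanishes
when v4 = c^3 + c v3 (A_3), and two more coefficients lead to A_4 and A_5.  When
v0, v1, v2 all vanish, the tangent cone is the cubic s^3 + v3 s t^2 + v4 t^3 of
discriminant -(4 v3^3 + 27 v4^2): three distinct lines give D_4 and a double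
line gives D_5.  A germ is brought exactly to its normal form by coordinates
that absorb the units (plane_typeA, plane_typeD), which are roots of holomorphic
functions.  That these coordinates are invertible is the holomorphic inverse
function theorem, proved here from a contraction argument (inverse_function);
holomorphy is handled through continuous difference quotients, which behave
algebraically under products, composition and inversion.

Geometry.  The A_4 stratum contains the surface A4_surface, given by polynomials
in two parameters a and c: a = 0 gives the D_5 stratum and c = 0 the A_5
stratum.  In the other direction a further equation, W24t_relation, holds on the
A_4 stratum and restricts to the discriminant on the D_4 stratum; this is why
their intersection is not larger than the D_5 stratum.  The generic points of
the strata other than A_3 and A_4 are dense because any point is joined to a
generic one by a polynomial curve in the stratum (zclosure_rational_path).

The six hypersurfaces.  C[y, z] modulo the two critical equations has dimension
6.  Multiplications by y and by z on it are commuting matrices with polynomial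
entries in Lambda; triangularizing them simultaneously gives six joint
eigenvalues, which are exactly the critical points (critical_spectrum).  Hence
symmetric functions of the critical points, in particular the product of the
critical values, are determinants or traces of polynomial matrices, thus
polynomial in Lambda.  The locus where the critical points are distinct and
nondegenerate is described by two such determinants, and there the implicit
function theorem makes them vary holomorphically (critical_point_continuation).

Nodes.  A germ with a node at a has zero value and zero differential at a, so a
nodal Lambda has a critical point of value zero (nodal_critical); conversely A_1
is the generic type on the locus of zero critical value, so the closure of the
nodal locus is the union of the six hypersurfaces. *)

(** * Holomorphic germs through difference quotients *)

Section Hol.
Variable K : numFieldType.

(** Holomorphy near a in the sense of Caratheodory: the difference f p - f q is a
    combination of the coordinates of p - q with coefficients continuous near
    the diagonal point (a, a), where their values g form the gradient.
    Quantifying over two points, rather than over x and a, is what makes the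
    notion stable in a neighbourhood of a and under inversion. *)
Definition hol n (f : 'rV[K]_n -> K) (a : 'rV[K]_n) (g : 'I_n -> K) :=
  exists Q : 'I_n -> 'rV[K]_n * 'rV[K]_n -> K,
  [/\ forall i, Q i (a, a) = g i,
      \forall pq \near (a, a), forall i, continuous_at pq (Q i) &
      \forall pq \near (a, a),
        f pq.1 - f pq.2 = \sum_i (pq.1 ord0 i - pq.2 ord0 i) * Q i pq].

Lemma near2_fst (T U : topologicalType) (x : T) (y : U) (P : T -> Prop) :
  (\forall x' \near x, P x') -> \forall xy \near (x, y), P xy.1.
Proof. move=> h. exact: (cvg_fst h). Qed.

Lemma near2_snd (T U : topologicalType) (x : T) (y : U) (P : U -> Prop) :
  (\forall x' \near y, P x') -> \forall xy \near (x, y), P xy.2.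
Proof. move=> h. exact: (cvg_snd h). Qed.

Lemma near_near (T : topologicalType) (x : T) (P : T -> Prop) :
  (\forall y \near x, P y) -> \forall y \near x, \forall z \near y, P z.
Proof. by move=> h; exact: (nbhs_interior h). Qed.

Lemma near_forall (T : topologicalType) (I : finType) (x : T) (P : I -> T -> Prop) :
  (forall i, \forall y \near x, P i y) -> \forall y \near x, forall i, P i y.
Proof. by move=> h; exact: filter_forall. Qed.

Lemma near_diag (T : topologicalType) (x : T) (P : T * T -> Prop) :
  (\forall xy \near (x, x), P xy) -> \forall y \near x, P (y, y).
Proof.
move=> h; have : (fun y : T => (y, y)) @ x --> (x, x) by apply: cvg_pair.
exact.
Qed.

Section Continuity.
Variables (T U : topologicalType).

Lemma continuous_at_comp (V : topologicalType) (f : T -> U) (h : U -> V) x :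
  continuous_at x f -> continuous_at (f x) h -> continuous_at x (fun y => h (f y)).
Proof. exact: continuous_comp. Qed.

Lemma continuous_at_fst (f : T -> U) (pq : T * T) :
  continuous_at pq.1 f -> continuous_at pq (fun pq => f pq.1).
Proof. by apply: (@continuous_comp _ _ _ fst f); exact: cvg_fst. Qed.

Lemma continuous_at_snd (f : T -> U) (pq : T * T) :
  continuous_at pq.2 f -> continuous_at pq (fun pq => f pq.2).
Proof. by apply: (@continuous_comp _ _ _ snd f); exact: cvg_snd. Qed.

Lemma near_eq_continuous_at (f h : T -> U) x :
  (\forall y \near x, f y = h y) -> continuous_at x h -> continuous_at x f.
Proof.
move=> e c; have ex : f x = h x := nbhs_singleton e.
rewrite /continuous_at ex; apply: cvg_trans c; apply: near_eq_cvg.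
by near do apply/esym.
Unshelve. all: by end_near. Qed.

Lemma continuous_at_cst (c : U) (x : T) : continuous_at x (fun=> c).
Proof. exact: cvg_cst. Qed.

Lemma continuous_at_pair (V : topologicalType) (f : T -> U) (h : T -> V) x :
  continuous_at x f -> continuous_at x h -> continuous_at x (fun y => (f y, h y)).
Proof. exact: cvg_pair. Qed.

Lemma continuous_at_id (x : T) : continuous_at x (fun y => y).
Proof. exact: cvg_id. Qed.

Lemma continuous_at_sum (I : finType) (F : I -> T -> K) x :
  (forall i, continuous_at x (F i)) -> continuous_at x (fun y => \sum_i F i y).
Proof.
move=> h; rewrite /continuous_at.
have h' i : true -> F i y @[y --> x] --> F i x by move=> _; exact: h.
exact: (@cvg_big K I +%R 0 xpredT (@add_continuous K) T (nbhs x) _ F (fun i => F i x) _ h').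
Qed.

Lemma continuous_at_prod (I : finType) (F : I -> T -> K) x :
  (forall i, continuous_at x (F i)) -> continuous_at x (fun y => \prod_i F i y).
Proof.
move=> h; rewrite /continuous_at.
have h' i : true -> F i y @[y --> x] --> F i x by move=> _; exact: h.
exact: (@cvg_big K I *%R 1 xpredT (@mul_continuous K) T (nbhs x) _ F (fun i => F i x) _ h').
Qed.

Lemma continuous_at_add (f h : T -> K) x : continuous_at x f ->
  continuous_at x h -> continuous_at x (fun y => f y + h y).
Proof. by move=> cf ch; apply: cvgD. Qed.

Lemma continuous_at_opp (f : T -> K) x : continuous_at x f ->
  continuous_at x (fun y => - f y).
Proof. by move=> cf; apply: cvgN. Qed.

Lemma continuous_at_mul (f h : T -> K) x : continuous_at x f ->
  continuous_at x h -> continuous_at x (fun y => f y * h y).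
Proof. by move=> cf ch; apply: cvgM. Qed.

Lemma continuous_at_inv (f : T -> K) x : f x != 0 -> continuous_at x f ->
  continuous_at x (fun y => (f y)^-1).
Proof. by move=> f0 cf; apply: cvgV. Qed.

Lemma continuous_at_coord n i (x : 'rV[K]_n) :
  continuous_at x (fun p : 'rV[K]_n => p ord0 i).
Proof. exact: coord_continuous. Qed.

Lemma continuous_at_row n (G : 'I_n -> T -> K) (x : T) :
  (forall j, continuous_at x (G j)) ->
  continuous_at x (fun y => \row_j G j y : 'rV[K]_n).
Proof.
move=> h; apply/cvgrPdist_lt => e e0; near=> y.
suff : ball_ (fun x => `| x |) (\row_j G j x) e (\row_j G j y) by [].
rewrite -mx_norm_ball.
split=> // i j; rewrite !mxE -ball_normE /=.
suff : forall j, `|G j x - G j y| < e by apply.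
near: y; apply: near_forall => {}j; have /cvgrPdist_lt/(_ e e0) := h j.
by [].
Unshelve. all: by end_near. Qed.

End Continuity.

Lemma hol_continuous n (f : 'rV[K]_n -> K) a g :
  hol f a g -> continuous_at a f.
Proof.
move=> [Q [_ Qc Qe]]; have pc : continuous_at a (fun p => (p, a)).
  by apply: continuous_at_pair; [exact: continuous_at_id|exact: continuous_at_cst].
have e : \forall p \near a, f p = f a + \sum_i (p ord0 i - a ord0 i) * Q i (p, a).
  have h : \forall p \near a, f p - f a = \sum_i (p ord0 i - a ord0 i) * Q i (p, a).
    exact: pc _ Qe.
  by near=> p; rewrite -(near h p)// addrC subrK.
apply: (near_eq_continuous_at e); apply: continuous_at_add.
  exact: continuous_at_cst.
apply: continuous_at_sum => i; apply: continuous_at_mul.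
  apply: continuous_at_add; first exact: continuous_at_coord.
  exact: continuous_at_cst.
by apply: (continuous_at_comp pc); exact: (nbhs_singleton Qc).
Unshelve. all: by end_near. Qed.

(** The conditions on the quotients hold near (a, a), hence near (x, x) for x
    close to a, where the same quotients serve. *)
Lemma hol_near n (f : 'rV[K]_n -> K) a g :
  hol f a g -> \forall x \near a, exists g', hol f x g'.
Proof.
move=> [Q [_ Qc Qe]]; have /near_diag Qc2 := near_near Qc; have /near_diag Qe2 := near_near Qe.
near=> x; exists (fun i => Q i (x, x)); exists Q; split=> //; [near: x; exact: Qc2 | near: x; exact: Qe2].
Unshelve. all: by end_near. Qed.

Lemma hol_eq n (f h : 'rV[K]_n -> K) a g :
  (\forall x \near a, f x = h x) -> hol h a g -> hol f a g.
Proof.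
move=> e [Q [Qg Qc Qe]]; exists Q; split=> //.
have e1 := near2_fst a e; have e2 := near2_snd a e.
by near=> pq; rewrite (near e1 pq)// (near e2 pq)//; near: pq.
Unshelve. all: by end_near. Qed.

Lemma hol_grad n (f : 'rV[K]_n -> K) a g g' : g =1 g' -> hol f a g -> hol f a g'.
Proof. by move=> e [Q [Qg Qc Qe]]; exists Q; split=> // i; rewrite Qg. Qed.

Lemma hol_cst n (c : K) (a : 'rV[K]_n) : hol (fun=> c) a (fun=> 0).
Proof.
exists (fun _ _ => 0); split=> //.
  by near=> pq => i; apply: continuous_at_cst.
by near=> pq; rewrite subrr big1// => i _; rewrite mulr0.
Unshelve. all: by end_near. Qed.

Lemma hol_coord n (j : 'I_n) (a : 'rV[K]_n) :
  hol (fun x => x ord0 j) a (fun i => (i == j)%:R).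
Proof.
exists (fun i _ => (i == j)%:R); split=> //.
  by near=> pq => i; apply: continuous_at_cst.
near=> pq; rewrite (bigD1 j)//= eqxx mulr1 big1 ?addr0// => i /negPf ->.
by rewrite mulr0.
Unshelve. all: by end_near. Qed.

Lemma hol_add n (f h : 'rV[K]_n -> K) a gf gh : hol f a gf -> hol h a gh ->
  hol (fun x => f x + h x) a (fun i => gf i + gh i).
Proof.
move=> [Q [Qg Qc Qe]] [P [Pg Pc Pe]]; exists (fun i pq => Q i pq + P i pq); split.
- by move=> i; rewrite Qg Pg.
- near=> pq => i; apply: continuous_at_add; [exact: (near Qc pq) | exact: (near Pc pq)].
- near=> pq; rewrite opprD addrACA (near Qe pq)// (near Pe pq)// -big_split/=.
  by apply: eq_bigr => i _; rewrite mulrDr.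
Unshelve. all: by end_near. Qed.

Lemma hol_mul n (f h : 'rV[K]_n -> K) a gf gh : hol f a gf -> hol h a gh ->
  hol (fun x => f x * h x) a (fun i => f a * gh i + h a * gf i).
Proof.
move=> hf hh; have [gf1 hf1]:= nbhs_singleton (hol_near hf).
have cf := hol_near hf; have ch := hol_near hh.
have cf1 := near2_fst a cf; have ch1 := near2_snd a ch.
move: hf hh => [Q [Qg Qc Qe]] [P [Pg Pc Pe]].
exists (fun i pq => f pq.1 * P i pq + h pq.2 * Q i pq); split.
- by move=> i; rewrite Qg Pg.
- near=> pq => i.
  have [g1 /hol_continuous c1] : exists g, hol f pq.1 g by near: pq.
  have [g2 /hol_continuous c2] : exists g, hol h pq.2 g by near: pq.
  apply: continuous_at_add; apply: continuous_at_mul.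
  + exact: continuous_at_fst.
  + exact: (near Pc pq).
  + exact: continuous_at_snd.
  + exact: (near Qc pq).
- near=> pq.
  have -> : f pq.1 * h pq.1 - f pq.2 * h pq.2 =
    f pq.1 * (h pq.1 - h pq.2) + h pq.2 * (f pq.1 - f pq.2) by ring.
  rewrite (near Qe pq)// (near Pe pq)// !big_distrr -big_split/=.
  by apply: eq_bigr => i _; ring.
Unshelve. all: by end_near. Qed.

Lemma hol_opp n (f : 'rV[K]_n -> K) a g : hol f a g ->
  hol (fun x => - f x) a (fun i => - g i).
Proof.
move=> hf; apply: (@hol_eq _ _ (fun x => (-1) * f x)).
  by near=> x; rewrite mulN1r.
by apply: hol_grad (hol_mul (hol_cst (-1) a) hf) => i; rewrite mulr0 addr0 mulN1r.
Unshelve. all: by end_near. Qed.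

Lemma hol_inv n (f : 'rV[K]_n -> K) a g : f a != 0 -> hol f a g ->
  hol (fun x => (f x)^-1) a (fun i => - g i / f a ^+ 2).
Proof.
move=> fa hf; have cf := hol_near hf.
have fn0 : \forall x \near a, f x != 0.
  by have := hol_continuous hf => /cvgr_neq0; apply.
have cf1 := near2_fst a cf; have cf2 := near2_snd a cf.
have n1 := near2_fst a fn0; have n2 := near2_snd a fn0.
move: hf => [Q [Qg Qc Qe]].
exists (fun i pq => - (f pq.1)^-1 * (f pq.2)^-1 * Q i pq); split.
- by move=> i; rewrite Qg/=; field.
- near=> pq => i.
  have [g1 /hol_continuous c1] : exists g, hol f pq.1 g by near: pq.
  have [g2 /hol_continuous c2] : exists g, hol f pq.2 g by near: pq.
  apply: continuous_at_mul; last exact: (near Qc pq).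
  apply: continuous_at_mul; [apply: continuous_at_opp|]; apply: continuous_at_inv.
  + by near: pq.
  + exact: continuous_at_fst.
  + by near: pq.
  + exact: continuous_at_snd.
- near=> pq.
  have p1 : f pq.1 != 0 by near: pq.
  have p2 : f pq.2 != 0 by near: pq.
  transitivity (- (f pq.1)^-1 * (f pq.2)^-1 * (f pq.1 - f pq.2)).
    by field; rewrite p1 p2.
  rewrite (near Qe pq)// big_distrr/=.
  by apply: eq_bigr => i _; ring.
Unshelve. all: by end_near. Qed.

Lemma hol_sum n (I : finType) (F : I -> 'rV[K]_n -> K) a (g : I -> 'I_n -> K) :
  (forall i, hol (F i) a (g i)) ->
  hol (fun x => \sum_i F i x) a (fun j => \sum_i g i j).
Proof.
move=> h; apply: (@hol_grad _ _ _ (fun j => \sum_(i <- index_enum I) g i j)) => //.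
elim: (index_enum I) => [|i r IH].
  apply: (@hol_eq _ _ (fun=> 0)); first by near=> x; rewrite big_nil.
  by apply: hol_grad (hol_cst 0 a) => j; rewrite big_nil.
apply: (@hol_eq _ _ (fun x => F i x + \sum_(i <- r) F i x)).
  by near=> x; rewrite big_cons.
by apply: hol_grad (hol_add (h i) IH) => j; rewrite big_cons.
Unshelve. all: by end_near. Qed.

Lemma hol_exp n (f : 'rV[K]_n -> K) a g k : hol f a g ->
  hol (fun x => f x ^+ k) a (fun i => k%:R * f a ^+ k.-1 * g i).
Proof.
move=> hf; elim: k => [|k IH].
  by apply: hol_grad (hol_cst 1 a) => i; rewrite mul0r mul0r.
apply: (@hol_eq _ _ (fun x => f x * f x ^+ k)).
  by near=> x; rewrite exprS.
apply: hol_grad (hol_mul hf IH) => i /=.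
by case: k {IH} => [|k]; rewrite /= ?exprS -?natr1; ring.
Unshelve. all: by end_near. Qed.

(** The quotients of a composite are the products of the quotients, which is the
    chain rule without any remainder. *)
Lemma hol_comp m n (f : 'rV[K]_m -> K) (G : 'I_m -> 'rV[K]_n -> K) a
    (gf : 'I_m -> K) (gG : 'I_m -> 'I_n -> K) :
  (forall j, hol (G j) a (gG j)) -> hol f (\row_j G j a) gf ->
  hol (fun x => f (\row_j G j x)) a (fun i => \sum_j gG j i * gf j).
Proof.
move=> hG [Q [Qg Qc Qe]].
pose R x : 'rV[K]_m := \row_j G j x.
have Rc : \forall x \near a, continuous_at x R.
  have : \forall x \near a, forall j, exists g, hol (G j) x g.
    by apply: near_forall => j; exact: hol_near (hG j).
  apply: filterS => x hx; apply: continuous_at_row => j.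
  by have [g /hol_continuous] := hx j.
have /choice[P hP] : forall j, exists P : 'I_n -> 'rV[K]_n * 'rV[K]_n -> K,
  [/\ forall i, P i (a, a) = gG j i,
      \forall pq \near (a, a), forall i, continuous_at pq (P i) &
      \forall pq \near (a, a),
        G j pq.1 - G j pq.2 = \sum_i (pq.1 ord0 i - pq.2 ord0 i) * P i pq].
  by move=> j; have [P] := hG j; exists P.
have Pc : \forall pq \near (a, a), forall j, forall i, continuous_at pq (P j i).
  by apply: near_forall => j; have [] := hP j.
have Pe : \forall pq \near (a, a), forall j,
        G j pq.1 - G j pq.2 = \sum_i (pq.1 ord0 i - pq.2 ord0 i) * P j i pq.
  by apply: near_forall => j; have [] := hP j.
have Rc1 := near2_fst a Rc; have Rc2 := near2_snd a Rc.
pose RR (pq : 'rV[K]_n * 'rV[K]_n) := (R pq.1, R pq.2).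
have RRc pq : continuous_at pq.1 R -> continuous_at pq.2 R -> continuous_at pq RR.
  move=> c1 c2; apply: continuous_at_pair; first exact: continuous_at_fst.
  exact: continuous_at_snd.
have RRa : continuous_at (a, a) RR.
  by apply: RRc; exact: (nbhs_singleton Rc).
have Qc2 : \forall pq \near (a, a), forall i, continuous_at (RR pq) (Q i).
  exact: RRa _ Qc.
have Qe2 : \forall pq \near (a, a), f (RR pq).1 - f (RR pq).2 =
    \sum_i ((RR pq).1 ord0 i - (RR pq).2 ord0 i) * Q i (RR pq).
  exact: RRa _ Qe.
have RRn : \forall pq \near (a, a), continuous_at pq RR.
  by near=> pq; apply: RRc; [exact: (near Rc1 pq)|exact: (near Rc2 pq)].
exists (fun i pq => \sum_j P j i pq * Q j (RR pq)); split.
- by move=> i; apply: eq_bigr => j _; have [-> _ _] := hP j; rewrite -Qg.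
- near=> pq => i; apply: continuous_at_sum => j; apply: continuous_at_mul.
    by move: i j; near: pq; apply: filterS Pc => ? h i j; exact: h.
  apply: (continuous_at_comp (f := RR)); last by move: j; near: pq.
  exact: (near RRn pq).
- near=> pq; rewrite -[LHS]/(f (RR pq).1 - f (RR pq).2) (near Qe2 pq)//.
  under eq_bigr => i _ do rewrite /= !mxE (near Pe pq)// mulr_suml.
  rewrite exchange_big/=; apply: eq_bigr => i _; rewrite mulr_sumr.
  by apply: eq_bigr => j _; rewrite mulrA.
Unshelve. all: by end_near. Qed.

(** Converts an epsilon estimate of the remainder to
    the little-o that defines differentiability. *)
Lemma differentiable_of_estimate (V W : normedModType K) (f : V -> W)
    (L : {linear V -> W}) (a : V) : continuous L ->
  (forall e : K, 0 < e ->
    \forall h \near (0 : V), `|f (h + a) - f a - L h| <= e * `|h|) ->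
  differentiable f a.
Proof.
move=> Lc H.
have e : f \o shift a = cst (f a) + L +o_ 0 id.
  apply/eqaddoP => _/posnumP[e].
  have e0 : 0 < e%:num by [].
  have He := H _ e0; near=> h.
  rewrite -[X in `|X| <= _]/(f (h + a) - (f a + L h)) opprD addrA.
  exact: (near He h).
have dL := @diff_unique _ _ _ f L a Lc e.
by apply/diff_locallyP; rewrite dL.
Unshelve. all: by end_near. Qed.

Lemma hol_differentiable n (f : 'rV[K]_n -> K) a g : hol f a g -> differentiable f a.
Proof.
move=> [Q [Qg Qc Qe]].
pose df (h : 'rV[K]_n) : K := (h *m \col_i g i) ord0 ord0.
have dfE h : df h = \sum_i h ord0 i * g i.
  by rewrite /df mxE; apply: eq_bigr => i _; rewrite mxE.
have dfl : linear df.
  move=> k u v; rewrite !dfE scaler_sumr -big_split/=; apply: eq_bigr => i _.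
  by rewrite !mxE mulrDl -mulrA.
pose dfL := GRing.isLinear.Build K 'rV[K]_n K _ df dfl.
pose L : {linear 'rV[K]_n -> K} := HB.pack df dfL.
have Lc : continuous L.
  move=> x; have -> : (L : _ -> _) = (fun h : 'rV[K]_n => \sum_i h ord0 i * g i).
    by apply/funext => h; exact: dfE.
  apply: continuous_at_sum => i; apply: continuous_at_mul; first exact: continuous_at_coord.
  exact: continuous_at_cst.
apply: (differentiable_of_estimate (L := L) Lc) => e e0.
have n0 : 0 < (n.+1)%:R :> K by rewrite ltr0n.
have c : continuous_at (0 : 'rV[K]_n) (fun h => (h + a, a)).
  apply: continuous_at_pair; last exact: continuous_at_cst.
  exact: cvgD (@cvg_id _ _) (cvg_cst _).
have h1 : \forall h \near (0 : 'rV[K]_n), forall i, `|Q i (h + a, a) - g i| < e / n.+1%:R.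
  apply: near_forall => i.
  have c1 : continuous_at (0 : 'rV[K]_n) (fun h => Q i (h + a, a)).
    apply: (continuous_at_comp (h := Q i) c).
    by rewrite add0r; exact: (nbhs_singleton Qc).
  have /cvgrPdist_lt/(_ (e / n.+1%:R)) := c1; rewrite add0r Qg.
  move=> H; have {H} := H (divr_gt0 e0 n0).
  by apply: filterS => h; rewrite distrC.
have h2 : \forall h \near (0 : 'rV[K]_n), f (h + a) - f a =
    \sum_i h ord0 i * Q i (h + a, a).
  have c0 : (fun h : 'rV[K]_n => (h + a, a)) @ (0 : 'rV[K]_n) --> (a, a).
    by have := c; rewrite /continuous_at add0r.
  have h3 : \forall h \near (0 : 'rV[K]_n),
    f (h + a) - f a = \sum_i ((h + a) ord0 i - a ord0 i) * Q i (h + a, a).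
    exact: c0 _ Qe.
  near=> h; rewrite (near h3 h)//.
  by apply: eq_bigr => i _; rewrite mxE addrK.
near=> h.
have -> : f (h + a) - f a - L h = \sum_i h ord0 i * (Q i (h + a, a) - g i).
  rewrite (near h2 h)// -[L h]/(df h) dfE -sumrB.
  by apply: eq_bigr => i _; rewrite mulrBr.
have hc i : `|h ord0 i| <= `|h|.
  have -> : `|h| = mx_norm h by [].
  by rewrite /mx_norm -[leLHS]nngE num_le; exact: (@le_bigmax _ _ _ _ _ (ord0, i)).
apply: (le_trans (ler_norm_sum _ _ _)).
apply: (@le_trans _ _ (\sum_(i < n) `|h| * (e / n.+1%:R))).
  apply: ler_sum => i _; rewrite normrM ler_pM//.
  by apply: ltW; move: i; near: h.
rewrite sumr_const card_ord -[leLHS]mulr_natr -mulrA mulrC ler_wpM2r//.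
by rewrite -mulrA ger_pMr// mulrC ler_pdivrMr// mul1r ler_nat.
Unshelve. all: by end_near. Qed.

Lemma hol_differentiable_row m n (F : 'rV[K]_n -> 'rV[K]_m) a (g : 'I_m -> 'I_n -> K) :
  (forall j, hol (fun x => F x ord0 j) a (g j)) -> differentiable F a.
Proof.
move=> h.
have -> : F = \sum_j (fun x => F x ord0 j *: (delta_mx ord0 j : 'rV[K]_m)).
  by apply/funext => x; rewrite fct_sumE -row_sum_delta.
apply: differentiable_sum => j; apply: differentiableZl.
exact: hol_differentiable (h j).
Qed.

End Hol.

(** * The holomorphic inverse function theorem *)

Lemma lipschitz_continuous_at (K : numFieldType) (V W : normedModType K)
    (G : V -> W) (u : V) (L : K) :
  0 < L -> (\forall v \near u, `|G u - G v| <= L * `|u - v|) -> continuous_at u G.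
Proof.
move=> L0 h; apply/cvgrPdist_lt => e e0.
have e1 : 0 < e / L by rewrite divr_gt0.
have h1 : \forall v \near u, `|u - v| < e / L.
  have /cvgrPdist_lt h1 : id @ u --> u by exact: cvg_id.
  exact: h1 _ e1.
near=> v; apply: (@le_lt_trans _ _ (L * `|u - v|)); first by near: v.
by rewrite mulrC -ltr_pdivlMr//; near: v.
Unshelve. all: by end_near. Qed.

Section ContinuousDet.
Variables (K : numFieldType) (T : topologicalType).

Lemma continuous_at_det n (M : T -> 'M[K]_n) x :
  (forall i j, continuous_at x (fun y => M y i j)) ->
  continuous_at x (fun y => \det (M y)).
Proof.
move=> h; apply: continuous_at_sum => s; apply: continuous_at_mul.
  exact: continuous_at_cst.
by apply: continuous_at_prod => i.
Qed.

Lemma continuous_at_adj n (M : T -> 'M[K]_n) x i j :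
  (forall i j, continuous_at x (fun y => M y i j)) ->
  continuous_at x (fun y => (\adj (M y)) i j).
Proof.
move=> h.
have -> : (fun y => (\adj (M y)) i j) =
    (fun y => (-1) ^+ (j + i) * \det (row' j (col' i (M y)))).
  by apply/funext => y; rewrite mxE.
apply: continuous_at_mul; first exact: continuous_at_cst.
apply: continuous_at_det => k l.
have -> : (fun y => row' j (col' i (M y)) k l) =
    (fun y => M y (lift j k) (lift i l)) by apply/funext => y; rewrite !mxE.
exact: h.
Qed.

End ContinuousDet.

Section Complete.
Variable R : realType.
Local Notation C := (Cx R).

(** The sequences u - e and u + e, with e k the sum of the remaining steps, are
    monotone in opposite directions; the limit is the supremum of the first. *)
Lemma geometric_limit_real (u : nat -> R) (M : R) :
  (forall k, `|u k.+1 - u k| <= M / 2 ^+ k) ->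
  exists l, forall k, `|u k - l| <= M * 2 / 2 ^+ k.
Proof.
move=> h; pose e k := M * 2 / 2 ^+ k : R.
have eS k : e k = e k.+1 + M / 2 ^+ k.
  rewrite /e exprS; have : (2 : R) ^+ k != 0 by rewrite expf_neq0.
  by move=> ?; field.
have lo k : u k - e k <= u k.+1 - e k.+1.
  by have := h k; rewrite ler_norml (eS k) => /andP[]; lra.
have up k : u k.+1 + e k.+1 <= u k + e k.
  by have := h k; rewrite ler_norml (eS k) => /andP[]; lra.
have e0 k : 0 <= e k.
  have M0 : 0 <= M by have := h 0%N; rewrite expr0 divr1; exact: le_trans.
  by rewrite /e !mulr_ge0// invr_ge0 exprn_ge0.
have lon m k : u m - e m <= u (m + k)%N - e (m + k)%N.
  elim: k => [|k IH]; first by rewrite addn0.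
  by rewrite addnS; exact: le_trans IH (lo _).
have upn m k : u (m + k)%N + e (m + k)%N <= u m + e m.
  elim: k => [|k IH]; first by rewrite addn0.
  by rewrite addnS; exact: le_trans (up _) IH.
have lu m k : u m - e m <= u k + e k.
  have := lon m k; have := upn k m; rewrite addnC; have := e0 (m + k)%N; lra.
pose A := range (fun k => u k - e k).
have A0 : A !=set0 by exists (u 0%N - e 0%N); exists 0%N.
exists (sup A) => k.
have h1 : u k - e k <= sup A.
  apply: sup_upper_bound; last by exists k.
  by split=> //; exists (u 0%N + e 0%N) => _ [m _ <-].
have h2 : sup A <= u k + e k by apply: ge_sup => // _ [m _ <-].
by rewrite ler_norml -/(e k); apply/andP; split; lra.
Qed.

Lemma normc_ge_Im (x : C) : (`|complex.Im x|)%:C%C <= `|x|.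
Proof.
rewrite normc_def lecR -sqrtr_sqr ler_sqrt ?lerDr ?sqr_ge0//.
by rewrite addr_ge0 ?sqr_ge0.
Qed.

(** Completeness of the complex numbers in the only form that the contraction
    argument uses, from the real and imaginary parts. *)
Lemma geometric_limit (u : nat -> C) (M : C) :
  (forall k, `|u k.+1 - u k| <= M / 2 ^+ k) ->
  exists l, forall k, `|u k - l| <= M * 4 / 2 ^+ k.
Proof.
move=> h.
have M0 : 0 <= M by have := h 0%N; rewrite expr0 divr1; exact: le_trans.
have ME : M = (complex.Re M)%:C%C.
  by apply/esym/RRe_real; rewrite realE M0.
have pE k (x : R) : x%:C%C / 2 ^+ k = ((x / 2 ^+ k)%:C)%C :> C.
  by rewrite rmorphM /= fmorphV rmorphXn /= rmorph_nat.
have [a ha] : exists l, forall k, `|complex.Re (u k) - l| <= complex.Re M * 2 / 2 ^+ k.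
  apply: geometric_limit_real => k.
  have := le_trans (normc_ge_Re _) (h k).
  by rewrite ME pE lecR raddfB.
have [b hb] : exists l, forall k, `|complex.Im (u k) - l| <= complex.Re M * 2 / 2 ^+ k.
  apply: geometric_limit_real => k.
  have := le_trans (normc_ge_Im _) (h k).
  by rewrite ME pE lecR raddfB.
exists (a +i* b)%C => k.
have -> : u k - (a +i* b)%C = (complex.Re (u k) - a)%:C%C + 'i%C * (complex.Im (u k) - b)%:C%C.
  by case: (u k) => x y; simpc.
apply: le_trans (ler_normD _ _) _.
rewrite normrM.
have -> : M * 4 / 2 ^+ k = ((complex.Re M * 2 / 2 ^+ k)%:C + (complex.Re M * 2 / 2 ^+ k)%:C)%C.
  rewrite -!pE -mulrDl -rmorphD /= -mulrDr !rmorphM /= -ME.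
  by congr (_ * _ / _); rewrite -[2%:R + 2%:R]natrD rmorph_nat.
have ni : `|'i%C : C| = 1 by rewrite normc_def /= expr0n expr1n add0r sqrtr1.
have nr (x : R) : `|x%:C%C : C| = (`|x|)%:C%C.
  by rewrite normc_def /= expr0n addr0 sqrtr_sqr.
by rewrite ni mul1r !nr; apply: lerD; rewrite lecR.
Qed.

Lemma eq0_of_geometric (c M : C) : 0 <= c -> (forall k, c <= M / 2 ^+ k) -> c = 0.
Proof.
move=> c0 h.
have M0 : 0 <= M by have := h 0%N; rewrite expr0 divr1; exact: le_trans.
have cE : (complex.Re c)%:C%C = c by apply/RRe_real; rewrite realE c0.
have ME : (complex.Re M)%:C%C = M by apply/RRe_real; rewrite realE M0.
have pE k (x : R) : x%:C%C / 2 ^+ k = ((x / 2 ^+ k)%:C)%C :> C.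
  by rewrite rmorphM /= fmorphV rmorphXn /= rmorph_nat.
have {}h k : complex.Re c <= complex.Re M / 2 ^+ k.
  by have := h k; rewrite -cE -ME pE lecR.
rewrite -cE; congr (_%:C)%C; apply/eqP; rewrite eq_le; apply/andP; split; last first.
  by move: c0; rewrite -cE lecR.
rewrite leNgt; apply/negP => cp.
have [k hk] : exists k : nat, complex.Re M / complex.Re c < k%:R.
  exists (Num.bound (complex.Re M / complex.Re c)).
  by apply: archi_boundP; rewrite divr_ge0 ?(ltW cp)// -lecR ME.
have := h k; rewrite ler_pdivlMr ?exprn_gt0//.
apply/negP; rewrite -ltNge mulrC -ltr_pdivrMr//.
apply: lt_trans hk _; rewrite -natrX ltr_nat; exact: ltn_expl.
Qed.

(** Iterating from a moves each coordinate by at most r / 8 times a geometric series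
    of sum 2, so the orbit stays in the polydisc of radius r.  Estimates are
    coordinatewise, which keeps every bound a scalar of C. *)
Lemma contraction_fixpoint n (a : 'rV[C]_n) (T : 'rV[C]_n -> 'rV[C]_n) (r : C) :
  0 < r ->
  (forall (p q : 'rV[C]_n) (m : C), (forall i, `|p ord0 i - a ord0 i| <= r) ->
    (forall i, `|q ord0 i - a ord0 i| <= r) ->
    (forall i, `|p ord0 i - q ord0 i| <= m) ->
     forall i, `|T p ord0 i - T q ord0 i| <= m / 2) ->
  (forall i, `|T a ord0 i - a ord0 i| <= r / 8) ->
  exists2 l : 'rV[C]_n, forall i, `|l ord0 i - a ord0 i| <= r & T l = l.
Proof.
move=> r0 Tc Ta; pose x k := iter k T a.
have p2 k : (2 : C) ^+ k != 0 by rewrite expf_neq0.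
have p20 k : 0 < (2 : C) ^+ k by rewrite exprn_gt0.
have r4 k : r / 4 * (1 - 1 / 2 ^+ k) <= r.
  rewrite -[leRHS]mulr1 ler_pM ?divr_ge0 ?(ltW r0)//.
  - by rewrite subr_ge0 mul1r invf_le1 ?exprn_ege1// ler1n.
  - by rewrite ler_pdivrMr// ler_peMr ?(ltW r0)// ler1n.
have P k : (forall i, `|x k ord0 i - a ord0 i| <= r / 4 * (1 - 1 / 2 ^+ k)) /\
  (forall i, `|x k.+1 ord0 i - x k ord0 i| <= r / 8 / 2 ^+ k).
  elim: k => [|k [IH1 IH2]].
    by split=> i; rewrite ?expr0 ?divr1 ?subrr ?mulr0 ?normr0 //= Ta.
  have h i : `|x k.+1 ord0 i - a ord0 i| <= r / 4 * (1 - 1 / 2 ^+ k.+1).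
    have -> : x k.+1 ord0 i - a ord0 i =
       (x k.+1 ord0 i - x k ord0 i) + (x k ord0 i - a ord0 i) by ring.
    apply: le_trans (ler_normD _ _) _; apply: le_trans (lerD (IH2 i) (IH1 i)) _.
    by rewrite le_eqVlt; apply/orP; left; apply/eqP; rewrite exprS; have := p2 k => ?; field.
  split=> // i; rewrite exprSr invfM mulrA.
  by apply: Tc => // j; [exact: le_trans (h j) (r4 _)|exact: le_trans (IH1 j) (r4 _)].
have /choice[l hl] : forall i, exists l, forall k, `|x k ord0 i - l| <= r / 8 * 4 / 2 ^+ k.
  by move=> i; apply: geometric_limit => k; have [_] := P k; apply.
have la i : `|l i - a ord0 i| <= r.
  rewrite distrC; apply: le_trans (hl i 0%N) _.
  rewrite expr0 divr1 -mulrA ler_piMr ?(ltW r0)//.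
  have -> : 8^-1 * 4 = 2^-1 :> C by field.
  by rewrite invf_le1 ?ler1n.
exists (\row_i l i); first by move=> i; rewrite mxE.
apply/rowP => i; rewrite mxE; apply/eqP; rewrite -subr_eq0 -normr_eq0; apply/eqP.
apply: (@eq0_of_geometric _ (r / 2)) => // k.
have -> : T (\row_i l i) ord0 i - l i =
   (T (\row_i l i) ord0 i - x k.+1 ord0 i) + (x k.+1 ord0 i - l i) by ring.
apply: le_trans (ler_normD _ _) _.
have -> : r / 2 / 2 ^+ k = r / 8 * 4 / 2 ^+ k / 2 + r / 8 * 4 / 2 ^+ k.+1.
  by rewrite exprS; have := p2 k => ?; field.
apply: lerD; last exact: hl.
apply: Tc => j; rewrite ?mxE//; last by rewrite distrC.
by have [h _] := P k; exact: le_trans (h j) (r4 _).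
Qed.

End Complete.

Section InverseFunction.
Variable R : realType.
Local Notation C := (Cx R).

Lemma mx_norm_le n (x : 'rV[C]_n) (e : C) : 0 <= e ->
  (forall i, `|x ord0 i| <= e) -> `|x| <= e.
Proof.
move=> e0 h; have -> : `|x| = mx_norm x by [].
have [/eqP->//|/mx_norm_neq0[[i j] ->]] := boolP (mx_norm x == 0).
by rewrite ord1.
Qed.

Lemma mx_norm_ge n (x : 'rV[C]_n) i : `|x ord0 i| <= `|x|.
Proof.
have -> : `|x| = mx_norm x by [].
by rewrite /mx_norm -[leLHS]nngE num_le; exact: (@le_bigmax _ _ _ _ _ (ord0, i)).
Qed.

Lemma near_ball n (a : 'rV[C]_n) (P : 'rV[C]_n -> Prop) :
  (\forall x \near a, P x) -> exists2 r : C, 0 < r & forall x, `|x - a| <= r -> P x.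
Proof.
move=> /nbhs_ballP[e /= e0 h]; exists (e / 2); first by rewrite divr_gt0.
move=> x xr; apply: h; rewrite -ball_normE /= distrC; apply: le_lt_trans xr _.
by rewrite ltr_pdivrMr// ltr_pMr// ltr1n.
Qed.

Lemma near2_ball n (a : 'rV[C]_n) (P : 'rV[C]_n * 'rV[C]_n -> Prop) :
  (\forall x \near (a, a), P x) ->
  exists2 r : C, 0 < r & forall x y, `|x - a| <= r -> `|y - a| <= r -> P (x, y).
Proof.
move=> [[A B] /= [/near_ball[r r0 hA] /near_ball[s s0 hB]] AB].
exists (r * s / (r + s)); first by rewrite divr_gt0 ?mulr_gt0 ?addr_gt0.
have rs : 0 < r + s by rewrite addr_gt0.
move=> x y xr yr; apply: AB; split=> /=.
  apply: hA; apply: le_trans xr _; rewrite ler_pdivrMr// ler_pM2l//.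
  by rewrite lerDr ltW.
apply: hB; apply: le_trans yr _; rewrite ler_pdivrMr// mulrC ler_pM2l//.
by rewrite lerDl ltW.
Qed.

(** The difference quotients of F form a matrix M with
    F p - F q = (p - q) M (p, q), and M (a, a), the transposed Jacobian, is
    invertible because its kernel is zero.  Hence the Newton map with the frozen
    inverse B0 of M (a, a) is a contraction near a and F x = u is solvable.
    Inverting M also gives G u - G v = (u - v) M (G u, G v)^-1; by Cramer the
    entries of this inverse are continuous, so they are quotients for G. *)
Theorem inverse_function n (F : 'I_n -> 'rV[C]_n -> C) a (J : 'I_n -> 'I_n -> C) :
  (forall j, hol (F j) a (J j)) ->
  (forall v : 'rV[C]_n, (forall j, \sum_i v ord0 i * J j i = 0) -> v = 0) ->
  exists G : 'rV[C]_n -> 'rV[C]_n,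
  [/\ G (\row_j F j a) = a,
      forall j, exists g, hol (fun u => G u ord0 j) (\row_j F j a) g,
      \forall u \near \row_j F j a, \row_j F j (G u) = u &
      \forall x \near a, G (\row_j F j x) = x].
Proof.
move=> hF ker0; pose Fr x : 'rV[C]_n := \row_j F j x.
have /choice[Q hQ] := hF.
pose Mx pq : 'M[C]_n := \matrix_(i, j) Q j i pq.
have Mc pq : (forall j i, continuous_at pq (Q j i)) ->
    forall i j, continuous_at pq (fun pq => Mx pq i j).
  move=> c i j; have -> : (fun pq => Mx pq i j) = Q j i by apply/funext => ?; rewrite mxE.
  exact: c.
have Qc : \forall pq \near (a, a), forall j i, continuous_at pq (Q j i).
  by apply: near_forall => j; have [] := hQ j.
have E1 : \forall pq \near (a, a), Fr pq.1 - Fr pq.2 = (pq.1 - pq.2) *m Mx pq.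
  have : \forall pq \near (a, a), forall j,
      F j pq.1 - F j pq.2 = \sum_i (pq.1 ord0 i - pq.2 ord0 i) * Q j i pq.
    by apply: near_forall => j; have [] := hQ j.
  apply: filterS => pq h; apply/rowP => j; rewrite !mxE h.
  by apply: eq_bigr => i _; rewrite !mxE.
have Mu : Mx (a, a) \in unitmx.
  rewrite -row_free_unit; apply/row_freeP.
  apply/row_freeP; rewrite -kermx_eq0; apply/eqP/row_matrixP => k; rewrite row0.
  apply: ker0 => j.
  have : row k (kermx (Mx (a, a))) *m Mx (a, a) = 0.
    by rewrite -row_mul mulmx_ker row0.
  move=> /rowP/(_ j); rewrite !mxE => h; rewrite -[RHS]h; apply: eq_bigr => i _.
  by rewrite [Mx _ _ _]mxE; have [-> _ _] := hQ j; rewrite !mxE.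
(* The Newton map below keeps this inverse fixed. *)
pose B0 := invmx (Mx (a, a)).
have D1 : \forall pq \near (a, a), \det (Mx pq) != 0.
  have c : continuous_at (a, a) (fun pq => \det (Mx pq)).
    by apply: continuous_at_det; apply: Mc; exact: (nbhs_singleton Qc).
  have d0 : \det (Mx (a, a)) != 0 by rewrite -unitfE -unitmxE.
  exact: (cvgr_neq0 _ c d0).
(* Entries this small make 1 - M B0 halve the coordinatewise sup norm; n.+1 instead
   of n covers dimension 0. *)
have n0 : 0 < (2 * n.+1%:R)^-1 :> C by rewrite invr_gt0 mulr_gt0 ?ltr0n.
have S1 : \forall pq \near (a, a), forall i j,
    `|((1%:M : 'M[C]_n) - Mx pq *m B0) i j| <= (2 * n.+1%:R)^-1.
  apply: near_forall => i; apply: near_forall => j.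
  have c : continuous_at (a, a) (fun pq => ((1%:M : 'M[C]_n) - Mx pq *m B0) i j).
    have -> : (fun pq => ((1%:M : 'M[C]_n) - Mx pq *m B0) i j) =
      (fun pq => (1%:M : 'M[C]_n) i j + - \sum_k (Mx pq i k * B0 k j)).
      by apply/funext => pq; rewrite !mxE.
    apply: continuous_at_add; first exact: continuous_at_cst.
    apply: continuous_at_opp; apply: continuous_at_sum => k.
    apply: continuous_at_mul; last exact: continuous_at_cst.
    by apply: Mc; exact: (nbhs_singleton Qc).
  have /cvgrPdist_le/(_ _ n0) := c.
  rewrite /B0 mulmxV// subrr mxE; apply: filterS => pq.
  by rewrite sub0r normrN.
have [r r0 hr] : exists2 r : C, 0 < r & forall p q, `|p - a| <= r -> `|q - a| <= r ->
   [/\ Fr p - Fr q = (p - q) *m Mx (p, q), \det (Mx (p, q)) != 0,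
      forall j i, continuous_at (p, q) (Q j i) &
      forall i j, `|((1%:M : 'M[C]_n) - Mx (p, q) *m B0) i j| <= (2 * n.+1%:R)^-1].
  have : \forall pq \near (a, a),
   [/\ Fr pq.1 - Fr pq.2 = (pq.1 - pq.2) *m Mx pq, \det (Mx pq) != 0,
      forall j i, continuous_at pq (Q j i) &
      forall i j, `|((1%:M : 'M[C]_n) - Mx pq *m B0) i j| <= (2 * n.+1%:R)^-1].
    near=> pq; split.
    - exact: (near E1 pq).
    - exact: (near D1 pq).
    - exact: (near Qc pq).
    - exact: (near S1 pq).
  by move=> /near2_ball[r r0 h]; exists r => // p q /h{}h/h.
have half (p q : 'rV[C]_n) (m : C) : `|p - a| <= r -> `|q - a| <= r ->
    (forall i, `|p ord0 i - q ord0 i| <= m) ->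
    forall j, `|((p - q) *m (1%:M - Mx (p, q) *m B0)) ord0 j| <= m / 2.
  move=> pr qr pq j; have [_ _ _ h] := hr p q pr qr.
  have m0 : 0 <= m by exact: le_trans (pq j).
  rewrite mxE; apply: le_trans (ler_norm_sum _ _ _) _.
  apply: (@le_trans _ _ (\sum_(i < n) m * (2 * n.+1%:R)^-1)).
    by apply: ler_sum => i _; rewrite normrM ler_pM// !mxE.
  rewrite sumr_const card_ord -[leLHS]mulr_natr -mulrA ler_wpM2l// invfM -mulrA.
  by rewrite ger_pMr ?invr_gt0// mulrC ler_pdivrMr ?ltr0n// mul1r ler_nat.
have diffT p q : `|p - a| <= r -> `|q - a| <= r ->
   (p - q) - (Fr p - Fr q) *m B0 = (p - q) *m (1%:M - Mx (p, q) *m B0).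
  by move=> pr qr; have [-> _ _ _] := hr p q pr qr; rewrite mulmxBr mulmx1 mulmxA.
have coordn (p : 'rV[C]_n) : (forall i, `|p ord0 i - a ord0 i| <= r) -> `|p - a| <= r.
  by move=> h; apply: mx_norm_le; [exact: ltW|move=> i; rewrite !mxE].
have sol u : (forall i, `|((Fr a - u) *m B0) ord0 i| <= r / 8) ->
    exists2 x, `|x - a| <= r & Fr x = u.
  move=> hu; pose T p := p - (Fr p - u) *m B0.
  have [|i|x xr Tx] := @contraction_fixpoint R n a T r r0.
  - move=> p q m /coordn pr /coordn qr pq i.
    have := half p q m pr qr pq i; rewrite -diffT// /T.
    have -> : Fr p - Fr q = (Fr p - u) - (Fr q - u) by rewrite opprB addrA subrK.
    rewrite (mulmxBl (Fr p - u)).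
    move: ((Fr p - u) *m B0) ((Fr q - u) *m B0) => X Y.
    congr (`|_| <= _).
    by rewrite !mxE; move: (p _ _) (q _ _) (X _ _) (Y _ _) => *; ring.
  - have := hu i; rewrite /T; move: ((Fr a - u) *m B0) => X.
    by rewrite !mxE addrAC subrr add0r normrN.
  exists x; first exact: coordn.
  have : (Fr x - u) *m B0 = 0.
    by have := congr1 (fun z => x - z) Tx; rewrite /T subrr opprB addrC subrK.
  move=> /(congr1 (mulmx^~ (Mx (a, a)))); rewrite mulmxKV// mul0mx => /eqP.
  by rewrite subr_eq0 => /eqP.
have inj p q : `|p - a| <= r -> `|q - a| <= r -> Fr p = Fr q -> p = q.
  move=> pr qr e; have [] := hr p q pr qr; rewrite e subrr => /esym h d _ _.
  have u : Mx (p, q) \in unitmx by rewrite unitmxE unitfE.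
  apply/eqP; rewrite -subr_eq0; apply/eqP.
  by rewrite -[LHS](mulmxK u) h mul0mx.
pose G u := xget a [set x | `|x - a| <= r /\ Fr x = u].
have GP u : (forall i, `|((Fr a - u) *m B0) ord0 i| <= r / 8) ->
    `|G u - a| <= r /\ Fr (G u) = u.
  move=> /sol[x xr Fx]; rewrite /G.
  by case: xgetP => [y _ //|/(_ x)]; case.
have GF x : `|x - a| <= r -> G (Fr x) = x.
  move=> xr; rewrite /G; case: xgetP => [y _ [yr Fy]|/(_ x)]; last by case.
  exact: inj.
have H1 : \forall u \near Fr a, `|G u - a| <= r /\ Fr (G u) = u.
  have : \forall u \near Fr a, forall i, `|((Fr a - u) *m B0) ord0 i| <= r / 8.
    apply: near_forall => i.
    have c : continuous_at (Fr a) (fun u => ((Fr a - u) *m B0) ord0 i).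
      have -> : (fun u => ((Fr a - u) *m B0) ord0 i) =
         (fun u : 'rV[C]_n => \sum_k ((Fr a ord0 k + - u ord0 k) * B0 k i)).
        by apply/funext => u; rewrite !mxE; apply: eq_bigr => k _; rewrite !mxE.
      apply: continuous_at_sum => k; apply: continuous_at_mul; last exact: continuous_at_cst.
      apply: continuous_at_add; first exact: continuous_at_cst.
      by apply: continuous_at_opp; exact: continuous_at_coord.
    have r8 : 0 < r / 8 by rewrite divr_gt0.
    have /cvgrPdist_le/(_ _ r8) := c.
    by rewrite subrr mul0mx mxE; apply: filterS => u; rewrite sub0r normrN.
  by apply: filterS => u; exact: GP.
pose K := 1 + \sum_i \sum_j `|B0 i j|.
have K0 : 0 < K.
  by rewrite ltr_wpDr// sumr_ge0// => i _; rewrite sumr_ge0.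
have lip u v : `|G u - a| <= r -> Fr (G u) = u -> `|G v - a| <= r -> Fr (G v) = v ->
    `|G u - G v| <= (2 * K) * `|u - v|.
  move=> ur Fu vr Fv.
  (* The first term comes from the contraction and is absorbed on the left. *)
  have h : `|G u - G v| <= `|G u - G v| / 2 + K * `|u - v|.
    apply: mx_norm_le; first by rewrite addr_ge0 ?divr_ge0 ?mulr_ge0 ?(ltW K0).
    move=> j.
    have -> : (G u - G v) ord0 j =
        ((G u - G v) *m (1%:M - Mx (G u, G v) *m B0)) ord0 j
        + ((Fr (G u) - Fr (G v)) *m B0) ord0 j.
      by rewrite -diffT//; move: (_ *m B0) => X; rewrite !mxE subrK.
    apply: le_trans (ler_normD _ _) _; apply: lerD.
      by apply: half => // i; have := mx_norm_ge (G u - G v) i; rewrite !mxE.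
    rewrite Fu Fv mxE; apply: le_trans (ler_norm_sum _ _ _) _.
    apply: (@le_trans _ _ (\sum_i `|B0 i j| * `|u - v|)).
      by apply: ler_sum => i _; rewrite normrM mulrC ler_wpM2l// mx_norm_ge.
    rewrite -mulr_suml ler_wpM2r//.
    apply: (@le_trans _ _ (\sum_i \sum_j `|B0 i j|)); last by rewrite /K lerDr.
    apply: ler_sum => i _; rewrite (bigD1 j)//= lerDl sumr_ge0//.
  rewrite -mulrA mulrC -ler_pdivrMr//.
  have {h} : `|G u - G v| - `|G u - G v| / 2 <= K * `|u - v| by rewrite lerBlDl.
  by congr (_ <= _); field.
have Gc : \forall u \near Fr a, continuous_at u G.
  have H2 := near_near H1; near=> u.
  apply: (@lipschitz_continuous_at _ _ _ _ _ (2 * K)); first by rewrite mulr_gt0.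
  have [ur Fu] : `|G u - a| <= r /\ Fr (G u) = u by near: u.
  have : \forall v \near u, `|G v - a| <= r /\ Fr (G v) = v by near: u.
  by apply: filterS => v [vr Fv]; exact: lip.
have H11 := near2_fst (Fr a) H1; have H12 := near2_snd (Fr a) H1.
have Gc1 := near2_fst (Fr a) Gc; have Gc2 := near2_snd (Fr a) Gc.
exists G; split.
- by apply: GF; rewrite subrr normr0 ltW.
- move=> j.
  pose P i uv := (\det (Mx (G uv.1, G uv.2)))^-1 * (\adj (Mx (G uv.1, G uv.2))) i j.
  exists (fun i => P i (Fr a, Fr a)), P; split=> //.
  + near=> uv => i.
    have [ur Fu] : `|G uv.1 - a| <= r /\ Fr (G uv.1) = uv.1 by exact: (near H11 uv).
    have [vr Fv] : `|G uv.2 - a| <= r /\ Fr (G uv.2) = uv.2 by exact: (near H12 uv).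
    have [_ d c _] := hr _ _ ur vr.
    have cG : continuous_at uv (fun uv => (G uv.1, G uv.2)).
      apply: continuous_at_pair.
        by apply: continuous_at_fst; exact: (near Gc1 uv).
      by apply: continuous_at_snd; exact: (near Gc2 uv).
    apply: continuous_at_mul.
      apply: continuous_at_inv => //.
      apply: (continuous_at_comp (h := fun pq => \det (Mx pq)) cG).
      by apply: continuous_at_det; exact: Mc.
    apply: (continuous_at_comp (h := fun pq => (\adj (Mx pq)) i j) cG).
    by apply: continuous_at_adj; exact: Mc.
  + near=> uv.
    have [ur Fu] : `|G uv.1 - a| <= r /\ Fr (G uv.1) = uv.1 by exact: (near H11 uv).
    have [vr Fv] : `|G uv.2 - a| <= r /\ Fr (G uv.2) = uv.2 by exact: (near H12 uv).
    have [e d _ _] := hr _ _ ur vr.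
    have u : Mx (G uv.1, G uv.2) \in unitmx by rewrite unitmxE unitfE.
    have : G uv.1 - G uv.2 = (uv.1 - uv.2) *m invmx (Mx (G uv.1, G uv.2)).
      by rewrite -[LHS](mulmxK u) -e Fu Fv.
    move=> /rowP/(_ j); rewrite /invmx u !mxE => ->; apply: eq_bigr => i _.
    by rewrite /P; move: (\adj _) => A; rewrite !mxE.
- by apply: filterS H1 => u [].
- have : \forall x \near a, `|a - x| < r.
    by have /cvgrPdist_lt/(_ _ r0) := @cvg_id _ (nbhs a).
  by apply: filterS => x xr; apply: GF; rewrite distrC ltW.
Unshelve. all: by end_near. Qed.

End InverseFunction.

(** * Germs of coordinates *)

Lemma near_mono (T : topologicalType) (x : T) (P Q : T -> Prop) :
  (forall y, P y -> Q y) -> (\forall y \near x, P y) -> \forall y \near x, Q y.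
Proof. by move=> PQ; apply: filterS. Qed.

Lemma near_and (T : topologicalType) (x : T) (P Q : T -> Prop) :
  (\forall y \near x, P y) -> (\forall y \near x, Q y) ->
  \forall y \near x, P y /\ Q y.
Proof. exact: filterI. Qed.

Lemma near_all (T : topologicalType) (x : T) (P : T -> Prop) :
  (forall y, P y) -> \forall y \near x, P y.
Proof. by move=> h; exact: nearW. Qed.

Section Holo.
Variables (R : realType) (n : nat).
Local Notation C := (Cx R).
Implicit Types (f h : 'rV[C]_n -> C) (a : 'rV[C]_n).

Definition holo f a := exists g, hol f a g.

Lemma holo_cst (c : C) a : holo (fun=> c) a.
Proof. by exists (fun=> 0); exact: hol_cst. Qed.

Lemma holo_add f h a : holo f a -> holo h a -> holo (fun x => f x + h x) a.
Proof. by move=> [g hf] [g' hh]; eexists; exact: hol_add hf hh. Qed.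

Lemma holo_mul f h a : holo f a -> holo h a -> holo (fun x => f x * h x) a.
Proof. by move=> [g hf] [g' hh]; eexists; exact: hol_mul hf hh. Qed.

Lemma holo_opp f a : holo f a -> holo (fun x => - f x) a.
Proof. by move=> [g hf]; eexists; exact: hol_opp hf. Qed.

Lemma holo_exp f a k : holo f a -> holo (fun x => f x ^+ k) a.
Proof. by move=> [g hf]; eexists; exact: hol_exp hf. Qed.

Lemma holo_inv f a : f a != 0 -> holo f a -> holo (fun x => (f x)^-1) a.
Proof. by move=> f0 [g hf]; eexists; exact: hol_inv f0 hf. Qed.

Lemma holo_continuous f a : holo f a -> continuous_at a f.
Proof. by move=> [g]; exact: hol_continuous. Qed.

Lemma holo_neq0 f a : holo f a -> f a != 0 -> \forall x \near a, f x != 0.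
Proof. by move=> /holo_continuous c fa; exact: (cvgr_neq0 _ c fa). Qed.

Lemma hol_horner (p : {poly C}) f a g : hol f a g ->
  hol (fun x => p.[f x]) a (fun i => p^`().[f a] * g i).
Proof.
move=> hf; elim/poly_ind: p => [|p c IH].
  apply: (@hol_eq _ _ _ (fun=> 0)); first by near=> x; rewrite horner0.
  by apply: hol_grad (hol_cst 0 a) => i; rewrite deriv0 horner0 mul0r.
apply: (@hol_eq _ _ _ (fun x => p.[f x] * f x + c)).
  by near=> x; rewrite hornerMXaddC.
apply: hol_grad (hol_add (hol_mul IH hf) (hol_cst c a)) => i /=.
by rewrite derivMXaddC hornerD hornerMX; ring.
Unshelve. all: by end_near. Qed.

End Holo.

Section Displacements.
Variable R : realType.
Local Notation C := (Cx R).
Local Notation C2 := 'rV[C]_2.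
Implicit Types q : C2.

Definition dy (q p : C2) : C := p ord0 ord0 - q ord0 ord0.
Definition dz (q p : C2) : C := p ord0 ord_max - q ord0 ord_max.

Lemma dy0 q : dy q q = 0. Proof. exact: subrr. Qed.
Lemma dz0 q : dz q q = 0. Proof. exact: subrr. Qed.

Lemma hol_dy q : hol (dy q) q (fun i => (i == ord0)%:R).
Proof.
apply: hol_grad (hol_add (hol_coord ord0 q) (hol_cst (- q ord0 ord0) q)) => i.
by rewrite addr0.
Qed.

Lemma hol_dz q : hol (dz q) q (fun i => (i == ord_max)%:R).
Proof.
apply: hol_grad (hol_add (hol_coord ord_max q) (hol_cst (- q ord0 ord_max) q)) => i.
by rewrite addr0.
Qed.

Lemma holo_dy q : holo (dy q) q. Proof. by eexists; exact: hol_dy. Qed.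
Lemma holo_dz q : holo (dz q) q. Proof. by eexists; exact: hol_dz. Qed.

End Displacements.

Ltac holo_tac := cbv beta; lazymatch goal with
  | |- holo (fun x => @?f x + @?h x) _ => apply: holo_add; holo_tac
  | |- holo (fun x => @?f x * @?h x) _ => apply: holo_mul; holo_tac
  | |- holo (fun x => - @?f x) _ => apply: holo_opp; holo_tac
  | |- holo (fun x => @?f x ^+ _) _ => apply: holo_exp; holo_tac
  | |- holo (fun x => (@?f x)^-1) _ => apply: holo_inv; holo_tac
  | |- holo (dy _) _ => exact: holo_dy
  | |- holo (dz _) _ => exact: holo_dz
  | |- holo (fun x => dy _ x) _ => exact: holo_dy
  | |- holo (fun x => dz _ x) _ => exact: holo_dz
  | H : holo ?f _ |- holo ?f _ => exact: H
  | H : holo ?f _ |- holo (fun x => ?f x) _ => exact: H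
  | |- holo _ _ => exact: holo_cst
  | |- _ => idtac
  end.

Section Germs.
Variable R : realType.
Local Notation C := (Cx R).

(** A simple root of p - f a continues to a holomorphic root of p - f, by the inverse
    function theorem in one variable. *)
Lemma holo_poly_root n (p : {poly C}) (f : 'rV[C]_n -> C) a (t0 : C) :
  holo f a -> p.[t0] = f a -> p^`().[t0] != 0 ->
  exists k, [/\ holo k a, k a = t0 & \forall x \near a, p.[k x] = f x].
Proof.
move=> [g hf] pt0 dp.
pose a1 : 'rV[C]_1 := \row_j t0.
pose F (j : 'I_1) (x : 'rV[C]_1) : C := p.[x ord0 j].
have hF j : hol (F j) a1 (fun i => p^`().[t0] * (i == j)%:R).
  by have := hol_horner p (hol_coord j a1); rewrite mxE.
have [v h|G [Ga Gh FG _]] := inverse_function hF.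
  apply/rowP => j; rewrite mxE; have := h j.
  rewrite big_ord1 !ord1 eqxx mulr1 => /eqP; rewrite mulf_eq0 (negPf dp) orbF.
  by move=> /eqP.
have e1 : \row_j F j a1 = \row_(j < 1) f a.
  by apply/rowP => j; rewrite !mxE /F mxE.
rewrite e1 in Ga Gh FG.
pose r x : 'rV[C]_1 := \row_(j < 1) f x.
have rc : continuous_at a r.
  by apply: continuous_at_row => _; exact: hol_continuous hf.
exists (fun x => G (r x) ord0 ord0); split.
- have [g' hG] := Gh ord0; eexists.
  exact: (@hol_comp _ 1 n (fun u => G u ord0 ord0) (fun _ => f) a g' (fun _ => g)).
- by rewrite /r Ga mxE.
- have h : \forall x \near a, \row_j F j (G (r x)) = r x by exact: rc _ FG.
  by apply: filterS h => x /rowP/(_ ord0); rewrite !mxE.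
Qed.

Lemma holo_nthroot n (w : 'rV[C]_n -> C) a (k : nat) : (0 < k)%N ->
  holo w a -> w a != 0 ->
  exists r, [/\ holo r a, r a != 0 & \forall x \near a, r x ^+ k = w x].
Proof.
move=> k0 hw wa; pose t0 := k.-root (w a).
have t0k : t0 ^+ k = w a by rewrite rootCK.
have t00 : t0 != 0 by apply: contra_neq wa => t00; rewrite -t0k t00 expr0n; case: (k) k0.
have [||r [hr ra re]] := @holo_poly_root _ 'X^k w a t0 hw.
- by rewrite hornerXn.
- by rewrite derivXn hornerMn hornerXn -mulr_natr mulf_neq0 ?expf_neq0// pnatr_eq0 -lt0n.
exists r; split=> //; first by rewrite ra.
by apply: filterS re => x; rewrite hornerXn.
Qed.

(** Functions vanishing at a with independent differentials are local coordinates,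
    and a function that is G of these coordinates is equivalent to G. *)
Lemma germ_equiv_of_coordinates N (F : 'rV[C]_N.+1 -> C) a G
    (phi : 'I_N.+1 -> 'rV[C]_N.+1 -> C) (J : 'I_N.+1 -> 'I_N.+1 -> C) :
  (forall j, hol (phi j) a (J j)) -> (forall j, phi j a = 0) ->
  (forall v : 'rV[C]_N.+1, (forall j, \sum_i v ord0 i * J j i = 0) -> v = 0) ->
  (\forall x \near a, F x = G (\row_j phi j x)) ->
  germ_equiv F a G.
Proof.
move=> hphi phi0 ker FG.
have [P [Pa Ph PF PG]] := inverse_function hphi ker.
have e0 : \row_j phi j a = 0 by apply/rowP => j; rewrite !mxE phi0.
rewrite e0 in Pa Ph PF.
have Pc : continuous_at (0 : 'rV[C]_N.+1) P.
  have -> : P = (fun u => \row_j P u ord0 j).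
    by apply/funext => u; apply/rowP => j; rewrite mxE.
  by apply: continuous_at_row => j; have [g] := Ph j; exact: hol_continuous.
exists (fun x => \row_j phi j x), P, (fun=> 1); split.
- split=> //.
  + have : \forall x \near a, forall j, exists g, hol (phi j) x g.
      by apply: near_forall => j; exact: hol_near (hphi j).
    apply: filterS => x /choice[g hg].
    apply: (hol_differentiable_row (g := g)) => j.
    by apply: hol_eq (hg j); near=> y; rewrite mxE.
  + have : \forall x \near (0 : 'rV[C]_N.+1), forall j, exists g, hol (fun u => P u ord0 j) x g.
      by apply: near_forall => j; have [g hg] := Ph j; exact: hol_near hg.
    by apply: filterS => x /choice[g hg]; exact: hol_differentiable_row hg.
- exact: PG.
- exact: PF.
- split; last exact: oner_neq0.
  by near=> x; exact: differentiable_cst.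
- have h : \forall x \near (0 : 'rV[C]_N.+1), F (P x) = G (\row_j phi j (P x)).
    have c : P @ (0 : 'rV[C]_N.+1) --> a by rewrite -[a in _ --> a]Pa.
    exact: c _ FG.
  by near=> x; rewrite mul1r (near h x)// (near PF x).
Unshelve. all: by end_near. Qed.

End Germs.

(** * Reduction to plane germs *)

Section PlaneGerms.
Variable R : realType.
Local Notation C := (Cx R).
Local Notation C2 := 'rV[C]_2.

Definition plane_form (t : simple_type) (y z : C) : C :=
  match t with
  | TypeA m => y ^+ 2 + z ^+ m.+1
  | TypeD m => y ^+ 2 * z + z ^+ m.-1
  | TypeE6 => y ^+ 3 + z ^+ 4
  end.

(** Y and Z are coordinates at q in which h is the plane normal form of type t; the
    determinant is the Jacobian of (Y, Z). *)
Definition plane_type (t : simple_type) (h : C2 -> C) (q : C2) :=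
  exists Y Z gY gZ, [/\ hol Y q gY, hol Z q gZ, Y q = 0 /\ Z q = 0,
    gY ord0 * gZ ord_max - gY ord_max * gZ ord0 != 0 &
    \forall x \near q, h x = plane_form t (Y x) (Z x)].

Definition plane_proj N (x : 'rV[C]_N.+1) : C2 :=
  \row_j (if j == ord0 then ycoord x else zcoord x).

Lemma squaresS m (x : 'rV[C]_m.+2) :
  squares m.+1 x = squares m x + ycoord x ^+ 2.
Proof.
rewrite /squares /ycoord [LHS](bigD1 (inord m)) /=; last by rewrite inordK.
rewrite addrC; congr (_ + _); apply: eq_bigl => i.
by rewrite -val_eqE /= inordK// ltnS [RHS]ltn_neqAle andbC.
Qed.

Lemma normal_form_plane m t (x : 'rV[C]_m.+2) :
  normal_form t x = squares m x + plane_form t (ycoord x) (zcoord x).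
Proof. by case: t => [k|k|] /=; rewrite ?squaresS ?addrA. Qed.

Lemma ord2P (P : 'I_2 -> Prop) : P ord0 -> P ord_max -> forall i, P i.
Proof.
move=> P0 P1 [[|[|//]] Hi]; first by have -> : Ordinal Hi = ord0 by apply: val_inj.
by have -> : Ordinal Hi = ord_max by apply: val_inj.
Qed.

Lemma big_ord2 (F : 'I_2 -> C) : \sum_i F i = F ord0 + F ord_max.
Proof. by rewrite big_ord_recl big_ord1; congr (_ + F _); apply: val_inj. Qed.

(** The squares of x_1, ..., x_(N-1) are already split off, so these variables
    together with the plane coordinates Y and Z put F in normal form. *)
Theorem has_type_of_plane N t (F : 'rV[C]_N.+1 -> C) (q : C2) (h : C2 -> C) :
  (0 < N)%N ->
  (forall x, F x = squares N.-1 x + h (plane_proj x)) ->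
  plane_type t h q -> has_type t F (pointN N q).
Proof.
case: N F => // m F _ Fh [Y [Z [gY [gZ [hY hZ [Y0 Z0] det0 hYZ]]]]].
pose a := pointN m.+1 q : 'rV[C]_m.+2.
have yv : (inord m : 'I_m.+2) = m :> nat by rewrite inordK.
have projE (x : 'rV[C]_m.+2) : plane_proj x = \row_j (if j == ord0 then x ord0 (inord m) else x ord0 ord_max).
  by [].
have pa : plane_proj a = q.
  apply/rowP; apply: ord2P; rewrite projE !mxE /= ?yv ?eqxx //.
  by rewrite (ltn_eqF (ltnSn m)).
have hproj (f : C2 -> C) g : hol f q g -> hol (fun x : 'rV[C]_m.+2 => f (plane_proj x)) a
    (fun i => (i == inord m)%:R * g ord0 + (i == ord_max)%:R * g ord_max).
  move=> hf; rewrite -pa in hf.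
  apply: hol_grad (hol_comp (gG := fun j i => if j == ord0 then (i == inord m)%:R else (i == ord_max)%:R) _ hf).
    by move=> i; rewrite big_ord2.
  by apply: ord2P => /=; exact: hol_coord.
(* The coordinates of the normal form: Y and Z in the last two places. *)
pose phi (j : 'I_m.+2) (x : 'rV[C]_m.+2) : C :=
  if j == ord_max then Z (plane_proj x) else
  if j == inord m then Y (plane_proj x) else x ord0 j.
pose J (j i : 'I_m.+2) : C :=
  if j == ord_max then (i == inord m)%:R * gZ ord0 + (i == ord_max)%:R * gZ ord_max else
  if j == inord m then (i == inord m)%:R * gY ord0 + (i == ord_max)%:R * gY ord_max
  else (i == j)%:R.
have ne : (inord m : 'I_m.+2) != ord_max.
  by rewrite -val_eqE /= yv (ltn_eqF (ltnSn m)).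
have ne2 : ord_max != (inord m : 'I_m.+2) by rewrite eq_sym.
have jlt (j : 'I_m.+2) : j != ord_max -> j != inord m -> (j < m)%N.
  rewrite -!val_eqE /= yv => h1 h2; have := ltn_ord j.
  by rewrite ltnS leq_eqVlt (negPf h1) /= ltnS leq_eqVlt (negPf h2).
apply: (@germ_equiv_of_coordinates _ _ _ _ _ phi J).
- move=> j; rewrite /phi /J; case: (j == ord_max); first exact: hproj.
  by case: (j == inord m); [exact: hproj|exact: hol_coord].
- move=> j; rewrite /phi pa Y0 Z0; case: ifPn => // h1; case: ifPn => // h2.
  have := jlt j h1 h2; rewrite mxE => jm.
  by rewrite (ltn_eqF (leqW jm)) /= (ltn_eqF jm).
- move=> v hv.
  have sumE (c d : C) : \sum_i v ord0 i * ((i == inord m)%:R * c + (i == ord_max)%:R * d) =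
      v ord0 (inord m) * c + v ord0 ord_max * d.
    rewrite (bigD1 (inord m))//= eqxx (negPf ne) mul1r mul0r addr0; congr (_ + _).
    rewrite (bigD1 ord_max)//= eqxx (negPf ne2) mul0r mul1r add0r.
    rewrite big1 ?addr0// => i /andP[/negPf -> /negPf ->].
    by rewrite !mul0r addr0 mulr0.
  have e1 : v ord0 (inord m) * gY ord0 + v ord0 ord_max * gY ord_max = 0.
    have := hv (inord m); rewrite /J (negPf ne) eqxx => {1}<-; exact/esym/sumE.
  have e2 : v ord0 (inord m) * gZ ord0 + v ord0 ord_max * gZ ord_max = 0.
    have := hv ord_max; rewrite /J eqxx => {1}<-; exact/esym/sumE.
  apply/rowP => j; rewrite mxE.
  have [->|h1] := eqVneq j ord_max.
    apply: (mulIf det0); rewrite mul0r.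
    transitivity (gY ord0 * (v ord0 (inord m) * gZ ord0 + v ord0 ord_max * gZ ord_max)
      - gZ ord0 * (v ord0 (inord m) * gY ord0 + v ord0 ord_max * gY ord_max)).
      by ring.
    by rewrite e1 e2 !mulr0 subrr.
  have [->|h2] := eqVneq j (inord m).
    apply: (mulIf det0); rewrite mul0r.
    transitivity (gZ ord_max * (v ord0 (inord m) * gY ord0 + v ord0 ord_max * gY ord_max)
      - gY ord_max * (v ord0 (inord m) * gZ ord0 + v ord0 ord_max * gZ ord_max)).
      by ring.
    by rewrite e1 e2 !mulr0 subrr.
  have := hv j; rewrite /J (negPf h1) (negPf h2) => <-.
  rewrite (bigD1 j)//= eqxx mulr1 big1 ?addr0// => i /negPf ->.
  by rewrite mulr0.
- have pc : continuous_at a (@plane_proj m.+1).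
    apply: continuous_at_row; apply: ord2P => /=; exact: continuous_at_coord.
  have h2 : \forall x \near a, h (plane_proj x) = plane_form t (Y (plane_proj x)) (Z (plane_proj x)).
    have c : @plane_proj m.+1 @ a --> q by rewrite -[q in _ --> q]pa.
    exact: c _ hYZ.
  apply: filterS h2 => x e; rewrite Fh e normal_form_plane; congr (_ + plane_form _ _ _).
  + apply: eq_bigr => i im; rewrite mxE /phi.
    by rewrite -!val_eqE /= yv (ltn_eqF (leqW im)) (ltn_eqF im).
  + by rewrite /ycoord mxE /phi (negPf ne) eqxx.
  + by rewrite /zcoord mxE /phi eqxx.
Qed.

(** A correction by a multiple of z does not change the gradient at a zero of z
    beyond a multiple of that of z.  Together with hol_unitM_vanishing, this
    keeps the Jacobian nonzero when coordinates are modified. *)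
Lemma hol_addM_vanishing (f z b : C2 -> C) q gf gz : hol f q gf -> hol z q gz ->
  holo b q -> z q = 0 -> hol (fun x => f x + z x * b x) q (fun i => gf i + b q * gz i).
Proof.
move=> hf hz [gb hb] z0; apply: hol_grad (hol_add hf (hol_mul hz hb)) => i.
by rewrite z0 mul0r add0r.
Qed.

Lemma hol_unitM_vanishing (u z : C2 -> C) q gz : holo u q -> hol z q gz ->
  z q = 0 -> hol (fun x => u x * z x) q (fun i => u q * gz i).
Proof.
move=> [gu hu] hz z0; apply: hol_grad (hol_mul hu hz) => i.
by rewrite z0 mul0r addr0.
Qed.

(** The coordinates are r M and s Z0 with r^2 = U and s^(k+1) = w, where
    M = M0 + Z0 B: adding a multiple of Z0 to M0 and multiplying by units does
    not affect the independence of the differentials. *)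
Lemma plane_typeA k (h M0 Z0 B U w : C2 -> C) q gM gZ : hol M0 q gM -> hol Z0 q gZ ->
  M0 q = 0 -> Z0 q = 0 -> gM ord0 * gZ ord_max - gM ord_max * gZ ord0 != 0 ->
  holo B q -> holo U q -> holo w q -> U q != 0 -> w q != 0 ->
  (\forall x \near q, h x = U x * (M0 x + Z0 x * B x) ^+ 2 + w x * Z0 x ^+ k.+1) ->
  plane_type (TypeA k) h q.
Proof.
move=> hM hZ M0q Z0q det0 hB hU hw Uq wq hE.
have [r [hr rq re]] := holo_nthroot (isT : (0 < 2)%N) hU Uq.
have [s [hs sq se]] := holo_nthroot (ltn0Sn k) hw wq.
have hM1 := hol_addM_vanishing hM hZ hB Z0q.
have M1q : M0 q + Z0 q * B q = 0 by rewrite M0q Z0q mul0r addr0.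
have hY := hol_unitM_vanishing hr hM1 M1q.
have hZ1 := hol_unitM_vanishing hs hZ Z0q.
exists (fun x => r x * (M0 x + Z0 x * B x)), (fun x => s x * Z0 x); do 2!eexists.
split; [exact: hY|exact: hZ1| | |].
- by rewrite M1q Z0q !mulr0.
- rewrite [X in X != 0](_ : _ = r q * s q * (gM ord0 * gZ ord_max - gM ord_max * gZ ord0)).
    by rewrite !mulf_neq0.
  by ring.
- near=> x; rewrite (near hE x)// /plane_form !exprMn (near re x)// (near se x)//.
Unshelve. all: by end_near. Qed.

(** The last coordinate is s L with s^(k-1) = w, which leaves L U M^2 to be
    r^2 s L M^2; so r is a square root of U / s. *)
Lemma plane_typeD k (h L M0 B U w : C2 -> C) q gL gM : (3 < k)%N -> hol L q gL -> hol M0 q gM ->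
  L q = 0 -> M0 q = 0 -> gM ord0 * gL ord_max - gM ord_max * gL ord0 != 0 ->
  holo B q -> holo U q -> holo w q -> U q != 0 -> w q != 0 ->
  (\forall x \near q, h x = L x * (U x * (M0 x + L x * B x) ^+ 2 + w x * L x ^+ k.-2)) ->
  plane_type (TypeD k) h q.
Proof.
move=> k3 hL hM Lq M0q det0 hB hU hw Uq wq hE.
have k1 : (0 < k.-1)%N by case: k k3 {hE} => [|[]].
have kE : k.-2.+1 = k.-1 by case: k k3 {hE} k1 => [|[]].
have [s [hs sq se]] := holo_nthroot k1 hw wq.
have hUs : holo (fun x => U x * (s x)^-1) q by holo_tac.
have Usq : U q * (s q)^-1 != 0 by rewrite mulf_neq0 ?invr_neq0.
have [r [hr rq re]] := holo_nthroot (isT : (0 < 2)%N) hUs Usq.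
have hM1 := hol_addM_vanishing hM hL hB Lq.
have M1q : M0 q + L q * B q = 0 by rewrite M0q Lq mul0r addr0.
have hY := hol_unitM_vanishing hr hM1 M1q.
have hZ1 := hol_unitM_vanishing hs hL Lq.
exists (fun x => r x * (M0 x + L x * B x)), (fun x => s x * L x); do 2!eexists.
split; [exact: hY|exact: hZ1| | |].
- by rewrite M1q Lq !mulr0.
- rewrite [X in X != 0](_ : _ = r q * s q * (gM ord0 * gL ord_max - gM ord_max * gL ord0)).
    by rewrite !mulf_neq0.
  by ring.
- have sn0 := holo_neq0 hs sq.
  near=> x; rewrite (near hE x)// /plane_form !exprMn (near re x)// (near se x)//.
  have sx : s x != 0 by near: x.
  have -> : L x ^+ k.-1 = L x * L x ^+ k.-2 by rewrite -exprS kE.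
  by field.
Unshelve. all: by end_near. Qed.

End PlaneGerms.

(** * Normal forms of the germ at a critical point *)

Section Identities.
Variable K : numFieldType.
Implicit Types v s t c a b u e L m tau : K.

(** The Taylor expansion of f_Lambda at a critical point of value zero, in
    displacements s and t from it. *)
Definition cubic_germ v0 v1 v2 v3 v4 s t : K :=
  s ^+ 3 + v1 * s ^+ 2 + v0 * s * t + v2 * t ^+ 2 + v3 * s * t ^+ 2
  + v4 * t ^+ 3 + t ^+ 4.

(** The square is completed in s over the unit v1 + s. *)
Lemma cubic_germ_A1 v0 v1 v2 v3 v4 s t : v1 + s != 0 ->
  cubic_germ v0 v1 v2 v3 v4 s t =
    (v1 + s) * (s + t * ((v0 + v3 * t) * (2 * (v1 + s))^-1)) ^+ 2
    + (v2 + v4 * t + t ^+ 2 - (v0 + v3 * t) ^+ 2 * (4 * (v1 + s))^-1) * t ^+ 2.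
Proof. by move=> U0; rewrite /cubic_germ; field. Qed.

(** The quadratic part is v1 (s + c t)^2.  In S = s + c t the germ is
    S^2 (v1 + S - 3 c t) + S t^2 (3 c^2 + v3) + t^3 (v4 - c^3 - c v3 + t), and
    the square is completed in S. *)
Lemma cubic_germ_A2 v1 v3 v4 c s t : v1 + (s + c * t) - 3 * c * t != 0 ->
  cubic_germ (2 * v1 * c) v1 (v1 * c ^+ 2) v3 v4 s t =
    (v1 + (s + c * t) - 3 * c * t) *
    (s + c * t + t * (t * (3 * c ^+ 2 + v3) *
       (2 * (v1 + (s + c * t) - 3 * c * t))^-1)) ^+ 2
    + (v4 - c ^+ 3 - c * v3 + t - t * (3 * c ^+ 2 + v3) ^+ 2 *
       (4 * (v1 + (s + c * t) - 3 * c * t))^-1) * t ^+ 3.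
Proof. by move=> U0; rewrite /cubic_germ; field. Qed.

(** With v4 = c^3 + c v3 the coefficient of t^3 in cubic_germ_A2 disappears. *)
Lemma cubic_germ_A3 v1 v3 c s t : v1 + (s + c * t) - 3 * c * t != 0 ->
  cubic_germ (2 * v1 * c) v1 (v1 * c ^+ 2) v3 (c ^+ 3 + c * v3) s t =
    (v1 + (s + c * t) - 3 * c * t) *
    (s + c * t + t * (t * (3 * c ^+ 2 + v3) *
       (2 * (v1 + (s + c * t) - 3 * c * t))^-1)) ^+ 2
    + (1 - (3 * c ^+ 2 + v3) ^+ 2 *
       (4 * (v1 + (s + c * t) - 3 * c * t))^-1) * t ^+ 4.
Proof. by move=> U0; rewrite /cubic_germ; field. Qed.

(** The cofactor of the square of a (s + c t) + t^2 in the germ, equal to 1 at the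
    origin. *)
Definition A4_unit a c s t :=
  1 + (s + c * t + t ^+ 2 * a^-1 - 3 * c * t - 3 * t ^+ 2 * a^-1) * (a ^+ 2)^-1.

(** The relation 3 c^2 + v3 = 2 a, with v1 = a^2, cancels the coefficient of
    t^4 in cubic_germ_A3: the terms of weight 4 form the square of
    a (s + c t) + t^2, where t has weight 1 and s + c t has weight 2. *)
Lemma cubic_germ_A4 a c s t : a != 0 -> A4_unit a c s t != 0 ->
  cubic_germ (2 * a ^+ 2 * c) (a ^+ 2) (a ^+ 2 * c ^+ 2) (2 * a - 3 * c ^+ 2)
     (2 * c * (a - c ^+ 2)) s t =
    A4_unit a c s t *
    (a * (s + c * t) + t ^+ 2 + t * (t ^+ 2 * (6 * c + 3 * t * a^-1) *
       (2 * a ^+ 2 * A4_unit a c s t)^-1)) ^+ 2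
    + ((- 3 * c - t * a^-1) * (a ^+ 2)^-1 - t * (6 * c + 3 * t * a^-1) ^+ 2 *
       (4 * a ^+ 4 * A4_unit a c s t)^-1) * t ^+ 5.
Proof.
(* Trading s for the unit u makes the denominators monomials in a and u. *)
move=> a0 U0; move: (erefl (A4_unit a c s t)) U0; rewrite {1}/A4_unit.
move: {-3}(A4_unit a c s t) => u uE U0.
have -> : s = (u - 1) * a ^+ 2 - (c * t + t ^+ 2 * a^-1 - 3 * c * t - 3 * t ^+ 2 * a^-1).
  by rewrite -uE; field.
by rewrite /cubic_germ /A4_unit; field; rewrite U0 a0.
Qed.

(** For c = 0 the coefficient of t^5 in cubic_germ_A4 vanishes as well. *)
Lemma cubic_germ_A5 a s t : a != 0 -> A4_unit a 0 s t != 0 ->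
  cubic_germ 0 (a ^+ 2) 0 (2 * a) 0 s t =
    A4_unit a 0 s t *
    (a * s + t ^+ 2 + t * (t ^+ 3 * 3 * (2 * a ^+ 3 * A4_unit a 0 s t)^-1)) ^+ 2
    + (- (a ^+ 3)^-1 - t ^+ 2 * 9 * (4 * a ^+ 6 * A4_unit a 0 s t)^-1) * t ^+ 6.
Proof.
move=> a0 U0.
have := @cubic_germ_A4 a 0 s t a0 U0.
rewrite !(mulr0, mul0r, expr0n, subr0, addr0, add0r) /= => ->.
by move: (A4_unit a 0 s t) U0 => u U0; field; rewrite U0 a0.
Qed.

(** When e is chosen with e^3 + v3 e + v4 + t = 0, the line s = e t is a factor of
    the whole germ, the term t^4 being absorbed in v4 + t.  The quadratic
    cofactor is then completed to a square. *)
Lemma cubic_germ_D4 v3 v4 e s t : 3 * e ^+ 2 + v3 != 0 ->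
  e ^+ 3 + v3 * e + v4 = - t ->
  cubic_germ 0 0 0 v3 v4 s t =
    (s - e * t) * ((3 * e ^+ 2 + v3) *
      (t + (s - e * t) * (3 * e * (2 * (3 * e ^+ 2 + v3))^-1)) ^+ 2
    + (1 - 9 * e ^+ 2 * (4 * (3 * e ^+ 2 + v3))^-1) * (s - e * t) ^+ 2).
Proof.
move=> U0 /eqP; rewrite addrC -subr_eq0 opprK => /eqP h.
have -> : v4 = - t - e ^+ 3 - v3 * e.
  by apply/eqP; rewrite -subr_eq0 -[X in _ == X]h; apply/eqP; ring.
by rewrite /cubic_germ; field.
Qed.

Definition D5_coef tau e := - 3 * (e - 2 * tau) * (4 * (e - tau) ^+ 2)^-1.

(** The slopes of the tangent cone are tau, twice, and -2 tau.  As in cubic_germ_D4,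
    the factor L comes from the simple one.  The coefficient of L^2 in the
    cofactor found there now vanishes along t = 0: it is t b, because
    t = - (e - tau)^2 (e + 2 tau).  A second completion of the square then
    leaves L^3. *)
Lemma cubic_germ_D5 tau e s t : 3 * e ^+ 2 - 3 * tau ^+ 2 != 0 -> e - tau != 0 ->
  e ^+ 3 + - 3 * tau ^+ 2 * e + 2 * tau ^+ 3 = - t ->
  let U := 3 * e ^+ 2 - 3 * tau ^+ 2 in let L := s - e * t in
  let b := D5_coef tau e * U^-1 in
  cubic_germ 0 0 0 (- 3 * tau ^+ 2) (2 * tau ^+ 3) s t =
    L * (U * (t + L * (3 * e * (2 * U)^-1 + L * (b * (2 * U)^-1))) ^+ 2
    + (- 3 * e * D5_coef tau e * (2 * U ^+ 2)^-1 - L * (b ^+ 2 * (4 * U)^-1)) * L ^+ 3).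
Proof.
move=> U0 e0 h U L b; rewrite /b /U /L.
have -> : t = - ((e - tau) ^+ 2 * (e + 2 * tau)) by rewrite -[t]opprK -h; ring.
rewrite /cubic_germ /D5_coef; field.
by rewrite U0 e0.
Qed.

End Identities.

Section Classification.
Variable R : realType.
Local Notation C := (Cx R).
Local Notation C2 := 'rV[C]_2.
Implicit Types (q : C2) (v a c : C).

Definition germ_at q v0 v1 v2 v3 v4 (p : C2) : C :=
  cubic_germ v0 v1 v2 v3 v4 (dy q p) (dz q p).

Lemma germ_A1 q v0 v1 v2 v3 v4 : v1 != 0 -> 4 * v1 * v2 - v0 ^+ 2 != 0 ->
  plane_type (TypeA 1) (germ_at q v0 v1 v2 v3 v4) q.
Proof.
move=> h1 h2; pose U p := v1 + dy q p.
have Uq : U q != 0 by rewrite /U dy0 addr0.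
have hU : holo U q by rewrite /U; holo_tac.
have hU2 : 2 * U q != 0 by rewrite mulf_neq0 ?pnatr_eq0.
have hU4 : 4 * U q != 0 by rewrite mulf_neq0 ?pnatr_eq0.
apply: (@plane_typeA _ 1 _ (dy q) (dz q)
  (fun p => (v0 + v3 * dz q p) * (2 * U p)^-1) U
  (fun p => v2 + v4 * dz q p + dz q p ^+ 2 - (v0 + v3 * dz q p) ^+ 2 * (4 * U p)^-1)
  q _ _ (hol_dy q) (hol_dz q)); rewrite ?dy0 ?dz0 ?eqxx ?mulr1 ?mulr0 ?subr0 ?oner_neq0//.
- by holo_tac.
- by holo_tac.
- rewrite /U dy0 expr0n /= !addr0.
  have -> : v2 - v0 ^+ 2 * (4 * v1)^-1 = (4 * v1 * v2 - v0 ^+ 2) * (4 * v1)^-1.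
    by field.
  by rewrite mulf_neq0// invr_neq0// mulf_neq0 ?pnatr_eq0.
- apply: near_mono (holo_neq0 hU Uq) => p Up.
  by rewrite /germ_at cubic_germ_A1.
Qed.

Lemma hol_shear q c : hol (fun p => dy q p + c * dz q p) q
  (fun i => (i == ord0)%:R + c * (i == ord_max)%:R).
Proof.
apply: hol_grad (hol_add (hol_dy q) (hol_mul (hol_cst c q) (hol_dz q))) => i.
by rewrite mulr0 addr0.
Qed.

Lemma germ_A2 q v1 v3 v4 c : v1 != 0 -> v4 - c ^+ 3 - c * v3 != 0 ->
  plane_type (TypeA 2) (germ_at q (2 * v1 * c) v1 (v1 * c ^+ 2) v3 v4) q.
Proof.
move=> h1 h2; pose U p := v1 + (dy q p + c * dz q p) - 3 * c * dz q p.
have Uq : U q != 0 by rewrite /U dy0 dz0 !mulr0 subr0 !addr0.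
have hU : holo U q by rewrite /U; holo_tac.
have hU2 : 2 * U q != 0 by rewrite mulf_neq0 ?pnatr_eq0.
have hU4 : 4 * U q != 0 by rewrite mulf_neq0 ?pnatr_eq0.
apply: (@plane_typeA _ 2 _ (fun p => dy q p + c * dz q p) (dz q)
  (fun p => dz q p * (3 * c ^+ 2 + v3) * (2 * U p)^-1) U
  (fun p => v4 - c ^+ 3 - c * v3 + dz q p - dz q p * (3 * c ^+ 2 + v3) ^+ 2 * (4 * U p)^-1)
  q _ _ (hol_shear q c) (hol_dz q));
  rewrite ?dy0 ?dz0 ?mulr0 ?mul0r ?addr0 ?subr0 ?eqxx ?mulr1 ?oner_neq0//=.
- by holo_tac.
- by holo_tac.
- apply: near_mono (holo_neq0 hU Uq) => p Up.
  by rewrite /germ_at cubic_germ_A2.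
Qed.

Lemma germ_A3 q v1 v3 c : v1 != 0 -> 4 * v1 - (3 * c ^+ 2 + v3) ^+ 2 != 0 ->
  plane_type (TypeA 3)
    (germ_at q (2 * v1 * c) v1 (v1 * c ^+ 2) v3 (c ^+ 3 + c * v3)) q.
Proof.
move=> h1 h2; pose U p := v1 + (dy q p + c * dz q p) - 3 * c * dz q p.
have UqE : U q = v1 by rewrite /U dy0 dz0 !mulr0 subr0 !addr0.
have Uq : U q != 0 by rewrite UqE.
have hU : holo U q by rewrite /U; holo_tac.
have hU2 : 2 * U q != 0 by rewrite mulf_neq0 ?pnatr_eq0.
have hU4 : 4 * U q != 0 by rewrite mulf_neq0 ?pnatr_eq0.
apply: (@plane_typeA _ 3 _ (fun p => dy q p + c * dz q p) (dz q)
  (fun p => dz q p * (3 * c ^+ 2 + v3) * (2 * U p)^-1) U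
  (fun p => 1 - (3 * c ^+ 2 + v3) ^+ 2 * (4 * U p)^-1)
  q _ _ (hol_shear q c) (hol_dz q));
  rewrite ?dy0 ?dz0 ?mulr0 ?mul0r ?addr0 ?subr0 ?eqxx ?mulr1 ?oner_neq0//=.
- by holo_tac.
- by holo_tac.
- rewrite UqE; have -> : 1 - (3 * c ^+ 2 + v3) ^+ 2 / (4 * v1) =
    (4 * v1 - (3 * c ^+ 2 + v3) ^+ 2) * (4 * v1)^-1 by field.
  by rewrite mulf_neq0// invr_neq0// mulf_neq0 ?pnatr_eq0.
- apply: near_mono (holo_neq0 hU Uq) => p Up.
  by rewrite /germ_at cubic_germ_A3.
Qed.

Lemma A4_unit0 a c : A4_unit a c 0 0 = 1.
Proof. by rewrite /A4_unit !mulr0 !expr0n /= !mulr0 !mul0r !subr0 !addr0 mul0r addr0. Qed.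

Lemma hol_parabola q a c :
  hol (fun p => a * (dy q p + c * dz q p) + dz q p ^+ 2) q
    (fun i => a * ((i == ord0)%:R + c * (i == ord_max)%:R)).
Proof.
apply: hol_grad (hol_add (hol_mul (hol_cst a q) (hol_shear q c)) (hol_exp 2 (hol_dz q))) => i.
by rewrite dy0 dz0 expr1 !mulr0 mul0r !addr0.
Qed.

(** The coefficient of t^5 has value -3 c / a^2 at the origin, whence the
    hypothesis on c. *)
Lemma germ_A4 q a c : a != 0 -> c != 0 ->
  plane_type (TypeA 4)
    (germ_at q (2 * a ^+ 2 * c) (a ^+ 2) (a ^+ 2 * c ^+ 2) (2 * a - 3 * c ^+ 2)
      (2 * c * (a - c ^+ 2))) q.
Proof.
move=> a0 c0; pose U p := A4_unit a c (dy q p) (dz q p).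
have UqE : U q = 1 by rewrite /U dy0 dz0 A4_unit0.
have Uq : U q != 0 by rewrite UqE oner_neq0.
have a2 : a ^+ 2 != 0 by rewrite expf_neq0.
have a4 : a ^+ 4 != 0 by rewrite expf_neq0.
have hU : holo U q by rewrite /U /A4_unit; holo_tac.
have hU2 : 2 * a ^+ 2 * U q != 0 by rewrite !mulf_neq0 ?pnatr_eq0.
have hU4 : 4 * a ^+ 4 * U q != 0 by rewrite !mulf_neq0 ?pnatr_eq0.
apply: (@plane_typeA _ 4 _ (fun p => a * (dy q p + c * dz q p) + dz q p ^+ 2) (dz q)
  (fun p => dz q p ^+ 2 * (6 * c + 3 * dz q p * a^-1) * (2 * a ^+ 2 * U p)^-1) U
  (fun p => (- 3 * c - dz q p * a^-1) * (a ^+ 2)^-1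
     - dz q p * (6 * c + 3 * dz q p * a^-1) ^+ 2 * (4 * a ^+ 4 * U p)^-1)
  q _ _ (hol_parabola q a c) (hol_dz q));
  rewrite ?dy0 ?dz0 ?expr0n ?mulr0 ?mul0r ?addr0 ?subr0 ?eqxx ?mulr1 ?oner_neq0//=.
- by rewrite mulr0.
- by holo_tac.
- by holo_tac.
- by rewrite mulf_neq0 ?invr_neq0// mulf_neq0// oppr_eq0 pnatr_eq0.
- apply: near_mono (holo_neq0 hU Uq) => p Up.
  by rewrite /germ_at cubic_germ_A4.
Qed.

Lemma germ_A5 q a : a != 0 ->
  plane_type (TypeA 5) (germ_at q 0 (a ^+ 2) 0 (2 * a) 0) q.
Proof.
move=> a0; pose U p := A4_unit a 0 (dy q p) (dz q p).
have UqE : U q = 1 by rewrite /U dy0 dz0 A4_unit0.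
have Uq : U q != 0 by rewrite UqE oner_neq0.
have a2 : a ^+ 2 != 0 by rewrite expf_neq0.
have a3 : a ^+ 3 != 0 by rewrite expf_neq0.
have a6 : a ^+ 6 != 0 by rewrite expf_neq0.
have hU : holo U q by rewrite /U /A4_unit; holo_tac.
have hU2 : 2 * a ^+ 3 * U q != 0 by rewrite !mulf_neq0 ?pnatr_eq0.
have hU4 : 4 * a ^+ 6 * U q != 0 by rewrite !mulf_neq0 ?pnatr_eq0.
apply: (@plane_typeA _ 5 _ (fun p => a * (dy q p + 0 * dz q p) + dz q p ^+ 2) (dz q)
  (fun p => dz q p ^+ 3 * 3 * (2 * a ^+ 3 * U p)^-1) U
  (fun p => - (a ^+ 3)^-1 - dz q p ^+ 2 * 9 * (4 * a ^+ 6 * U p)^-1)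
  q _ _ (hol_parabola q a 0) (hol_dz q));
  rewrite ?dy0 ?dz0 ?expr0n ?mulr0 ?mul0r ?addr0 ?subr0 ?eqxx ?mulr1 ?oner_neq0//=.
- by rewrite mulr0.
- by holo_tac.
- by holo_tac.
- by rewrite oppr_eq0 invr_neq0.
- apply: near_mono (holo_neq0 hU Uq) => p Up.
  by rewrite /germ_at cubic_germ_A5// mul0r addr0.
Qed.

Definition slope_poly v3 v4 : {poly C} := 'X^3 + v3 *: 'X + v4%:P.

Lemma slope_polyE v3 v4 e : (slope_poly v3 v4).[e] = e ^+ 3 + v3 * e + v4.
Proof. by rewrite !hornerD hornerZ hornerXn hornerX hornerC. Qed.

Lemma slope_poly_deriv v3 v4 e : (slope_poly v3 v4)^`().[e] = 3 * e ^+ 2 + v3.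
Proof.
rewrite !derivD derivZ derivXn derivX derivC addr0 hornerD hornerMn hornerXn.
by rewrite hornerZ hornerC mulr1 -mulr_natl.
Qed.

(** A simple slope of the tangent cone continues to a branch of the germ. *)
Lemma holo_slope q v3 v4 e : e ^+ 3 + v3 * e + v4 = 0 -> 3 * e ^+ 2 + v3 != 0 ->
  exists k, [/\ holo k q, k q = e &
    \forall p \near q, k p ^+ 3 + v3 * k p + v4 = - dz q p].
Proof.
move=> he de.
have hf : holo (fun p => - dz q p) q by holo_tac.
have [||k [hk kq ke]] := @holo_poly_root _ _ (slope_poly v3 v4) (fun p => - dz q p) q e hf.
- by rewrite slope_polyE he dz0 oppr0.
- by rewrite slope_poly_deriv.
by exists k; split=> //; apply: filterS ke => p; rewrite slope_polyE.
Qed.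

Lemma hol_branch q k : holo k q ->
  hol (fun p => dy q p + dz q p * - k p) q
    (fun i => (i == ord0)%:R + - k q * (i == ord_max)%:R).
Proof.
move=> hk; have hk1 : holo (fun p => - k p) q by holo_tac.
exact: (hol_addM_vanishing (hol_dy q) (hol_dz q) hk1 (dz0 q)).
Qed.

(** A nonzero discriminant provides a simple slope e, and factors as
    (3 e^2 + v3)^2 (3 e^2 + 4 v3); the last factor is, up to sign, the
    discriminant of the other two slopes. *)
Lemma germ_D4 q v3 v4 : 4 * v3 ^+ 3 + 27 * v4 ^+ 2 != 0 ->
  plane_type (TypeD 4) (germ_at q 0 0 0 v3 v4) q.
Proof.
move=> disc.
(* solve_monicpoly writes the equation as e^3 = lower terms, whence the signs. *)
have [e he] : exists e, e ^+ 3 + v3 * e + v4 = 0.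
  have [|e he] := @solve_monicpoly C 3 (fun i => if i == 0%N then - v4 else if i == 1%N then - v3 else 0).
    by [].
  exists e; rewrite he !big_ord_recl big_ord0 /= expr0 expr1; ring.
have discE : 4 * v3 ^+ 3 + 27 * v4 ^+ 2 = (3 * e ^+ 2 + v3) ^+ 2 * (3 * e ^+ 2 + 4 * v3).
  have -> : v4 = - (e ^+ 3 + v3 * e).
    by apply/eqP; rewrite -addr_eq0 addrC he.
  by ring.
rewrite discE mulf_eq0 negb_or in disc; move/andP: disc => [d1 d2].
rewrite expf_eq0 /= in d1.
have [k [hk kq ke]] := holo_slope q he d1.
pose U p := 3 * k p ^+ 2 + v3.
have Uq : U q != 0 by rewrite /U kq.
have hU : holo U q by rewrite /U; holo_tac.
have hU2 : 2 * U q != 0 by rewrite mulf_neq0 ?pnatr_eq0.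
have hU4 : 4 * U q != 0 by rewrite mulf_neq0 ?pnatr_eq0.
apply: (@plane_typeD _ 4 _ (fun p => dy q p + dz q p * - k p) (dz q)
  (fun p => 3 * k p * (2 * U p)^-1) U
  (fun p => 1 - 9 * k p ^+ 2 * (4 * U p)^-1) q _ _ isT (hol_branch hk) (hol_dz q));
  rewrite ?dy0 ?dz0 ?mulr0 ?mul0r ?addr0 ?subr0 ?eqxx ?mulr1 ?oner_neq0//=.
- by holo_tac.
- by holo_tac.
- rewrite /U kq in Uq *; have -> : 1 - 9 * e ^+ 2 / (4 * (3 * e ^+ 2 + v3)) =
    (3 * e ^+ 2 + 4 * v3) * (4 * (3 * e ^+ 2 + v3))^-1 by field.
  by rewrite mulf_neq0// invr_neq0// mulf_neq0 ?pnatr_eq0.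
- apply: near_mono (near_and (holo_neq0 hU Uq) ke) => p [Up kp].
  have e1 : dy q p + dz q p * - k p = dy q p - k p * dz q p by rewrite mulrN mulrC.
  by rewrite /germ_at (@cubic_germ_D4 _ v3 v4 (k p)) ?e1.
Qed.

(** The parameters describe the points of the discriminant cusp
    4 v3^3 + 27 v4^2 = 0 other than the origin. *)
Lemma germ_D5 q a : a != 0 ->
  plane_type (TypeD 5) (germ_at q 0 0 0 (- 3 * a ^+ 2) (2 * a ^+ 3)) q.
Proof.
move=> a0.
have he : (- 2 * a) ^+ 3 + - 3 * a ^+ 2 * (- 2 * a) + 2 * a ^+ 3 = 0 by ring.
have de : 3 * (- 2 * a) ^+ 2 + - 3 * a ^+ 2 != 0.
  have -> : 3 * (- 2 * a) ^+ 2 + - 3 * a ^+ 2 = 9 * a ^+ 2 by ring.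
  by rewrite mulf_neq0 ?pnatr_eq0 ?expf_neq0.
have [k [hk kq ke]] := holo_slope q he de.
pose U p := 3 * k p ^+ 2 - 3 * a ^+ 2.
have UE p : U p = 3 * k p ^+ 2 + - 3 * a ^+ 2 by rewrite mulNr.
have Uq : U q != 0 by rewrite UE kq.
have hU : holo U q by rewrite /U; holo_tac.
have kaq : k q - a != 0.
  have -> : k q - a = - (3 * a) by rewrite kq; ring.
  by rewrite oppr_eq0 mulf_neq0 ?pnatr_eq0.
have hka : holo (fun p => k p - a) q by holo_tac.
have h4 : 4 * (k q - a) ^+ 2 != 0 by rewrite mulf_neq0 ?pnatr_eq0 ?expf_neq0.
have hU2 : 2 * U q != 0 by rewrite mulf_neq0 ?pnatr_eq0.
have hU4 : 4 * U q != 0 by rewrite mulf_neq0 ?pnatr_eq0.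
have hU22 : 2 * U q ^+ 2 != 0 by rewrite mulf_neq0 ?pnatr_eq0 ?expf_neq0.
pose mu p := D5_coef a (k p).
have hmu : holo mu q by rewrite /mu /D5_coef; holo_tac.
pose L p := dy q p + dz q p * - k p.
have hL : holo L q by rewrite /L; holo_tac.
have Lq : L q = 0 by rewrite /L dy0 dz0 mul0r addr0.
apply: (@plane_typeD _ 5 _ L (dz q)
  (fun p => 3 * k p * (2 * U p)^-1 + L p * (mu p * (U p)^-1 * (2 * U p)^-1)) U
  (fun p => - 3 * k p * mu p * (2 * U p ^+ 2)^-1 - L p * ((mu p * (U p)^-1) ^+ 2 * (4 * U p)^-1))
   q _ _ isT (hol_branch hk) (hol_dz q)); rewrite ?Lq ?dz0 ?mul0r ?subr0 ?eqxx//=.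
- by rewrite mulr0 addr0 sub0r mulr1 oppr_eq0 oner_neq0.
- by holo_tac.
- by holo_tac.
- rewrite mulf_neq0 ?invr_neq0// !mulf_neq0 ?oppr_eq0 ?pnatr_eq0//.
    by rewrite kq mulf_neq0 ?oppr_eq0 ?pnatr_eq0.
  have -> : k q - 2 * a = - (4 * a) by rewrite kq; ring.
  by rewrite oppr_eq0 mulf_neq0 ?pnatr_eq0.
  by rewrite invr_neq0.
- apply: near_mono (near_and (near_and (holo_neq0 hU Uq) (holo_neq0 hka kaq)) ke).
  move=> p [[Up kap] kp].
  have e1 : dy q p - k p * dz q p = L p by rewrite /L mulrN mulrC.
  by rewrite /germ_at (@cubic_germ_D5 _ a (k p)) ?e1.
Qed.

Lemma germ_E6 q : plane_type TypeE6 (germ_at q 0 0 0 0 0) q.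
Proof.
exists (dy q), (dz q); do 2!eexists; split; [exact: hol_dy|exact: hol_dz| | |].
- by rewrite dy0 dz0.
- by rewrite /= mulr1 mulr0 subr0 oner_neq0.
- by apply: near_all => p; rewrite /germ_at /cubic_germ /= !mul0r !addr0.
Qed.

End Classification.

(** * Polynomial functions and Zariski closures *)

Section PolynomialFunctions.
Variables (K : fieldType) (n : nat).
Implicit Types f h : 'rV[K]_n -> K.

(** Closure properties stated for functions, rather than for multivariate
    polynomials, apply to the equations of the loci as they are written. *)
Definition polyfun f :=
  exists g : mpoly.mpoly n K, forall x, f x = mpoly.meval (fun i => x ord0 i) g.

Lemma polyfun_ext f h : f =1 h -> polyfun h -> polyfun f.
Proof. by move=> /funext ->. Qed.

Lemma polyfun_cst c : polyfun (fun=> c).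
Proof. by exists (mpoly.mpolyC n c) => x; rewrite mpoly.mevalC. Qed.

Lemma polyfun_coord i : polyfun (fun x => x ord0 i).
Proof. by exists (mpoly.mpolyX K (mpoly.mnm1 i)) => x; rewrite mpoly.mevalXU. Qed.

Lemma polyfun_add f h : polyfun f -> polyfun h -> polyfun (fun x => f x + h x).
Proof. by move=> [p hp] [q hq]; exists (p + q) => x; rewrite mpoly.mevalD hp hq. Qed.

Lemma polyfun_mul f h : polyfun f -> polyfun h -> polyfun (fun x => f x * h x).
Proof. by move=> [p hp] [q hq]; exists (p * q) => x; rewrite mpoly.mevalM hp hq. Qed.

Lemma polyfun_opp f : polyfun f -> polyfun (fun x => - f x).
Proof. by move=> [p hp]; exists (- p) => x; rewrite mpoly.mevalN hp. Qed.

Lemma polyfun_exp f k : polyfun f -> polyfun (fun x => f x ^+ k).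
Proof. move=> hf; elim: k => [|k IH]; first exact: polyfun_cst.
have -> : (fun x => f x ^+ k.+1) = (fun x => f x * f x ^+ k).
  by apply/funext => x; rewrite exprS.
exact: polyfun_mul. Qed.

Lemma polyfun_sum (I : Type) (r : seq I) (F : I -> 'rV[K]_n -> K) :
  (forall i, polyfun (F i)) -> polyfun (fun x => \sum_(i <- r) F i x).
Proof.
move=> h; elim: r => [|i r IH].
  have -> : (fun x => \sum_(i <- [::]) F i x) = fun=> 0 by apply/funext => x; rewrite big_nil.
  exact: polyfun_cst.
have -> : (fun x => \sum_(i <- i :: r) F i x) = fun x => F i x + \sum_(i <- r) F i x.
  by apply/funext => x; rewrite big_cons.
exact: polyfun_add.
Qed.

Lemma polyfun_prod (I : Type) (r : seq I) (F : I -> 'rV[K]_n -> K) :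
  (forall i, polyfun (F i)) -> polyfun (fun x => \prod_(i <- r) F i x).
Proof.
move=> h; elim: r => [|i r IH].
  have -> : (fun x => \prod_(i <- [::]) F i x) = fun=> 1 by apply/funext => x; rewrite big_nil.
  exact: polyfun_cst.
have -> : (fun x => \prod_(i <- i :: r) F i x) = fun x => F i x * \prod_(i <- r) F i x.
  by apply/funext => x; rewrite big_cons.
exact: polyfun_mul.
Qed.

Lemma polyfun_det m (M : 'rV[K]_n -> 'M[K]_m) :
  (forall i j, polyfun (fun x => M x i j)) -> polyfun (fun x => \det (M x)).
Proof.
move=> h; apply: polyfun_sum => s; apply: polyfun_mul; first exact: polyfun_cst.
by apply: polyfun_prod.
Qed.

Lemma zclosed_zero f : polyfun f -> zclosed [set x | f x = 0].
Proof.
move=> [p hp]; exists [set p]; apply/seteqP; split=> x /=.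
  by rewrite hp => e g ->.
by move=> /(_ p erefl); rewrite -hp.
Qed.

Lemma zclosedI Z1 Z2 : zclosed Z1 -> zclosed Z2 -> zclosed (Z1 `&` Z2 : set 'rV[K]_n).
Proof.
move=> [I ->] [J ->]; exists (I `|` J); apply/seteqP; split=> x /=.
  by move=> [hI hJ] g [/hI|/hJ].
by move=> h; split=> g hg; apply: h; [left|right].
Qed.

Lemma zclosed_zclosure S : zclosed (zclosure S : set 'rV[K]_n).
Proof. by eexists. Qed.

Lemma zclosure_sub S Z : zclosed Z -> S `<=` Z -> zclosure S `<=` (Z : set 'rV[K]_n).
Proof.
move=> [I ->] SI x hx g Ig; apply: hx => y Sy.
exact: SI Sy _ Ig.
Qed.

Lemma sub_zclosure S : S `<=` (zclosure S : set 'rV[K]_n).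
Proof. by move=> x Sx g; apply. Qed.

Lemma zclosure_zero S f x : polyfun f -> (forall y, S y -> f y = 0) -> zclosure S x -> f x = 0.
Proof. by move=> [p hp] h hx; rewrite hp; apply: hx => y /h; rewrite hp. Qed.

Lemma zopen_neq0 f : polyfun f -> zopen [set x | f x != 0].
Proof.
move=> pf; rewrite /zopen (_ : ~` _ = [set x | f x = 0]); first exact: zclosed_zero.
by apply/seteqP; split=> x /=; [move=> /negP; rewrite negbK => /eqP | move=> ->; rewrite eqxx].
Qed.

Lemma zopenT : zopen (setT : set 'rV[K]_n).
Proof.
rewrite /zopen setCT; exists setT; apply/seteqP; split=> x //= /(_ 1 I).
by rewrite mpoly.meval1 => /eqP; rewrite oner_eq0.
Qed.

Lemma zclosure_nonempty S x : zclosure S x -> (S : set 'rV[K]_n) !=set0.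
Proof.
move=> h; apply/set0P/eqP => S0.
have : mpoly.meval (fun i => x ord0 i) (1 : mpoly.mpoly n K) = 0.
  by apply: h => y; rewrite S0.
by rewrite mpoly.meval1 => /eqP; rewrite oner_eq0.
Qed.

End PolynomialFunctions.

Lemma polyfun_comp (K : fieldType) m n (f : 'rV[K]_m -> K) (g : 'rV[K]_n -> 'rV[K]_m) :
  polyfun f -> (forall i, polyfun (fun x => g x ord0 i)) -> polyfun (fun x => f (g x)).
Proof.
move=> [p hp] hg.
have -> : (fun x => f (g x)) = (fun x => \sum_(k <- mpoly.msupp p)
    mpoly.mcoeff k p * \prod_(i <- index_enum 'I_m) g x ord0 i ^+ k i).
  by apply/funext => x; rewrite hp mpoly.mevalE.
apply: polyfun_sum => k; apply: polyfun_mul; first exact: polyfun_cst.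
by apply: polyfun_prod => i; exact: polyfun_exp.
Qed.

Ltac polyfun_tac := cbv beta; lazymatch goal with
  | |- polyfun (fun x => @?f x + @?h x) => apply: polyfun_add; polyfun_tac
  | |- polyfun (fun x => @?f x * @?h x) => apply: polyfun_mul; polyfun_tac
  | |- polyfun (fun x => - @?f x) => apply: polyfun_opp; polyfun_tac
  | |- polyfun (fun x => @?f x ^+ _) => apply: polyfun_exp; polyfun_tac
  | H : polyfun ?f |- polyfun ?f => exact: H
  | H : polyfun ?f |- polyfun (fun x => ?f x) => exact: H
  | |- polyfun _ => first [exact: polyfun_cst | exact: polyfun_coord]
  end.

Section Curves.
Variable K : numFieldType.
Implicit Types f h : K -> K.

Definition upoly f := exists p : {poly K}, forall t, f t = p.[t].

Lemma upoly_cst c : upoly (fun=> c).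
Proof. by exists c%:P => t; rewrite hornerC. Qed.

Lemma upoly_ext f h : (forall t, f t = h t) -> upoly h -> upoly f.
Proof. by move=> e [p hp]; exists p => t; rewrite e. Qed.

Lemma upoly_id : upoly (fun t => t).
Proof. by exists 'X => t; rewrite hornerX. Qed.

Lemma upoly_add f h : upoly f -> upoly h -> upoly (fun t => f t + h t).
Proof. by move=> [p hp] [q hq]; exists (p + q) => t; rewrite hornerD hp hq. Qed.

Lemma upoly_mul f h : upoly f -> upoly h -> upoly (fun t => f t * h t).
Proof. by move=> [p hp] [q hq]; exists (p * q) => t; rewrite hornerM hp hq. Qed.

Lemma upoly_mulc c : upoly (GRing.mul c).
Proof. by apply: upoly_mul; [exact: upoly_cst|exact: upoly_id]. Qed.

Lemma upoly_opp f : upoly f -> upoly (fun t => - f t).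
Proof. by move=> [p hp]; exists (- p) => t; rewrite hornerN hp. Qed.

Lemma upoly_exp f k : upoly f -> upoly (fun t => f t ^+ k).
Proof. by move=> [p hp]; exists (p ^+ k) => t; rewrite horner_exp hp. Qed.

Lemma upoly_sum (I : Type) (r : seq I) (F : I -> K -> K) :
  (forall i, upoly (F i)) -> upoly (fun x => \sum_(i <- r) F i x).
Proof.
move=> h; elim: r => [|i r IH].
  have -> : (fun x => \sum_(i <- [::]) F i x) = fun=> 0 by apply/funext => x; rewrite big_nil.
  exact: upoly_cst.
have -> : (fun x => \sum_(i <- i :: r) F i x) = fun x => F i x + \sum_(i <- r) F i x.
  by apply/funext => x; rewrite big_cons.
exact: upoly_add.
Qed.

Lemma upoly_prod (I : Type) (r : seq I) (F : I -> K -> K) :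
  (forall i, upoly (F i)) -> upoly (fun x => \prod_(i <- r) F i x).
Proof.
move=> h; elim: r => [|i r IH].
  have -> : (fun x => \prod_(i <- [::]) F i x) = fun=> 1 by apply/funext => x; rewrite big_nil.
  exact: upoly_cst.
have -> : (fun x => \prod_(i <- i :: r) F i x) = fun x => F i x * \prod_(i <- r) F i x.
  by apply/funext => x; rewrite big_cons.
exact: upoly_mul.
Qed.

Lemma upoly_comp n (f : 'rV[K]_n -> K) (g : K -> 'rV[K]_n) :
  polyfun f -> (forall i, upoly (fun t => g t ord0 i)) -> upoly (fun t => f (g t)).
Proof.
move=> [p hp] hg.
have -> : (fun t => f (g t)) = (fun t => \sum_(m <- mpoly.msupp p)
    mpoly.mcoeff m p * \prod_(i <- index_enum 'I_n) g t ord0 i ^+ m i).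
  by apply/funext => t; rewrite hp mpoly.mevalE.
apply: upoly_sum => m; apply: upoly_mul; first exact: upoly_cst.
by apply: upoly_prod => i; exact: upoly_exp.
Qed.

Lemma poly_vanish (p : {poly K}) : (forall t, p.[t] = 0) -> p = 0.
Proof.
move=> h; apply/eqP; case: eqP => // /eqP p0.
have := @max_poly_roots _ p [seq i%:R | i <- iota 0 (size p)] p0.
rewrite size_map size_iota ltnn => -> //.
  by apply/allP => t _; apply/rootP.
rewrite map_inj_uniq ?iota_uniq// => i j /eqP.
by rewrite eqr_nat => /eqP.
Qed.

(** A polynomial that vanishes on S vanishes at all but finitely many points of the
    curve, hence along the whole curve. *)
Lemma zclosure_curve n (S : set 'rV[K]_n) (g : K -> 'rV[K]_n) (h : K -> K) t0 t1 :
  (forall i, upoly (fun t => g t ord0 i)) -> upoly h -> h t1 != 0 ->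
  (forall t, h t != 0 -> S (g t)) -> zclosure S (g t0).
Proof.
move=> hg [H hH] h1 hS f fS.
have [|P hP] := @upoly_comp _ (fun x => mpoly.meval (fun i => x ord0 i) f) g _ hg.
  by exists f.
have PH0 : P * H = 0.
  apply: poly_vanish => t; rewrite hornerM -hP -hH.
  have [->|/hS/fS ->] := eqVneq (h t) 0; first by rewrite mulr0.
  by rewrite mul0r.
have H0 : H != 0 by apply: contra_neq h1 => H0; rewrite hH H0 horner0.
by move/eqP: PH0; rewrite mulf_eq0 (negPf H0) orbF hP => /eqP ->; rewrite horner0.
Qed.

(** Density of the locus H != 0 in S is shown by joining x to a point of that locus
    by a polynomial curve inside S. *)
Lemma zclosure_rational_path n (S : set 'rV[K]_n) (H : 'rV[K]_n -> K) x :
  polyfun H ->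
  (exists g : K -> 'rV[K]_n, [/\ forall i, upoly (fun t => g t ord0 i),
     g 0 = x, forall t, S (g t) & H (g 1) != 0]) ->
  zclosure (S `&` [set x | H x != 0]) x.
Proof.
move=> pH [g [hg <- gS gH]].
by apply: (@zclosure_curve _ _ g (fun t => H (g t)) _ 1) => //; exact: upoly_comp.
Qed.

End Curves.

Ltac upoly_tac := cbv beta; lazymatch goal with
  | |- upoly (fun x => @?f x + @?h x) => apply: upoly_add; upoly_tac
  | |- upoly (fun x => @?f x * @?h x) => apply: upoly_mul; upoly_tac
  | |- upoly (fun x => - @?f x) => apply: upoly_opp; upoly_tac
  | |- upoly (fun x => @?f x ^+ _) => apply: upoly_exp; upoly_tac
  | |- upoly (GRing.mul _) => exact: upoly_mulc
  | |- upoly (fun x => x) => exact: upoly_id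
  | H : upoly ?f |- upoly ?f => exact: H
  | H : upoly ?f |- upoly (fun x => ?f x) => exact: H
  | |- upoly _ => exact: upoly_cst
  end.

(** * The coordinates v0, ..., v4 *)

Section CoverCoordinates.
Variable R : realType.
Local Notation C := (Cx R).
Local Notation Cover := 'rV[C]_(6 + 2).
Implicit Types (x : Cover) (u a c : C).

(** The inverse of (v0, ..., v4) on Lcal: v1 and v4 give y and z, then v3, v2, v0
    give lambda_5, lambda_4, lambda_3, and the equations of Lcal give the
    remaining lambdas. *)
Definition of_v u0 u1 u2 u3 u4 : Cover :=
  let y := u1 / 3 in let z := u4 / 4 in
  let l5 := u3 in let l4 := u2 - 6 * z ^+ 2 - u3 * y in
  let l3 := u0 - 2 * u3 * z in
  let l2 := - (4 * z ^+ 3 + 2 * l4 * z + y * (l3 + 2 * l5 * z)) in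
  let l1 := - (3 * y ^+ 2 + l3 * z + l5 * z ^+ 2) in
  let l0 := - (y ^+ 3 + z ^+ 4 + l1 * y + l2 * z + l3 * y * z + l4 * z ^+ 2 + l5 * y * z ^+ 2) in
  \row_i nth 0 [:: l0; l1; l2; l3; l4; l5; y; z] i.

Lemma lamxE x k : lamx x k = x ord0 (lshift 2 (inord k)).
Proof. by rewrite /lamx /lam mxE. Qed.

Lemma yxE x : yx x = x ord0 (rshift 6 ord0).
Proof. by rewrite /yx mxE. Qed.

Lemma zxE x : zx x = x ord0 (rshift 6 ord_max).
Proof. by rewrite /zx mxE. Qed.

Definition LcalE x : Prop :=
  [/\ 3 * yx x ^+ 2 + lamx x 1 + lamx x 3 * zx x + lamx x 5 * zx x ^+ 2 = 0,
      4 * zx x ^+ 3 + 2 * lamx x 4 * zx x + lamx x 2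
        + yx x * (lamx x 3 + 2 * lamx x 5 * zx x) = 0 &
      yx x ^+ 3 + zx x ^+ 4 + lamx x 0 + lamx x 1 * yx x + lamx x 2 * zx x
      + lamx x 3 * yx x * zx x + lamx x 4 * zx x ^+ 2 + lamx x 5 * yx x * zx x ^+ 2 = 0].

Lemma LcalP x : Lcal R x <-> LcalE x.
Proof. by split=> [[[h1 h2] h3]|[h1 h2 h3]]. Qed.

Section OfV.
Variables u0 u1 u2 u3 u4 : C.
Let x := of_v u0 u1 u2 u3 u4.

Lemma yx_of_v : yx x = u1 / 3. Proof. by rewrite yxE mxE. Qed.
Lemma zx_of_v : zx x = u4 / 4. Proof. by rewrite zxE mxE. Qed.
Lemma lamx5_of_v : lamx x 5 = u3. Proof. by rewrite lamxE mxE /= inordK. Qed.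
Lemma lamx4_of_v : lamx x 4 = u2 - 6 * (u4 / 4) ^+ 2 - u3 * (u1 / 3).
Proof. by rewrite lamxE mxE /= inordK. Qed.
Lemma lamx3_of_v : lamx x 3 = u0 - 2 * u3 * (u4 / 4).
Proof. by rewrite lamxE mxE /= inordK. Qed.
Lemma lamx2_of_v : lamx x 2 =
  - (4 * zx x ^+ 3 + 2 * lamx x 4 * zx x + yx x * (lamx x 3 + 2 * lamx x 5 * zx x)).
Proof.
by rewrite yx_of_v zx_of_v lamx5_of_v lamx4_of_v lamx3_of_v lamxE mxE /= inordK.
Qed.
Lemma lamx1_of_v : lamx x 1 =
  - (3 * yx x ^+ 2 + lamx x 3 * zx x + lamx x 5 * zx x ^+ 2).
Proof. by rewrite yx_of_v zx_of_v lamx5_of_v lamx3_of_v lamxE mxE /= inordK. Qed.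
Lemma lamx0_of_v : lamx x 0 =
  - (yx x ^+ 3 + zx x ^+ 4 + lamx x 1 * yx x + lamx x 2 * zx x
     + lamx x 3 * yx x * zx x + lamx x 4 * zx x ^+ 2 + lamx x 5 * yx x * zx x ^+ 2).
Proof.
rewrite lamx1_of_v lamx2_of_v.
by rewrite yx_of_v zx_of_v lamx5_of_v lamx4_of_v lamx3_of_v lamxE mxE /= inordK.
Qed.

Lemma Lcal_of_v : Lcal R x.
Proof.
apply/LcalP; split.
- by rewrite lamx1_of_v; ring.
- by rewrite lamx2_of_v; ring.
- by rewrite lamx0_of_v; ring.
Qed.

Lemma v0_of_v : v0 x = u0.
Proof. by rewrite /v0 lamx3_of_v lamx5_of_v zx_of_v subrK. Qed.
Lemma v1_of_v : v1 x = u1.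
Proof. by rewrite /v1 yx_of_v; field. Qed.
Lemma v2_of_v : v2 x = u2.
Proof. by rewrite /v2 lamx4_of_v lamx5_of_v yx_of_v zx_of_v; ring. Qed.
Lemma v3_of_v : v3 x = u3.
Proof. exact: lamx5_of_v. Qed.
Lemma v4_of_v : v4 x = u4.
Proof. by rewrite /v4 zx_of_v; field. Qed.

End OfV.

Definition v_of_v := (v0_of_v, v1_of_v, v2_of_v, v3_of_v, v4_of_v).

(** Together with Lcal_of_v and v_of_v, this identifies Lcal with affine 5-space. *)
Lemma of_vK x : Lcal R x -> of_v (v0 x) (v1 x) (v2 x) (v3 x) (v4 x) = x.
Proof.
move=> /LcalP[e1 e2 e3].
have hy : yx (of_v (v0 x) (v1 x) (v2 x) (v3 x) (v4 x)) = yx x.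
  by rewrite yx_of_v /v1; field.
have hz : zx (of_v (v0 x) (v1 x) (v2 x) (v3 x) (v4 x)) = zx x.
  by rewrite zx_of_v /v4; field.
have h5 : lamx (of_v (v0 x) (v1 x) (v2 x) (v3 x) (v4 x)) 5 = lamx x 5.
  by rewrite lamx5_of_v.
have h4 : lamx (of_v (v0 x) (v1 x) (v2 x) (v3 x) (v4 x)) 4 = lamx x 4.
  by rewrite lamx4_of_v /v1 /v2 /v3 /v4; field.
have h3 : lamx (of_v (v0 x) (v1 x) (v2 x) (v3 x) (v4 x)) 3 = lamx x 3.
  by rewrite lamx3_of_v /v0 /v3 /v4; field.
have h2 : lamx (of_v (v0 x) (v1 x) (v2 x) (v3 x) (v4 x)) 2 = lamx x 2.
  by rewrite lamx2_of_v hy hz h5 h4 h3 -[RHS]addr0 -[in RHS]oppr0 -e2; ring.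
have h1 : lamx (of_v (v0 x) (v1 x) (v2 x) (v3 x) (v4 x)) 1 = lamx x 1.
  by rewrite lamx1_of_v hy hz h5 h3 -[RHS]addr0 -[in RHS]oppr0 -e1; ring.
have h0 : lamx (of_v (v0 x) (v1 x) (v2 x) (v3 x) (v4 x)) 0 = lamx x 0.
  by rewrite lamx0_of_v hy hz h5 h4 h3 h2 h1 -[RHS]addr0 -[in RHS]oppr0 -e3; ring.
move: hy hz h5 h4 h3 h2 h1 h0; move: (of_v _ _ _ _ _) => x'.
rewrite !yxE !zxE !lamxE => hy hz h5 h4 h3 h2 h1 h0.
apply/rowP => i; rewrite -(fintype.splitK i); case: (fintype.split i) => j /=.
  rewrite -[j]inord_val; case: j => [[|[|[|[|[|[|//]]]]]] Hj] //=.
by elim/ord2P: j.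
Qed.

Lemma upoly_of_v (u0 u1 u2 u3 u4 : C -> C) i :
  upoly u0 -> upoly u1 -> upoly u2 -> upoly u3 -> upoly u4 ->
  upoly (fun t => of_v (u0 t) (u1 t) (u2 t) (u3 t) (u4 t) ord0 i).
Proof.
move=> h0 h1 h2 h3 h4.
case: i => [[|[|[|[|[|[|[|[|//]]]]]]]] Hi];
  (eapply upoly_ext; [move=> t; rewrite /of_v mxE /=; reflexivity|]); upoly_tac.
Qed.

End CoverCoordinates.

(** * The strata and the diagram of inclusions *)

Section Strata.
Variable R : realType.
Local Notation C := (Cx R).
Local Notation Cover := 'rV[C]_(6 + 2).
Implicit Types (x : Cover) (u a c e : C).

Lemma polyfun_lamx k : polyfun (fun x : Cover => lamx x k).
Proof.
have -> : (fun x : Cover => lamx x k) = fun x => x ord0 (lshift 2 (inord k)).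
  by apply/funext => x; rewrite lamxE.
exact: polyfun_coord.
Qed.

Lemma polyfun_yx : polyfun (@yx R).
Proof.
have -> : @yx R = fun x => x ord0 (rshift 6 ord0) by apply/funext => x; rewrite yxE.
exact: polyfun_coord.
Qed.

Lemma polyfun_zx : polyfun (@zx R).
Proof.
have -> : @zx R = fun x => x ord0 (rshift 6 ord_max) by apply/funext => x; rewrite zxE.
exact: polyfun_coord.
Qed.

Lemma polyfun_v0 : polyfun (@v0 R).
Proof.
have hz := polyfun_zx; have h5 := polyfun_lamx 5; have h3 := polyfun_lamx 3.
by rewrite /v0; polyfun_tac.
Qed.

Lemma polyfun_v1 : polyfun (@v1 R).
Proof. by have hy := polyfun_yx; rewrite /v1; polyfun_tac. Qed.

Lemma polyfun_v2 : polyfun (@v2 R).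
Proof.
have hz := polyfun_zx; have hy := polyfun_yx.
have h5 := polyfun_lamx 5; have h4 := polyfun_lamx 4.
by rewrite /v2; polyfun_tac.
Qed.

Lemma polyfun_v3 : polyfun (@v3 R).
Proof. exact: polyfun_lamx. Qed.

Lemma polyfun_v4 : polyfun (@v4 R).
Proof. by have hz := polyfun_zx; rewrite /v4; polyfun_tac. Qed.

Ltac v_tac := have ? := polyfun_v0; have ? := polyfun_v1; have ? := polyfun_v2;
  have ? := polyfun_v3; have ? := polyfun_v4; polyfun_tac.

Lemma zclosed_Lcal : zclosed (Lcal R).
Proof.
have hz := polyfun_zx; have hy := polyfun_yx; have hl := polyfun_lamx.
have h0 := hl 0%N; have h1 := hl 1%N; have h2 := hl 2%N; have h3 := hl 3%N.
have h4 := hl 4%N; have h5 := hl 5%N.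
have -> : Lcal R = [set x |
     3 * yx x ^+ 2 + lamx x 1 + lamx x 3 * zx x + lamx x 5 * zx x ^+ 2 = 0] `&`
   [set x | 4 * zx x ^+ 3 + 2 * lamx x 4 * zx x + lamx x 2
        + yx x * (lamx x 3 + 2 * lamx x 5 * zx x) = 0] `&`
   [set x | yx x ^+ 3 + zx x ^+ 4 + lamx x 0 + lamx x 1 * yx x + lamx x 2 * zx x
      + lamx x 3 * yx x * zx x + lamx x 4 * zx x ^+ 2 + lamx x 5 * yx x * zx x ^+ 2 = 0].
  by apply/seteqP; split=> x; [move=> /LcalP[]|move=> [[? ?] ?]; apply/LcalP].
by do 2?apply: zclosedI; apply: zclosed_zero; polyfun_tac.
Qed.

Lemma zclosed_zero_on_L (w : Cover -> C) : polyfun w -> zclosed (zero_on_L w).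
Proof. by move=> hw; apply: zclosedI; [exact: zclosed_Lcal|exact: zclosed_zero]. Qed.

Lemma V02P x : V02 x <-> Lcal R x /\ [/\ v0 x = 0, v1 x = 0 & v2 x = 0].
Proof. by split=> [[[[L h0] [_ h1]] [_ h2]]|[L [h0 h1 h2]]]. Qed.

Lemma W23P x : W23 x <-> Lcal R x /\
  (4 * v1 x * v2 x - v0 x ^+ 2 = 0 /\
   v1 x ^+ 3 * v4 x ^+ 2 - v2 x * (v1 x * v3 x + v2 x) ^+ 2 = 0).
Proof. by split=> [[[L h0] [_ h1]]|[L [h0 h1]]]. Qed.

Lemma W24P x : W24 x <-> Lcal R x /\
  [/\ 4 * v1 x * v2 x - v0 x ^+ 2 = 0,
   v1 x ^+ 3 * v4 x ^+ 2 - v2 x * (v1 x * v3 x + v2 x) ^+ 2 = 0 &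
   4 * v1 x ^+ 3 - (v1 x * v3 x + 3 * v2 x) ^+ 2 = 0].
Proof. by split=> [[[[L h0] [_ h1]] [_ h2]]|[L [h0 h1 h2]]]. Qed.

Lemma A5P x : (stratum R vA5) x <-> Lcal R x /\
  [/\ v0 x = 0, v2 x = 0, v4 x = 0 & v3 x ^+ 2 - 4 * v1 x = 0].
Proof. by split=> [[[L h] [[[_ h0] [_ h2]] [_ h4]]]|[L [h0 h2 h4 h]]]. Qed.

Lemma D5P x : (stratum R vD5) x <-> Lcal R x /\
  [/\ v0 x = 0, v1 x = 0, v2 x = 0 & 4 * v3 x ^+ 3 + 27 * v4 x ^+ 2 = 0].
Proof. by split=> [[[L h] /V02P[_ [h0 h1 h2]]]|[L [h0 h1 h2 h]]]. Qed.

Lemma of_v0 : of_v 0 0 0 0 0 = 0 :> Cover.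
Proof.
apply/rowP => i; rewrite /of_v !mxE !(mul0r, mulr0, expr0n, subr0, addr0, oppr0) /=.
by case: i => [[|[|[|[|[|[|[|[|//]]]]]]]] Hi].
Qed.

Lemma v_at0 : [/\ v0 (0 : Cover) = 0, v1 (0 : Cover) = 0, v2 (0 : Cover) = 0,
  v3 (0 : Cover) = 0 & v4 (0 : Cover) = 0].
Proof. by rewrite -of_v0 !v_of_v. Qed.

Lemma Lcal0 : Lcal R 0.
Proof. by rewrite -of_v0; exact: Lcal_of_v. Qed.

Lemma eq0_of_v x : Lcal R x -> v0 x = 0 -> v1 x = 0 -> v2 x = 0 -> v3 x = 0 ->
  v4 x = 0 -> x = 0.
Proof. by move=> /of_vK <-; rewrite !v_of_v => -> -> -> -> ->; exact: of_v0. Qed.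

(** The slope c and the square root a of v1, in the notation of cubic_germ_A4,
    parametrize the component of the A_4 stratum whose generic type is A_4. *)
Definition A4_surface a c : Cover :=
  of_v (2 * a ^+ 2 * c) (a ^+ 2) (a ^+ 2 * c ^+ 2) (2 * a - 3 * c ^+ 2)
    (2 * c * (a - c ^+ 2)).

Lemma A4_surface_W24 a c : a != 0 -> (@W24 R `\` @V02 R) (A4_surface a c).
Proof.
move=> a0; split.
  apply/W24P; split; first exact: Lcal_of_v.
  by rewrite /A4_surface !v_of_v; split; ring.
move=> /V02P[_ []]; rewrite /A4_surface !v_of_v => _ /eqP.
by rewrite expf_eq0 /= (negPf a0).
Qed.

(** The point lies off V02 for a nonzero, and the curve a = t reaches a = 0. *)
Lemma A4_surface_closure a c : W24t (A4_surface a c).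
Proof.
apply: (@zclosure_curve _ _ _ (fun t => A4_surface t c) (fun t => t) a 1).
- by move=> i; rewrite /A4_surface; apply: upoly_of_v; upoly_tac.
- exact: upoly_id.
- exact: oner_neq0.
- by move=> t; exact: A4_surface_W24.
Qed.

Lemma W2_slope x : v1 x != 0 -> 4 * v1 x * v2 x - v0 x ^+ 2 = 0 ->
  exists c, v0 x = 2 * v1 x * c /\ v2 x = v1 x * c ^+ 2.
Proof.
move=> h1 /eqP; rewrite subr_eq0 => /eqP h2.
exists (v0 x / (2 * v1 x)); split; first by field.
have -> : v1 x * (v0 x / (2 * v1 x)) ^+ 2 = v0 x ^+ 2 / (4 * v1 x) by field.
by rewrite -h2; field.
Qed.

(** Off V02 the locus W24 has two sheets, exchanged by the sign e of v4, since W3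
    only controls v4^2.  The sheet e = 1 is the part of A4_surface where a is nonzero. *)
Lemma W24_param x : W24 x -> v1 x != 0 -> exists a c e,
  [/\ a != 0, e = 1 \/ e = -1 & x = of_v (2 * a ^+ 2 * c) (a ^+ 2) (a ^+ 2 * c ^+ 2)
    (2 * a - 3 * c ^+ 2) (e * (2 * c * (a - c ^+ 2)))].
Proof.
move=> /W24P[L [h2 h3 h4]] v1n.
have [c [v0E v2E]] := W2_slope v1n h2.
rewrite v2E in h3 h4.
have {}h4 : 4 * v1 x = (v3 x + 3 * c ^+ 2) ^+ 2.
  have : v1 x ^+ 2 * (4 * v1 x - (v3 x + 3 * c ^+ 2) ^+ 2) = 0 by rewrite -h4; ring.
  move/eqP; rewrite mulf_eq0 expf_eq0 /= (negPf v1n) /= subr_eq0.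
  by move/eqP.
pose a := (v3 x + 3 * c ^+ 2) / 2.
have v1E : v1 x = a ^+ 2.
  have -> : a ^+ 2 = (v3 x + 3 * c ^+ 2) ^+ 2 / 4 by rewrite /a; field.
  by rewrite -h4; field.
have v3E : v3 x = 2 * a - 3 * c ^+ 2 by rewrite /a; field.
have a0 : a != 0 by apply: contra_neq v1n => a0; rewrite v1E a0 expr0n.
have {}h3 : v4 x ^+ 2 = (2 * c * (a - c ^+ 2)) ^+ 2.
  have : v1 x ^+ 3 * (v4 x ^+ 2 - (2 * c * (a - c ^+ 2)) ^+ 2) = 0.
    by rewrite -h3 v3E; ring.
  move/eqP; rewrite mulf_eq0 expf_eq0 /= (negPf v1n) /= subr_eq0.
  by move/eqP.
have [e [he v4E]] : exists e, (e = 1 \/ e = -1) /\ v4 x = e * (2 * c * (a - c ^+ 2)).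
  move/eqP: h3; rewrite eqf_sqr => /orP[/eqP ->|/eqP ->].
    by exists 1; rewrite mul1r; split=> //; left.
  by exists (-1); rewrite mulN1r; split=> //; right.
exists a, c, e; split=> //.
by rewrite -[LHS]of_vK// v0E v2E v1E v3E v4E.
Qed.

Lemma W24_off_V02 x : W24 x -> ~ V02 x -> v1 x != 0.
Proof.
move=> /W24P[L [h2 h3 h4]] nV; apply/eqP => v10; apply: nV.
rewrite v10 in h2 h4; apply/V02P; split=> //; split=> //.
  by move/eqP: h2; rewrite mulr0 mul0r sub0r oppr_eq0 expf_eq0 => /andP[_ /eqP].
have e : 4 * 0 ^+ 3 - (0 * v3 x + 3 * v2 x) ^+ 2 = - (3 * v2 x) ^+ 2 by ring.
move/eqP: h4; rewrite e oppr_eq0 expf_eq0 /=.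
by rewrite mulf_eq0 pnatr_eq0 /= => /eqP.
Qed.

Lemma zclosed_V02 : zclosed (@V02 R).
Proof.
apply: zclosedI; last by apply: zclosed_zero_on_L; v_tac.
by apply: zclosedI; apply: zclosed_zero_on_L; v_tac.
Qed.

Lemma zclosed_W23 : zclosed (@W23 R).
Proof. by apply: zclosedI; apply: zclosed_zero_on_L; v_tac. Qed.

Lemma zclosed_W24 : zclosed (@W24 R).
Proof. by apply: zclosedI; [exact: zclosed_W23|apply: zclosed_zero_on_L; v_tac]. Qed.

Lemma zclosed_stratum v : zclosed (stratum R v).
Proof.
case: v => /=.
- exact: zclosed_Lcal.
- by apply: zclosed_zero_on_L; v_tac.
- exact: zclosed_W23.
- exact: zclosed_zclosure.
- apply: zclosedI; first by apply: zclosed_zero_on_L; v_tac.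
  apply: zclosedI; last by apply: zclosed_zero_on_L; v_tac.
  by apply: zclosedI; apply: zclosed_zero_on_L; v_tac.
- exact: zclosed_V02.
- by apply: zclosedI; [apply: zclosed_zero_on_L; v_tac|exact: zclosed_V02].
- rewrite (_ : [set 0] = zclosure [set 0]); first exact: zclosed_zclosure.
  apply/seteqP; split; first exact: sub_zclosure.
  move=> x hx /=; apply/rowP => i.
  have pi := @polyfun_coord C _ i.
  by rewrite mxE; apply: (zclosure_zero pi) hx => y ->; rewrite mxE.
Qed.

Lemma W24t_W24 : @W24t R `<=` @W24 R.
Proof. by apply: zclosure_sub; [exact: zclosed_W24|move=> x []]. Qed.

(** An equation satisfied by both sheets of W24_param, hence by their closure.  On
    V02 it becomes the equation of V. *)
Lemma W24t_relation x : W24t x ->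
  4 * v3 x ^+ 3 + 27 * v4 x ^+ 2 - 16 * v1 x * v3 x - 12 * v2 x = 0.
Proof.
have p : polyfun (fun x : Cover =>
    4 * v3 x ^+ 3 + 27 * v4 x ^+ 2 - 16 * v1 x * v3 x - 12 * v2 x) by v_tac.
apply: (zclosure_zero p) => y [W nV].
have [a [c [e [a0 he ->]]]] := W24_param W (W24_off_V02 W nV).
by rewrite !v_of_v; case: he => ->; ring.
Qed.

Lemma sqrt_exists u : exists c, c ^+ 2 = u.
Proof. by exists (sqrtC u); rewrite sqrtCK. Qed.

(** The usual parametrization of the cusp; both square roots of v4^2 occur,
    exchanged by the sign of a. *)
Lemma cuspidal_param u3 u4 : 4 * u3 ^+ 3 + 27 * u4 ^+ 2 = 0 ->
  exists a, u3 = - 3 * a ^+ 2 /\ u4 = 2 * a ^+ 3.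
Proof.
move=> h; have [a ha] := sqrt_exists (- u3 / 3).
have u3E : u3 = - 3 * a ^+ 2 by rewrite ha; field.
have : u4 ^+ 2 = (2 * a ^+ 3) ^+ 2.
  have : 27 * (u4 ^+ 2 - (2 * a ^+ 3) ^+ 2) = 0 by rewrite -h u3E; ring.
  by move/eqP; rewrite mulf_eq0 pnatr_eq0 /= subr_eq0 => /eqP.
move/eqP; rewrite eqf_sqr => /orP[/eqP ->|/eqP ->]; first by exists a.
by exists (- a); rewrite sqrrN; split=> //; ring.
Qed.

(** The A_5 stratum is the curve c = 0 of A4_surface. *)
Lemma A5_sub_A4 : stratum R vA5 `<=` stratum R vA4.
Proof.
move=> x /A5P[L [h0 h2 h4 h]].
have v1E : v1 x = (v3 x / 2) ^+ 2.
  have -> : (v3 x / 2) ^+ 2 = v3 x ^+ 2 / 4 by field.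
  by move/eqP: h; rewrite subr_eq0 => /eqP ->; field.
have -> : x = A4_surface (v3 x / 2) 0.
  rewrite /A4_surface -{1}[x]of_vK// h0 h2 h4 v1E.
  have -> : 2 * (v3 x / 2) ^+ 2 * 0 = 0 by ring.
  have -> : (v3 x / 2) ^+ 2 * 0 ^+ 2 = 0 by ring.
  have -> : 2 * (v3 x / 2) - 3 * 0 ^+ 2 = v3 x by field.
  by have -> : 2 * 0 * (v3 x / 2 - 0 ^+ 2) = 0 by ring.
exact: A4_surface_closure.
Qed.

(** The D_5 stratum is the curve a = 0 of A4_surface. *)
Lemma D5_sub_A4 : stratum R vD5 `<=` stratum R vA4.
Proof.
move=> x /D5P[L [h0 h1 h2 /cuspidal_param[a [h3 h4]]]].
have -> : x = A4_surface 0 (- a).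
  rewrite /A4_surface -{1}[x]of_vK// h0 h1 h2 h3 h4.
  have -> : 2 * 0 ^+ 2 * - a = 0 by ring.
  have -> : 0 ^+ 2 * (- a) ^+ 2 = 0 by ring.
  have -> : 2 * 0 - 3 * (- a) ^+ 2 = - 3 * a ^+ 2 by ring.
  have -> : 2 * - a * (0 - (- a) ^+ 2) = 2 * a ^+ 3 by ring.
  by rewrite expr0n.
exact: A4_surface_closure.
Qed.

Lemma cip_diagram_stratum : cip_diagram (stratum R).
Proof.
have W2_A1 : stratum R vA2 `<=` stratum R vA1 by move=> x [].
have W23_A2 : stratum R vA3 `<=` stratum R vA2 by move=> x [].
have A4_A3 : stratum R vA4 `<=` stratum R vA3 by move=> x /W24t_W24[].
have D4_A3 : stratum R vD4 `<=` stratum R vA3.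
  move=> x /V02P[L [h0 h1 h2]]; apply/W23P; split=> //.
  by rewrite h0 h1 h2 !(expr0n, mulr0, mul0r) /= !(mul0r, subrr).
have D5_D4 : stratum R vD5 `<=` stratum R vD4 by move=> x [].
have E6_D5 : stratum R vE6 `<=` stratum R vD5.
  move=> x ->; have [h0 h1 h2 h3 h4] := v_at0; apply/D5P; split; first exact: Lcal0.
  by rewrite h0 h1 h2 h3 h4 !expr0n /= !mulr0 addr0.
have E6_A5 : stratum R vE6 `<=` stratum R vA5.
  move=> x ->; have [h0 h1 h2 h3 h4] := v_at0; apply/A5P; split; first exact: Lcal0.
  by rewrite h0 h1 h2 h3 h4 !expr0n /= !mulr0 subrr.
split.
- move=> a b []; [exact: W2_A1|exact: W23_A2|exact: A4_A3|exact: A5_sub_A4|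
    exact: D5_D4|exact: E6_D5|exact: D4_A3|exact: D5_sub_A4|exact: E6_A5].
- split=> //; first exact: D5_sub_A4.
  apply/seteqP; split=> x; first by move=> h; split; [exact: D5_sub_A4|exact: D5_D4].
  move=> [/W24t_relation h4 /V02P[L [h0 h1 h2]]].
  apply/D5P; split=> //; split=> //.
  by rewrite -h4 h1 h2; ring.
- split=> //; [exact: A5_sub_A4|exact: D5_sub_A4|].
  apply/seteqP; split=> x; first by move=> h; split; [exact: E6_A5|exact: E6_D5].
  move=> [/A5P[L [h0 h2 h4 h]] /D5P[_ [_ h1 _ _]]] /=.
  apply: eq0_of_v => //.
  by move/eqP: h; rewrite h1 mulr0 subr0 expf_eq0 => /andP[_ /eqP].
Qed.

End Strata.

(** * Generic types on the strata *)

Section GenericTypes.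
Variables (R : realType) (N : nat).
Hypothesis N_gt0 : (0 < N)%N.
Local Notation C := (Cx R).
Local Notation Cover := 'rV[C]_(6 + 2).
Implicit Types (x : Cover) (u a c e : C).

(** Taylor expansion at the critical point: the terms of degree 0 and 1 are the
    equations of Lcal. *)
Lemma f_def_local x (X : 'rV[C]_N.+1) : Lcal R x ->
  f_def (lsubmx x) X = squares N.-1 X +
    germ_at (rsubmx x) (v0 x) (v1 x) (v2 x) (v3 x) (v4 x) (plane_proj X).
Proof.
move=> /LcalP[]; rewrite /f_def /= /germ_at /dy /dz /v0 /v1 /v2 /v3 /v4.
rewrite -!/(yx x) -!/(zx x) -!/(lamx x _) !mxE /=.
move: (squares _ _) (ycoord X) (zcoord X) (yx x) (zx x) => s Y Z y z.
move: (lamx x 0) (lamx x 1) (lamx x 2) (lamx x 3) (lamx x 4) (lamx x 5).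
move=> l0 l1 l2 l3 l4 l5 e1 e2 e3.
transitivity (s + cubic_germ (l3 + 2 * l5 * z) (3 * y) (6 * z ^+ 2 + l4 + l5 * y) l5
     (4 * z) (Y - y) (Z - z)
   + (3 * y ^+ 2 + l1 + l3 * z + l5 * z ^+ 2) * (Y - y)
   + (4 * z ^+ 3 + 2 * l4 * z + l2 + y * (l3 + 2 * l5 * z)) * (Z - z)
   + (y ^+ 3 + z ^+ 4 + l0 + l1 * y + l2 * z + l3 * y * z + l4 * z ^+ 2 + l5 * y * z ^+ 2)).
  by rewrite /cubic_germ; ring.
by rewrite e1 e2 e3 !mul0r !addr0.
Qed.

Lemma type_at_of_germ t x : Lcal R x ->
  plane_type t (germ_at (rsubmx x) (v0 x) (v1 x) (v2 x) (v3 x) (v4 x)) (rsubmx x) ->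
  type_at R N t x.
Proof. by move=> Lx; apply: has_type_of_plane => // X; exact: f_def_local. Qed.

Definition open_A1 x : C := v1 x * (4 * v1 x * v2 x - v0 x ^+ 2).

(** On W2 it is 2 v1^3 (v4 - c^3 - c v3), where c is the slope of W2_slope. *)
Definition open_A2 x : C :=
  v1 x * (2 * v1 x ^+ 2 * v4 x - v0 x * (v2 x + v1 x * v3 x)).

(** The first factor in the parentheses discards the component of W23 on which v4 is
    the opposite of c^3 + c v3; the second is the equation of W4. *)
Definition open_A3 x : C :=
  v1 x * ((2 * v1 x ^+ 2 * v4 x + v0 x * (v2 x + v1 x * v3 x)) *
    (4 * v1 x ^+ 3 - (v1 x * v3 x + 3 * v2 x) ^+ 2)).

(** Selects the sheet e = 1 of W24_param and a nonzero slope c. *)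
Definition open_A4 x : C :=
  v1 x * (v0 x * (2 * v1 x ^+ 2 * v4 x + v0 x * (v2 x + v1 x * v3 x))).

Definition open_D4 x : C := 4 * v3 x ^+ 3 + 27 * v4 x ^+ 2.

Lemma type_A1 x : Lcal R x -> open_A1 x != 0 -> type_at R N (TypeA 1) x.
Proof.
move=> Lx; rewrite mulf_eq0 negb_or => /andP[h1 h2].
by apply: type_at_of_germ => //; exact: germ_A1.
Qed.

Lemma type_A2 x : W2 x -> open_A2 x != 0 -> type_at R N (TypeA 2) x.
Proof.
move=> [Lx h]; rewrite mulf_eq0 negb_or => /andP[h1 h2].
have [c [v0E v2E]] := W2_slope h1 h.
apply: type_at_of_germ => //; rewrite v0E v2E; apply: germ_A2 => //.
apply: contra_neq h2 => h2; rewrite v0E v2E.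
transitivity (2 * v1 x ^+ 2 * (v4 x - c ^+ 3 - c * v3 x)); first by ring.
by rewrite h2 mulr0.
Qed.

(** W3 says that v4^2 = (c^3 + c v3)^2, and the open condition selects the sign. *)
Lemma type_A3 x : W23 x -> open_A3 x != 0 -> type_at R N (TypeA 3) x.
Proof.
move=> /W23P[Lx [h hW3]]; rewrite mulf_eq0 negb_or => /andP[h1].
rewrite mulf_eq0 negb_or => /andP[h2 h3].
have [c [v0E v2E]] := W2_slope h1 h.
rewrite v0E v2E in hW3 h2 h3.
have v4E : v4 x = c ^+ 3 + c * v3 x.
  have : (2 * v1 x ^+ 2 * v4 x + 2 * v1 x * c * (v1 x * c ^+ 2 + v1 x * v3 x)) *
     (v4 x - (c ^+ 3 + c * v3 x)) = 0.
    apply: (mulfI h1); rewrite mulr0; apply: etrans (_ : 2 * 0 = 0); last by rewrite mulr0.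
    by rewrite -hW3; ring.
  by move/eqP; rewrite mulf_eq0 (negPf h2) /= subr_eq0 => /eqP.
apply: type_at_of_germ => //; rewrite v0E v2E v4E; apply: germ_A3 => //.
apply: contra_neq h3 => h3.
transitivity (v1 x ^+ 2 * (4 * v1 x - (3 * c ^+ 2 + v3 x) ^+ 2)); first by ring.
by rewrite h3 mulr0.
Qed.

Lemma type_A4 x : W24t x -> open_A4 x != 0 -> type_at R N (TypeA 4) x.
Proof.
move=> /W24t_W24 hx; rewrite mulf_eq0 negb_or => /andP[h1].
rewrite mulf_eq0 negb_or => /andP[h0 h2].
have Lx : Lcal R x by have /W24P[] := hx.
have [a [c [e [a0 he xE]]]] := W24_param hx h1.
rewrite xE !v_of_v in h0 h2.
have c0 : c != 0 by apply: contra_neq h0 => ->; rewrite mulr0.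
have e1 : e = 1.
  case: he => // e1; move: h2; rewrite e1.
  rewrite (_ : _ + _ = 0) ?eqxx//; ring.
rewrite e1 mul1r in xE.
by apply: type_at_of_germ => //; move: (rsubmx x) => q; rewrite xE !v_of_v; exact: germ_A4.
Qed.

Lemma type_A5 x : stratum R vA5 x -> v1 x != 0 -> type_at R N (TypeA 5) x.
Proof.
move=> /A5P[Lx [h0 h2 h4 h]] h1; apply: type_at_of_germ => //.
have v1E : v1 x = (v3 x / 2) ^+ 2.
  have -> : (v3 x / 2) ^+ 2 = v3 x ^+ 2 / 4 by field.
  by move/eqP: h; rewrite subr_eq0 => /eqP ->; field.
pose a := v3 x / 2; have v3E : v3 x = 2 * a by rewrite /a; field.
rewrite h0 h2 h4 v1E -/a v3E; apply: germ_A5.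
by apply: contra_neq h1; rewrite v1E -/a => ->; rewrite expr0n.
Qed.

Lemma type_D4 x : stratum R vD4 x -> open_D4 x != 0 -> type_at R N (TypeD 4) x.
Proof.
move=> /V02P[Lx [h0 h1 h2]] h; apply: type_at_of_germ => //.
by rewrite h0 h1 h2; exact: germ_D4.
Qed.

Lemma type_D5 x : stratum R vD5 x -> v3 x != 0 -> type_at R N (TypeD 5) x.
Proof.
move=> /D5P[Lx [h0 h1 h2 /cuspidal_param[a [h3 h4]]]] h.
apply: type_at_of_germ => //; rewrite h0 h1 h2 h3 h4; apply: germ_D5.
by apply: contra_neq h => a0; rewrite h3 a0 expr0n mulr0.
Qed.

Lemma type_E6 : type_at R N TypeE6 0.
Proof.
apply: type_at_of_germ; first exact: Lcal0.
by have [-> -> -> -> ->] := v_at0 R; exact: germ_E6.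
Qed.

Ltac v_tac := have ? := polyfun_v0 R; have ? := polyfun_v1 R; have ? := polyfun_v2 R;
  have ? := polyfun_v3 R; have ? := polyfun_v4 R; polyfun_tac.

Lemma polyfun_open_A1 : polyfun open_A1. Proof. by rewrite /open_A1; v_tac. Qed.
Lemma polyfun_open_A2 : polyfun open_A2. Proof. by rewrite /open_A2; v_tac. Qed.
Lemma polyfun_open_A3 : polyfun open_A3. Proof. by rewrite /open_A3; v_tac. Qed.
Lemma polyfun_open_A4 : polyfun open_A4. Proof. by rewrite /open_A4; v_tac. Qed.
Lemma polyfun_open_D4 : polyfun open_D4. Proof. by rewrite /open_D4; v_tac. Qed.

(** Segments in the coordinates v0, ..., v4, or in parameters for them, join a point
    of a stratum to a generic one. *)
Definition segment u w (t : C) : C := u + t * (w - u).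

Lemma segment0 u w : segment u w 0 = u. Proof. by rewrite /segment mul0r addr0. Qed.
Lemma segment1 u w : segment u w 1 = w. Proof. by rewrite /segment mul1r addrC subrK. Qed.
Lemma upoly_segment u w : upoly (segment u w).
Proof. by rewrite /segment; upoly_tac. Qed.

Lemma dense_A1 : Lcal R `<=` zclosure (Lcal R `&` [set x | open_A1 x != 0]).
Proof.
move=> x Lx; apply: (zclosure_rational_path polyfun_open_A1).
pose g t := of_v (segment (v0 x) 0 t) (segment (v1 x) 1 t) (segment (v2 x) 1 t)
  (segment (v3 x) 0 t) (segment (v4 x) 0 t).
exists g; split.
- by move=> i; apply: upoly_of_v; exact: upoly_segment.
- by rewrite /g !segment0 of_vK.
- by move=> t; exact: Lcal_of_v.
- rewrite /g !segment1 /open_A1 !v_of_v.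
  by rewrite !mulr1 expr0n /= subr0 mul1r pnatr_eq0.
Qed.

(** W2 is a quadric cone with parameters the coefficients of a square root
    a s + b t of the quadratic part. *)
Lemma W2_param x : W2 x -> exists a b,
  [/\ v1 x = a ^+ 2, v0 x = 2 * a * b & v2 x = b ^+ 2].
Proof.
move=> [_ /= h]; have [a ha] := sqrt_exists (v1 x).
have [v10|v1n] := eqVneq (v1 x) 0; last first.
  have [c [v0E v2E]] := W2_slope v1n h.
  by exists a, (a * c); rewrite v0E v2E -ha; split=> //; ring.
have [b hb] := sqrt_exists (v2 x); exists 0, b; rewrite v10 expr0n mulr0 mul0r.
split=> //; move/eqP: h; rewrite v10 mulr0 mul0r sub0r oppr_eq0 expf_eq0.
by move=> /andP[_ /eqP].
Qed.

Lemma dense_A2 : @W2 R `<=` zclosure (@W2 R `&` [set x | open_A2 x != 0]).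
Proof.
move=> x Wx; apply: (zclosure_rational_path polyfun_open_A2).
have [a [b [h1 h0 h2]]] := W2_param Wx.
pose A := segment a 1; pose B := segment b 0.
pose g t := of_v (2 * A t * B t) (A t ^+ 2) (B t ^+ 2)
  (segment (v3 x) 0 t) (segment (v4 x) 1 t).
have hA : upoly A by exact: upoly_segment.
have hB : upoly B by exact: upoly_segment.
exists g; split.
- move=> i; apply: upoly_of_v; try exact: upoly_segment; upoly_tac.
- by rewrite /g /A /B !segment0 -h0 -h1 -h2 of_vK//; case: Wx.
- move=> t; split; first exact: Lcal_of_v.
  by rewrite /= /g !v_of_v; ring.
- rewrite /g /A /B !segment1 /open_A2 !v_of_v.
  by rewrite !expr1n !mulr1 !mulr0 mul0r subr0 mul1r pnatr_eq0.
Qed.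

Lemma dense_A5 : stratum R vA5 `<=` zclosure (stratum R vA5 `&` [set x | v1 x != 0]).
Proof.
move=> x /A5P[L [h0 h2 h4 h]]; apply: (zclosure_rational_path (polyfun_v1 R)).
pose A := segment (v3 x / 2) 1.
pose g t := of_v 0 (A t ^+ 2) 0 (2 * A t) 0.
have hA : upoly A by exact: upoly_segment.
exists g; split.
- move=> i; apply: upoly_of_v; upoly_tac.
- rewrite /g /A segment0 -[RHS]of_vK// h0 h2 h4.
  have -> : (v3 x / 2) ^+ 2 = v1 x.
    have -> : (v3 x / 2) ^+ 2 = v3 x ^+ 2 / 4 by field.
    by move/eqP: h; rewrite subr_eq0 => /eqP ->; field.
  by have -> : 2 * (v3 x / 2) = v3 x by field.
- move=> t; apply/A5P; split; first exact: Lcal_of_v.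
  by rewrite /g !v_of_v; split=> //; ring.
- by rewrite /g /A segment1 !v_of_v expr1n oner_neq0.
Qed.

Lemma dense_D4 : stratum R vD4 `<=` zclosure (stratum R vD4 `&` [set x | open_D4 x != 0]).
Proof.
move=> x /V02P[L [h0 h1 h2]]; apply: (zclosure_rational_path polyfun_open_D4).
pose g t := of_v 0 0 0 (segment (v3 x) 1 t) (segment (v4 x) 0 t).
have c0 : upoly (fun _ : C => 0) := upoly_cst 0.
exists g; split.
- move=> i; apply: upoly_of_v; by [exact: c0|exact: upoly_segment].
- by rewrite /g !segment0 -[RHS]of_vK// h0 h1 h2.
- move=> t; apply/V02P; split; first exact: Lcal_of_v.
  by rewrite /g !v_of_v.
- rewrite /g !segment1 /open_D4 !v_of_v expr1n expr0n /= mulr0 addr0 mulr1.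
  by rewrite pnatr_eq0.
Qed.

Lemma dense_D5 : stratum R vD5 `<=` zclosure (stratum R vD5 `&` [set x | v3 x != 0]).
Proof.
move=> x /D5P[L [h0 h1 h2 /cuspidal_param[a [h3 h4]]]].
apply: (zclosure_rational_path (polyfun_v3 R)).
pose A := segment a 1.
pose g t := of_v 0 0 0 (- 3 * A t ^+ 2) (2 * A t ^+ 3).
have hA : upoly A by exact: upoly_segment.
exists g; split.
- move=> i; apply: upoly_of_v; upoly_tac.
- by rewrite /g /A segment0 -h3 -h4 -[RHS]of_vK// h0 h1 h2.
- move=> t; apply/D5P; split; first exact: Lcal_of_v.
  by rewrite /g !v_of_v; split=> //; ring.
- by rewrite /g /A segment1 !v_of_v !expr1n mulr1 oppr_eq0 pnatr_eq0.
Qed.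

Lemma densely_generic_stratum v : v <> vA3 -> v <> vA4 ->
  densely_generically (stratum R v) (type_at R N (vertex_type v)).
Proof.
case: v => // _ _.
- exists [set x | open_A1 x != 0]; split.
  + exact: zopen_neq0 polyfun_open_A1.
  + exact: dense_A1.
  + by move=> x [Sx Ox]; exact: type_A1.
- exists [set x | open_A2 x != 0]; split.
  + exact: zopen_neq0 polyfun_open_A2.
  + exact: dense_A2.
  + by move=> x [Sx Ox]; exact: type_A2.
- exists [set x | v1 x != 0]; split.
  + exact: zopen_neq0 (polyfun_v1 R).
  + exact: dense_A5.
  + by move=> x [Sx Ox]; exact: type_A5.
- exists [set x | open_D4 x != 0]; split.
  + exact: zopen_neq0 polyfun_open_D4.
  + exact: dense_D4.
  + by move=> x [Sx Ox]; exact: type_D4.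
- exists [set x | v3 x != 0]; split.
  + exact: zopen_neq0 (polyfun_v3 R).
  + exact: dense_D5.
  + by move=> x [Sx Ox]; exact: type_D5.
- exists setT; split; first exact: zopenT.
  + by rewrite setIT; exact: sub_zclosure.
  + by move=> x [-> _]; exact: type_E6.
Qed.

Lemma stratum_nonempty v : stratum R v !=set0.
Proof.
have [sub _ _] := cip_diagram_stratum R.
have E6 : stratum R vE6 0 by [].
have D5 : stratum R vD5 0 by exact: sub arrow_D5_E6 _ E6.
have A5 : stratum R vA5 0 by exact: sub arrow_A5_E6 _ E6.
have A4 : stratum R vA4 0 by exact: sub arrow_A4_D5 _ D5.
have D4 : stratum R vD4 0 by exact: sub arrow_D4_D5 _ D5.
have A3 : stratum R vA3 0 by exact: sub arrow_A3_A4 _ A4.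
have A2 : stratum R vA2 0 by exact: sub arrow_A2_A3 _ A3.
have A1 : stratum R vA1 0 by exact: sub arrow_A1_A2 _ A2.
by case: v; exists 0.
Qed.

Lemma generically_of_dense n (S : set 'rV[C]_n) P : S !=set0 ->
  densely_generically S P -> generically S P.
Proof.
move=> [x Sx] [U [Uo SU UP]]; exists U; split=> //.
exact: zclosure_nonempty (SU x Sx).
Qed.

(** For A_3 and A_4 a single point of the right component is enough to make the open
    condition nonempty. *)
Lemma verifies_stratum : verifies N arnold_arrow (stratum R).
Proof.
split; first by have [] := cip_diagram_stratum R.
move=> v; case: (pselect (v = vA3)) => [->|h3].
  exists [set x | open_A3 x != 0]; split.
  - exact: zopen_neq0 polyfun_open_A3.
  - exists (of_v 2 1 1 0 1); split.
      apply/W23P; split; first exact: Lcal_of_v.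
      by rewrite !v_of_v; split; ring.
    rewrite /= /open_A3 !v_of_v.
    rewrite (_ : 1 * _ = - 20); last by ring.
    by rewrite oppr_eq0 pnatr_eq0.
  - by move=> x [Sx Ox]; exact: type_A3.
case: (pselect (v = vA4)) => [->|h4].
  exists [set x | open_A4 x != 0]; split.
  - exact: zopen_neq0 polyfun_open_A4.
  - exists (A4_surface 1 2); split; first exact: A4_surface_closure.
    rewrite /= /open_A4 /A4_surface !v_of_v.
    rewrite (_ : _ * _ = - 192); last by ring.
    by rewrite oppr_eq0 pnatr_eq0.
  - by move=> x [Sx Ox]; exact: type_A4.
apply: generically_of_dense; first exact: stratum_nonempty.
exact: densely_generic_stratum.
Qed.

End GenericTypes.

(** * The critical points as a joint spectrum *)

Section JointSpectrum.
Variable K : numClosedFieldType.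

(** Polynomial expressions in y and z, to be evaluated at numbers and at commuting
    matrices alike. *)
Inductive biexpr := BY | BZ | BC of K | BA of biexpr & biexpr | BM of biexpr & biexpr.

Fixpoint bival (e : biexpr) (y z : K) : K :=
  match e with
  | BY => y | BZ => z | BC c => c
  | BA e1 e2 => bival e1 y z + bival e2 y z
  | BM e1 e2 => bival e1 y z * bival e2 y z
  end.

Fixpoint bimx n (A B : 'M[K]_n) (e : biexpr) : 'M[K]_n :=
  match e with
  | BY => A | BZ => B | BC c => c%:M
  | BA e1 e2 => bimx A B e1 + bimx A B e2
  | BM e1 e2 => bimx A B e1 *m bimx A B e2
  end.

Lemma mulmx_trig n (A B : 'M[K]_n) : is_trig_mx A -> is_trig_mx B ->
  is_trig_mx (A *m B) /\ forall i, (A *m B) i i = A i i * B i i.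
Proof.
move=> /is_trig_mxP hA /is_trig_mxP hB; split.
  apply/is_trig_mxP => i j ij; rewrite mxE big1// => k _.
  have [ik|ki] := ltnP i k; first by rewrite hA ?mul0r.
  by rewrite hB ?mulr0// (leq_ltn_trans ki).
move=> i; rewrite mxE (bigD1 i)//= big1 ?addr0// => k.
rewrite -val_eqE /= neq_ltn => /orP[ki|ik]; first by rewrite hB ?mulr0.
by rewrite hA ?mul0r.
Qed.

Lemma bimx_comm n (A B : 'M[K]_n) e : A *m B = B *m A ->
  comm_mx (bimx A B e) A /\ comm_mx (bimx A B e) B.
Proof.
move=> AB; elim: e => [||c|e1 [IH1 IH1'] e2 [IH2 IH2']|e1 [IH1 IH1'] e2 [IH2 IH2']] //=.
- by split; apply/comm_mx_sym/comm_mx_scalar.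
- by split; apply/comm_mx_sym; apply: comm_mxD; apply/comm_mx_sym.
- by split; apply/comm_mx_sym; apply: comm_mxM; apply/comm_mx_sym.
Qed.

(** Commuting matrices over an algebraically closed field are simultaneously
    triangularizable, and the diagonal entries of a polynomial in them are the
    values of this polynomial at the pairs of diagonal entries. *)
Theorem joint_spectrum n (A B : 'M[K]_n) : A *m B = B *m A ->
  exists a b : 'I_n -> K, forall e,
  [/\ \det (bimx A B e) = \prod_i bival e (a i) (b i),
      \tr (bimx A B e) = \sum_i bival e (a i) (b i) &
      bimx A B e = 0 -> forall i, bival e (a i) (b i) = 0].
Proof.
move=> AB; have [P Pu /andP[tA tB]] := cotrigonalization2 AB.
have Pn := unitarymx_unit Pu.
pose T M := P *m M *m invmx P.
have TM X Y : T (X *m Y) = T X *m T Y by rewrite /T !mulmxA mulmxKV.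
have TD X Y : T (X + Y) = T X + T Y by rewrite /T mulmxDr mulmxDl.
have TC c : T c%:M = c%:M by rewrite /T scalar_mxC mulmxK.
have {}tA : is_trig_mx (T A) by rewrite /T -conjumx.
have {}tB : is_trig_mx (T B) by rewrite /T -conjumx.
exists (fun i => T A i i), (fun i => T B i i) => e.
have [te de] : is_trig_mx (T (bimx A B e)) /\
    forall i, T (bimx A B e) i i = bival e (T A i i) (T B i i).
  elim: e => [||c|e1 [IH1 IH1'] e2 [IH2 IH2']|e1 [IH1 IH1'] e2 [IH2 IH2']] //=.
  - by rewrite TC; split; [exact: scalar_mx_is_trig|move=> i; rewrite mxE eqxx].
  - rewrite TD; split; last by move=> i; rewrite mxE IH1' IH2'.
    apply/is_trig_mxP => i j ij; rewrite mxE.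
    by rewrite (is_trig_mxP IH1)// (is_trig_mxP IH2)// addr0.
  - have [h1 h2] := mulmx_trig IH1 IH2.
    by rewrite TM; split=> // i; rewrite h2 IH1' IH2'.
split.
- have -> : \det (bimx A B e) = \det (T (bimx A B e)).
    rewrite /T !det_mulmx mulrAC -det_mulmx mulmxV// det1 mul1r//.
  by rewrite det_trig//; apply: eq_bigr => i _.
- have -> : \tr (bimx A B e) = \tr (T (bimx A B e)).
    by rewrite /T mxtrace_mulC mulmxA mulVmx// mul1mx.
  by apply: eq_bigr => i _.
- by move=> e0 i; rewrite -de e0 /T mulmx0 mul0mx mxE.
Qed.

End JointSpectrum.

Section Multiplication.
Variable K : numClosedFieldType.
Variables l1 l2 l3 l4 l5 : K.

Definition mx_of_rows (r : seq (seq K)) : 'M[K]_6 :=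
  \matrix_(i, j) nth 0 (nth [::] r i) j.

Definition row_z3 := [:: - l2 / 4; - l4 / 2; 0; - l3 / 4; - l5 / 2; 0].
Definition row_y2 := [:: - l1 / 3; - l3 / 3; - l5 / 3; 0; 0; 0].
Definition row_y2z := [:: l5 * l2 / 12; - l1 / 3 + l5 * l4 / 6; - l3 / 3;
  l5 * l3 / 12; l5 ^+ 2 / 6; 0].
Definition row_y2z2 := [:: l3 * l2 / 12; l3 * l4 / 6 + l5 * l2 / 12;
  - l1 / 3 + l5 * l4 / 6; l3 ^+ 2 / 12; l3 * l5 / 4; l5 ^+ 2 / 6].
Definition row_yz3 := [:: l3 * l1 / 12 - l5 ^+ 2 * l2 / 24;
  l3 ^+ 2 / 12 + l5 * l1 / 6 - l5 ^+ 2 * l4 / 12; l3 * l5 / 4;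
  - l2 / 4 - l5 ^+ 2 * l3 / 24; - l4 / 2 - l5 ^+ 3 / 12; 0].

(** Multiplication by y, and below by z, on C[y, z] modulo the critical equations, in
    the basis 1, z, z^2, y, yz, yz^2.  Row i expands the product with the i-th
    basis element; the named rows are the products that have to be reduced by
    the equations, which give y^2 and z^3. *)
Definition mult_y := mx_of_rows [:: [:: 0; 0; 0; 1; 0; 0]; [:: 0; 0; 0; 0; 1; 0];
  [:: 0; 0; 0; 0; 0; 1]; row_y2; row_y2z; row_y2z2].
Definition mult_z := mx_of_rows [:: [:: 0; 1; 0; 0; 0; 0]; [:: 0; 0; 1; 0; 0; 0];
  row_z3; [:: 0; 0; 0; 0; 1; 0]; [:: 0; 0; 0; 0; 0; 1]; row_yz3].

Lemma mult_comm : mult_y *m mult_z = mult_z *m mult_y.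
Proof.
apply/matrixP => i j; rewrite !mxE !big_ord_recl !big_ord0 /mult_y /mult_z !mxE.
case: i => [[|[|[|[|[|[|//]]]]]] Hi]; case: j => [[|[|[|[|[|[|//]]]]]] Hj];
  by rewrite /=; field.
Qed.

Definition base_row (i : 'I_6) : 'rV[K]_6 := delta_mx ord0 i.

Lemma base_row_mul (r : seq (seq K)) i :
  base_row i *m mx_of_rows r = \row_j nth 0 (nth [::] r i) j.
Proof. by rewrite -rowE; apply/rowP => j; rewrite !mxE. Qed.

Lemma shift_rows : [/\ base_row 0 *m mult_z = base_row 1, base_row 1 *m mult_z = base_row 2,
  base_row 3 *m mult_z = base_row 4, base_row 4 *m mult_z = base_row 5 &
  base_row 0 *m mult_y = base_row 3].
Proof.
split; rewrite base_row_mul; apply/rowP => -[[|[|[|[|[|[|//]]]]]] Hj]; by rewrite !mxE.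
Qed.

(** The class of 1 generates the quotient algebra, so a matrix commuting with both
    multiplications is determined by its first row. *)
Lemma mult_faithful (M : 'M[K]_6) : M *m mult_y = mult_y *m M ->
  M *m mult_z = mult_z *m M -> base_row 0 *m M = 0 -> M = 0.
Proof.
move=> My Mz M0; have [s01 s12 s34 s45 s03] := shift_rows.
have stepz i j : base_row i *m mult_z = base_row j -> base_row i *m M = 0 -> base_row j *m M = 0.
  by move=> <- h; rewrite -mulmxA -Mz mulmxA h mul0mx.
have h1 := stepz _ _ s01 M0; have h2 := stepz _ _ s12 h1.
have h3 : base_row 3 *m M = 0 by rewrite -s03 -mulmxA -My mulmxA M0 mul0mx.
have h4 := stepz _ _ s34 h3; have h5 := stepz _ _ s45 h4.
apply/row_matrixP => i; rewrite row0 rowE -/(base_row i).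
case: i => [[|[|[|[|[|[|//]]]]]] Hi];
  [move: M0|move: h1|move: h2|move: h3|move: h4|move: h5] => h;
  rewrite -[RHS]h; congr (base_row _ *m _); exact: val_inj.
Qed.

Definition expr_crit_y : biexpr K :=
  BA (BA (BA (BM (BC 3) (BM (BY K) (BY K))) (BC l1)) (BM (BC l3) (BZ K)))
    (BM (BC l5) (BM (BZ K) (BZ K))).

Definition expr_crit_z : biexpr K :=
  BA (BA (BA (BM (BC 4) (BM (BZ K) (BM (BZ K) (BZ K)))) (BM (BC (2 * l4)) (BZ K))) (BC l2))
    (BM (BY K) (BA (BC l3) (BM (BC (2 * l5)) (BZ K)))).

(** The critical equations hold for the two matrices; by mult_faithful, only their
    effect on the class of 1 has to be computed. *)
Lemma mult_crit_y : bimx mult_y mult_z expr_crit_y = 0.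
Proof.
have [cy cz] := bimx_comm expr_crit_y mult_comm.
apply: mult_faithful => //; rewrite /= !mulmxDr !mul_scalar_mx -!scalemxAr mul_mx_scalar !mulmxA.
have [s01 s12 s34 s45 s03] := shift_rows; rewrite s03 s01 s12.
rewrite base_row_mul; apply/rowP => -[[|[|[|[|[|[|//]]]]]] Hj]; rewrite !mxE /=; by field.
Qed.

Lemma mult_crit_z : bimx mult_y mult_z expr_crit_z = 0.
Proof.
have [cy cz] := bimx_comm expr_crit_z mult_comm.
apply: mult_faithful => //; rewrite /= !mulmxDr !mul_scalar_mx -!scalemxAr !mul_mx_scalar.
rewrite -!scalemxAr !mulmxA.
have [s01 s12 s34 s45 s03] := shift_rows; rewrite s03 s34 s01 s12.
rewrite base_row_mul; apply/rowP => -[[|[|[|[|[|[|//]]]]]] Hj]; rewrite !mxE /=; by field.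
Qed.

(** The values of the basis at a point.  At a critical point they form a joint
    eigenvector. *)
Definition base_col (y z : K) : 'cV[K]_6 :=
  \col_i nth 0 [:: 1; z; z ^+ 2; y; y * z; y * z ^+ 2] i.

Lemma base_col_neq0 y z : base_col y z != 0.
Proof.
by apply/eqP => /colP/(_ ord0); rewrite !mxE => /eqP; rewrite oner_eq0.
Qed.

Lemma mult_eigen y z :
  3 * y ^+ 2 + l1 + l3 * z + l5 * z ^+ 2 = 0 ->
  4 * z ^+ 3 + 2 * l4 * z + l2 + y * (l3 + 2 * l5 * z) = 0 ->
  mult_y *m base_col y z = y *: base_col y z /\
  mult_z *m base_col y z = z *: base_col y z.
Proof.
move=> e1 e2.
have l1E : l1 = - (3 * y ^+ 2 + l3 * z + l5 * z ^+ 2).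
  by apply/eqP; rewrite -addr_eq0 -[X in _ == X]e1; apply/eqP; ring.
have l2E : l2 = - (4 * z ^+ 3 + 2 * l4 * z + y * (l3 + 2 * l5 * z)).
  by apply/eqP; rewrite -addr_eq0 -[X in _ == X]e2; apply/eqP; ring.
rewrite /mult_y /mult_z /row_z3 /row_y2 /row_y2z /row_y2z2 /row_yz3 l1E l2E.
by split; apply/colP => i; rewrite !mxE !big_ord_recl big_ord0 !mxE;
  case: i => [[|[|[|[|[|[|//]]]]]] Hi]; rewrite /=; field.
Qed.

Lemma bimx_eigen e y z :
  3 * y ^+ 2 + l1 + l3 * z + l5 * z ^+ 2 = 0 ->
  4 * z ^+ 3 + 2 * l4 * z + l2 + y * (l3 + 2 * l5 * z) = 0 ->
  bimx mult_y mult_z e *m base_col y z = bival e y z *: base_col y z.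
Proof.
move=> e1 e2; have [hy hz] := mult_eigen e1 e2.
elim: e => [||c|f IHf g IHg|f IHf g IHg] //=.
- by rewrite mul_scalar_mx.
- by rewrite mulmxDl IHf IHg scalerDl.
- by rewrite -mulmxA IHg -scalemxAr IHf scalerA mulrC.
Qed.

(** Finitely many nonzero vectors of the plane avoid the kernel of some linear form
    of the shape u + t v. *)
Lemma exists_separating_slope (I : finType) (u v : I -> K) :
  (forall i, u i != 0 \/ v i != 0) -> exists t, forall i, u i + t * v i != 0.
Proof.
move=> h; pose p := \prod_i ((u i)%:P + v i *: 'X).
have pE i t : ((u i)%:P + v i *: 'X).[t] = u i + t * v i.
  by rewrite hornerD hornerC hornerZ hornerX mulrC.
have p0 : p != 0.
  apply/prodf_neq0 => i _; apply/eqP => e.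
  have e0 := congr1 (fun q : {poly K} => q.[0]) e.
  have e1 := congr1 (fun q : {poly K} => q.[1]) e.
  rewrite /= pE horner0 mul0r addr0 in e0; rewrite /= pE horner0 e0 add0r mul1r in e1.
  by have [] := h i; rewrite ?e0 ?e1 eqxx.
have [t ht] : exists t, p.[t] != 0.
  apply: contrapT => nt; move/eqP: p0; apply; apply: poly_vanish => t.
  by apply/eqP/negPn/negP => pt; apply: nt; exists t.
exists t => i; apply: contra_neq ht => e; rewrite /p horner_prod.
by apply/eqP/prodf_eq0; exists i => //; rewrite pE e.
Qed.

(** A joint eigenvalue is a critical point because the matrices satisfy the critical
    equations.  Conversely, were a critical point (y, z) none of the joint
    eigenvalues, some linear form vanishing at (y, z) would be nonzero at all of
    them, hence invertible on the matrices, although base_col y z is in its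
    kernel. *)
Theorem critical_spectrum : exists a b : 'I_6 -> K,
  (forall e, \det (bimx mult_y mult_z e) = \prod_i bival e (a i) (b i) /\
     \tr (bimx mult_y mult_z e) = \sum_i bival e (a i) (b i)) /\
  forall y z, (3 * y ^+ 2 + l1 + l3 * z + l5 * z ^+ 2 = 0 /\
     4 * z ^+ 3 + 2 * l4 * z + l2 + y * (l3 + 2 * l5 * z) = 0) <->
   exists i, y = a i /\ z = b i.
Proof.
have [a [b hab]] := joint_spectrum mult_comm.
exists a, b; split; first by move=> e; have [] := hab e.
move=> y z; split; last first.
  move=> [i [-> ->]]; split.
    have [_ _ /(_ mult_crit_y i) /= h] := hab expr_crit_y.
    by rewrite -[RHS]h; ring.
  have [_ _ /(_ mult_crit_z i) /= h] := hab expr_crit_z.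
  by rewrite -[RHS]h; ring.
move=> [e1 e2]; apply: contrapT => nex.
have sep i : a i - y != 0 \/ b i - z != 0.
  apply: contrapT => h; apply: nex; exists i.
  split; apply/eqP; rewrite eq_sym -subr_eq0; apply/negPn/negP => ?; apply: h; by [left|right].
have [t ht] := exists_separating_slope sep.
(* The linear form (Y - y) + t (Z - z). *)
pose e := BA (BA (BY K) (BC (- y))) (BM (BC t) (BA (BZ K) (BC (- z)))).
have [de _ _] := hab e.
have : bimx mult_y mult_z e *m base_col y z = 0.
  by rewrite bimx_eigen// /= !subrr mulr0 addr0 scale0r.
have u : bimx mult_y mult_z e \in unitmx.
  by rewrite unitmxE unitfE de; apply/prodf_neq0 => i _; exact: ht.
move=> /(congr1 (mulmx (invmx (bimx mult_y mult_z e)))).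
rewrite mulKmx// mulmx0 => h; have := base_col_neq0 y z.
by rewrite h eqxx.
Qed.

End Multiplication.

(** * The six critical points over the base *)

Section CriticalPoints.
Variable R : realType.
Local Notation C := (Cx R).
Local Notation T1 := 'rV[C]_6.
Local Notation Cover := 'rV[C]_(6 + 2).
Implicit Types (l : T1) (q : 'rV[C]_2).

(** The multiplication operator of an expression on the algebra of the critical
    points of f_l. *)
Definition alg_mx l (e : biexpr C) : 'M[C]_6 :=
  bimx (mult_y (lam l 1) (lam l 2) (lam l 3) (lam l 4) (lam l 5))
    (mult_z (lam l 1) (lam l 2) (lam l 3) (lam l 4) (lam l 5)) e.

Definition bival_at (e : biexpr C) q : C := bival e (q ord0 ord0) (q ord0 ord_max).

(** Determinants and traces of multiplication operators are the products and sums of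
    values over the critical points.  This is how symmetric functions of the
    critical points are seen to be polynomial in l. *)
Lemma critical_points_exist : exists p : 'I_6 -> T1 -> 'rV[C]_2,
  [/\ forall l e, \det (alg_mx l e) = \prod_i bival_at e (p i l),
      forall l e, \tr (alg_mx l e) = \sum_i bival_at e (p i l) &
      forall l q, critical l q <-> exists i, q = p i l].
Proof.
have /choice[p hp] : forall l, exists p : 'I_6 -> 'rV[C]_2,
  [/\ forall e, \det (alg_mx l e) = \prod_i bival_at e (p i),
      forall e, \tr (alg_mx l e) = \sum_i bival_at e (p i) &
      forall q, critical l q <-> exists i, q = p i].
  move=> l.
  have [a [b [hab hcrit]]] := critical_spectrum (lam l 1) (lam l 2) (lam l 3) (lam l 4) (lam l 5).
  exists (fun i => \row_j (if j == ord0 then a i else b i)); split.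
  - by move=> e; have [-> _] := hab e; apply: eq_bigr => i _; rewrite /bival_at !mxE.
  - by move=> e; have [_ ->] := hab e; apply: eq_bigr => i _; rewrite /bival_at !mxE.
  - move=> q; apply: iff_trans (hcrit (q ord0 ord0) (q ord0 ord_max)) _.
    split=> [] [k]; first by move=> [h0 h1]; exists k; apply/rowP; apply: ord2P; rewrite !mxE.
    by move=> ->; exists k; rewrite !mxE.
exists (fun i l => p l i); split=> l; by have [h1 h2 h3] := hp l.
Qed.

Definition polymx n (M : T1 -> 'M[C]_n) := forall i j, polyfun (fun l => M l i j).

Lemma polymxD n (M M' : T1 -> 'M[C]_n) : polymx M -> polymx M' -> polymx (fun l => M l + M' l).
Proof.
move=> h h' i j; apply: (polyfun_ext (h := fun l => M l i j + M' l i j)).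
  by move=> l; rewrite mxE.
exact: polyfun_add.
Qed.

Lemma polymxM n (M M' : T1 -> 'M[C]_n) : polymx M -> polymx M' -> polymx (fun l => M l *m M' l).
Proof.
move=> h h' i j; apply: (polyfun_ext (h := fun l => \sum_k M l i k * M' l k j)).
  by move=> l; rewrite mxE.
by apply: polyfun_sum => k; exact: polyfun_mul.
Qed.

Lemma polymxC n (f : T1 -> C) : polyfun f -> polymx (fun l => (f l)%:M : 'M[C]_n).
Proof.
move=> h i j; apply: (polyfun_ext (h := fun l => f l * (i == j)%:R)).
  by move=> l; rewrite mxE mulr_natr.
by apply: polyfun_mul => //; exact: polyfun_cst.
Qed.

Lemma polyfun_lam k : polyfun (fun l : T1 => lam l k).
Proof. exact: polyfun_coord. Qed.

Ltac lam_tac := have ? := polyfun_lam 0; have ? := polyfun_lam 1; have ? := polyfun_lam 2;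
  have ? := polyfun_lam 3; have ? := polyfun_lam 4; have ? := polyfun_lam 5.

Lemma polymx_mult_y : polymx (fun l => alg_mx l (BY C)).
Proof.
lam_tac; move=> i j.
apply: (polyfun_ext (h := fun l => (alg_mx l (BY C)) i j)) => //.
rewrite /alg_mx /= /mult_y /mx_of_rows.
case: i => [[|[|[|[|[|[|//]]]]]] Hi]; case: j => [[|[|[|[|[|[|//]]]]]] Hj];
 (eapply polyfun_ext; [move=> l; rewrite mxE /=; reflexivity|]); polyfun_tac.
Qed.

Lemma polymx_mult_z : polymx (fun l => alg_mx l (BZ C)).
Proof.
lam_tac; move=> i j.
rewrite /alg_mx /= /mult_z /mx_of_rows.
case: i => [[|[|[|[|[|[|//]]]]]] Hi]; case: j => [[|[|[|[|[|[|//]]]]]] Hj];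
 (eapply polyfun_ext; [move=> l; rewrite mxE /=; reflexivity|]); polyfun_tac.
Qed.

Fixpoint bipow (e : biexpr C) k := if k is k'.+1 then BM e (bipow e k') else BC 1.

Lemma bival_pow e k q : bival_at (bipow e k) q = bival_at e q ^+ k.
Proof. by elim: k => [|k IH] //=; rewrite exprS -IH. Qed.

Local Notation Y := (BY C).
Local Notation Z := (BZ C).

Definition value_expr l : biexpr C :=
  BA (BA (BA (BA (BA (BA (BA (bipow Y 3) (bipow Z 4)) (BC (lam l 0))) (BM (BC (lam l 1)) Y))
    (BM (BC (lam l 2)) Z)) (BM (BC (lam l 3)) (BM Y Z))) (BM (BC (lam l 4)) (bipow Z 2)))
    (BM (BC (lam l 5)) (BM Y (bipow Z 2))).

Lemma value_exprE l q : bival_at (value_expr l) q = crit_value l q.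
Proof. by rewrite /bival_at /crit_value /=; ring. Qed.

Definition slope_expr l : biexpr C := BA (BC (lam l 3)) (BM (BC (2 * lam l 5)) Z).

(** The Hessian determinant of f_Lambda in y and z. *)
Definition hess_expr l : biexpr C :=
  BA (BM (BM (BC 6) Y) (BA (BA (BM (BC 12) (bipow Z 2)) (BC (2 * lam l 4)))
     (BM (BC (2 * lam l 5)) Y)))
   (BM (BC (-1)) (bipow (slope_expr l) 2)).

Definition hessian l q : C :=
  let y := q ord0 ord0 in let z := q ord0 ord_max in
  6 * y * (12 * z ^+ 2 + 2 * lam l 4 + 2 * lam l 5 * y) - (lam l 3 + 2 * lam l 5 * z) ^+ 2.

Lemma hess_exprE l q : bival_at (hess_expr l) q = hessian l q.
Proof. by rewrite /bival_at /hessian /=; ring. Qed.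

(** A linear form that separates the critical points of a particular member, good_l,
    hence of the generic one. *)
Definition sep_expr : biexpr C := BA Y (BM (BC 3) Z).

Definition polyexpr (e : T1 -> biexpr C) := polymx (fun l => alg_mx l (e l)).

Lemma polyexprA (e e' : T1 -> biexpr C) :
  polyexpr e -> polyexpr e' -> polyexpr (fun l => BA (e l) (e' l)).
Proof. exact: polymxD. Qed.

Lemma polyexprM (e e' : T1 -> biexpr C) :
  polyexpr e -> polyexpr e' -> polyexpr (fun l => BM (e l) (e' l)).
Proof. exact: polymxM. Qed.

Lemma polyexprC (f : T1 -> C) : polyfun f -> polyexpr (fun l => BC (f l)).
Proof. exact: polymxC. Qed.

Lemma polyexpr_pow (e : T1 -> biexpr C) k : polyexpr e -> polyexpr (fun l => bipow (e l) k).
Proof.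
by move=> h; elim: k => [|k IH]; [apply: polyexprC; exact: polyfun_cst|exact: polyexprM].
Qed.

Ltac polyexpr_tac := lam_tac; rewrite ?/value_expr ?/hess_expr ?/slope_expr ?/sep_expr;
  repeat lazymatch goal with
  | |- polyexpr (fun l => BA _ _) => apply: polyexprA
  | |- polyexpr (fun l => BM _ _) => apply: polyexprM
  | |- polyexpr (fun l => BC _) => apply: polyexprC; polyfun_tac
  | |- polyexpr (fun l => bipow _ _) => apply: polyexpr_pow
  | |- polyexpr (fun l => BY _) => exact: polymx_mult_y
  | |- polyexpr (fun l => BZ _) => exact: polymx_mult_z
  end.

Lemma polyfun_value : polyfun (fun l => \det (alg_mx l (value_expr l))).
Proof. by apply: polyfun_det; change (polyexpr value_expr); polyexpr_tac. Qed.

Lemma polyfun_hess : polyfun (fun l => \det (alg_mx l (hess_expr l))).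
Proof. by apply: polyfun_det; change (polyexpr hess_expr); polyexpr_tac. Qed.

Lemma polymx_sep k : polymx (fun l => alg_mx l (bipow sep_expr k)).
Proof. by change (polyexpr (fun l => bipow sep_expr k)); polyexpr_tac. Qed.

(** The Hankel matrix of the power sums of the values of the linear form has
    determinant the square of their Vandermonde determinant. *)
Definition sep_disc l : C := \det (\matrix_(i < 6, j < 6) \tr (alg_mx l (bipow sep_expr (i + j)))).

Lemma polyfun_sep : polyfun sep_disc.
Proof.
apply: polyfun_det => i j.
apply: (polyfun_ext (h := fun l => \sum_k alg_mx l (bipow sep_expr (i + j)) k k)).
  by move=> l; rewrite mxE.
by apply: polyfun_sum => k; exact: polymx_sep.
Qed.

Lemma sep_discE l (p : 'I_6 -> 'rV[C]_2) :
  (forall e, \tr (alg_mx l e) = \sum_i bival_at e (p i)) ->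
  sep_disc l = \det (Vandermonde 6 (\row_i bival_at sep_expr (p i))) ^+ 2.
Proof.
move=> h; rewrite expr2 -[X in _ * X]det_tr -det_mulmx; congr (\det _).
apply/matrixP => i j; rewrite !mxE h; apply: eq_bigr => k _.
by rewrite bival_pow !mxE exprD.
Qed.

Lemma sep_disc_inj l (p : 'I_6 -> 'rV[C]_2) :
  (forall e, \tr (alg_mx l e) = \sum_i bival_at e (p i)) ->
  sep_disc l != 0 <-> injective (fun i => bival_at sep_expr (p i)).
Proof.
move=> /sep_discE ->; rewrite expf_eq0 /= det_Vandermonde; split.
  move=> d i j e; apply/eqP; apply: contraNT d => ij.
  have {ij} [ij|ij] : (i < j)%N \/ (j < i)%N by apply/orP; rewrite -neq_ltn.
    apply/prodf_eq0; exists i => //; apply/prodf_eq0; exists j => //.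
    by rewrite !mxE e subrr.
  apply/prodf_eq0; exists j => //; apply/prodf_eq0; exists i => //.
  by rewrite !mxE e subrr.
move=> inj; apply/prodf_neq0 => i _; apply/prodf_neq0 => j ij.
rewrite !mxE subr_eq0; apply: contraTneq ij => /inj ->; by rewrite ltnn.
Qed.

(** The member y^3 + z^4 - 3 y - 2 z^2, whose critical points are the pairs (y, z)
    with y = 1, -1 and z = 0, 1, -1. *)
Definition good_l : T1 := \row_i nth 0 [:: 0; - 3; 0; 0; - 2; 0] i.

Lemma lam_good k : (k < 6)%N -> lam good_l k = nth 0 [:: 0; - 3; 0; 0; - 2; 0] k.
Proof. by move=> k6; rewrite /lam mxE inordK. Qed.

Lemma critical_good q : critical good_l q <->
  (q ord0 ord0 = 1 \/ q ord0 ord0 = -1) /\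
  (q ord0 ord_max = 0 \/ q ord0 ord_max = 1 \/ q ord0 ord_max = -1).
Proof.
rewrite /critical !lam_good //=; move: (q ord0 ord0) (q ord0 ord_max) => y z.
split; last first.
  by move=> [[->|->] [->|[->|->]]]; split; ring.
move=> [h1 h2]; split.
  have : 3 * (y ^+ 2 - 1 ^+ 2) = 0 by rewrite -h1; ring.
  move/eqP; rewrite mulf_eq0 pnatr_eq0 /= subr_eq0 eqf_sqr.
  by move=> /orP[/eqP ->|/eqP ->]; [left|right].
have : 4 * (z * ((z - 1) * (z + 1))) = 0 by rewrite -h2; ring.
move/eqP; rewrite !mulf_eq0 pnatr_eq0 /= subr_eq0 addr_eq0.
by move=> /or3P[/eqP ->|/eqP ->|/eqP ->]; [left|right; left|right; right].
Qed.

Definition open_T1 l : C := \det (alg_mx l (hess_expr l)) * sep_disc l.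

Lemma polyfun_open_T1 : polyfun open_T1.
Proof. by apply: polyfun_mul; [exact: polyfun_hess|exact: polyfun_sep]. Qed.

Lemma open_T1_good : open_T1 good_l != 0.
Proof.
have [p [hdet htr hcrit]] := critical_points_exist.
apply: mulf_neq0.
  rewrite hdet; apply/prodf_neq0 => i _; rewrite hess_exprE.
  have /critical_good : critical good_l (p i good_l) by apply/hcrit; exists i.
  rewrite /hessian !lam_good //=; move: (p i good_l ord0 ord0) (p i good_l ord0 ord_max) => y z.
  move=> [hy hz].
  rewrite (_ : _ - _ = 24 * (y * (3 * z ^+ 2 - 1))); last by ring.
  rewrite mulf_neq0 ?pnatr_eq0// mulf_neq0//.
    by case: hy => ->; rewrite ?oppr_eq0 oner_neq0.
  have [->|->] : 3 * z ^+ 2 - 1 = -1 \/ 3 * z ^+ 2 - 1 = 2.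
    by case: hz => [->|[->|->]]; [left|right|right]; ring.
    by rewrite oppr_eq0 oner_neq0.
  by rewrite pnatr_eq0.
apply/(sep_disc_inj (htr good_l)).
pose pt (k : 'I_6) : 'rV[C]_2 :=
  \row_j (if j == ord0 then nth 0 [:: 1; 1; 1; -1; -1; -1] k else nth 0 [:: 0; 1; -1; 0; 1; -1] k).
have ptc k : critical good_l (pt k).
  apply/critical_good; rewrite !mxE /=.
  by case: k => [[|[|[|[|[|[|//]]]]]] Hk] /=; split; auto.
have /choice[s hs] : forall k, exists i, pt k = p i good_l by move=> k; apply/hcrit.
have val k : bival_at sep_expr (pt k) =
    (nth 0 [:: 1; 4; - 2; -1; 2; - 4] k : int)%:~R.
  rewrite /bival_at !mxE /=.
  by case: k => [[|[|[|[|[|[|//]]]]]] Hk] /=; ring.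
have inj_pt : injective (fun k => bival_at sep_expr (pt k)).
  move=> k k'; rewrite !val => /intr_inj e; apply/val_inj => /=; move: e.
  by case: k => [[|[|[|[|[|[|//]]]]]] Hk]; case: k' => [[|[|[|[|[|[|//]]]]]] Hk'].
have s_inj : injective s by move=> k k' e; apply: inj_pt; rewrite /= !hs e.
have [t st ts] := injF_bij s_inj.
move=> i j /= e; rewrite -(ts i) -(ts j); congr s.
by apply: inj_pt; rewrite !hs !ts.
Qed.

Lemma hessian_neq0 l : open_T1 l != 0 -> forall q, critical l q -> hessian l q != 0.
Proof.
move=> ol q cq; have [p [hdet htr hcrit]] := critical_points_exist.
have [i qi] := (hcrit l q).1 cq.
move: ol; rewrite mulf_eq0 negb_or hdet => /andP[/prodf_neq0/(_ i isT) + _].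
by rewrite hess_exprE qi.
Qed.

Definition crit_y (x : Cover) : C :=
  3 * yx x ^+ 2 + lamx x 1 + lamx x 3 * zx x + lamx x 5 * zx x ^+ 2.
Definition crit_z (x : Cover) : C :=
  4 * zx x ^+ 3 + 2 * lamx x 4 * zx x + lamx x 2 + yx x * (lamx x 3 + 2 * lamx x 5 * zx x).

Lemma hol_lamx k (x : Cover) : hol (fun x => lamx x k) x (fun i => (i == lshift 2 (inord k))%:R).
Proof.
apply: hol_eq (hol_coord (lshift 2 (inord k)) x).
by apply: near_all => y; rewrite lamxE.
Qed.

Lemma hol_yx (x : Cover) : hol (@yx R) x (fun i => (i == rshift 6 ord0)%:R).
Proof.
apply: hol_eq (hol_coord (rshift 6 ord0) x).
by apply: near_all => y; rewrite yxE.
Qed.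

Lemma hol_zx (x : Cover) : hol (@zx R) x (fun i => (i == rshift 6 ord_max)%:R).
Proof.
apply: hol_eq (hol_coord (rshift 6 ord_max) x).
by apply: near_all => y; rewrite zxE.
Qed.

Lemma hol_crit_y x : exists2 g, hol crit_y x g &
  g (rshift 6 ord0) = 6 * yx x /\
  g (rshift 6 ord_max) = lamx x 3 + 2 * lamx x 5 * zx x.
Proof.
eexists.
  exact: hol_add (hol_add (hol_add (hol_mul (hol_cst 3 x) (hol_exp 2 (hol_yx x))) (hol_lamx 1 x))
    (hol_mul (hol_lamx 3 x) (hol_zx x))) (hol_mul (hol_lamx 5 x) (hol_exp 2 (hol_zx x))).
rewrite /= !eq_rlshift /=.
by split; ring.
Qed.

Lemma hol_crit_z x : exists2 g, hol crit_z x g &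
  g (rshift 6 ord0) = lamx x 3 + 2 * lamx x 5 * zx x /\
  g (rshift 6 ord_max) = 12 * zx x ^+ 2 + 2 * lamx x 4 + 2 * lamx x 5 * yx x.
Proof.
eexists.
  exact: hol_add (hol_add (hol_add (hol_mul (hol_cst 4 x) (hol_exp 3 (hol_zx x)))
     (hol_mul (hol_mul (hol_cst 2 x) (hol_lamx 4 x)) (hol_zx x))) (hol_lamx 2 x))
    (hol_mul (hol_yx x) (hol_add (hol_lamx 3 x)
       (hol_mul (hol_mul (hol_cst 2 x) (hol_lamx 5 x)) (hol_zx x)))).
rewrite /= !eq_rlshift /=.
by split; ring.
Qed.

(** The implicit function theorem: the map (l, y, z) |-> (l, f_y, f_z) has Jacobian
    determinant the Hessian, and a local inverse of it, restricted to
    (l, 0, 0), follows the critical point. *)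
Theorem critical_point_continuation l0 q0 : critical l0 q0 -> hessian l0 q0 != 0 ->
  exists c : T1 -> 'rV[C]_2,
    [/\ holo_near c l0, c l0 = q0 & \forall l \near l0, critical l (c l)].
Proof.
move=> [c1 c2] hess.
pose a : Cover := row_mx l0 q0.
have lama k : lamx a k = lam l0 k by rewrite /lamx row_mxKl.
have ya : yx a = q0 ord0 ord0 by rewrite /yx row_mxKr.
have za : zx a = q0 ord0 ord_max by rewrite /zx row_mxKr.
have [g1 hg1 [g1y g1z]] := hol_crit_y a.
have [g2 hg2 [g2y g2z]] := hol_crit_z a.
pose F (j : 'I_(6 + 2)) (x : Cover) : C := match fintype.split j with
  | inl _ => x ord0 j | inr k => if k == ord0 then crit_y x else crit_z x end.
pose J (j i : 'I_(6 + 2)) : C := match fintype.split j with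
  | inl _ => (i == j)%:R | inr k => if k == ord0 then g1 i else g2 i end.
have hF j : hol (F j) a (J j).
  rewrite /F /J; case: (fintype.split j) => k; first exact: hol_coord.
  by case: (k == ord0).
have splitl k : fintype.split (lshift 2 k : 'I_(6 + 2)) = inl k.
  by rewrite -[lshift 2 k]/(fintype.unsplit (inl k)) fintype.unsplitK.
have splitr k : fintype.split (rshift 6 k : 'I_(6 + 2)) = inr k.
  by rewrite -[rshift 6 k]/(fintype.unsplit (inr k)) fintype.unsplitK.
have ker (v : Cover) : (forall j, \sum_i v ord0 i * J j i = 0) -> v = 0.
  move=> h.
  have vl k : v ord0 (lshift 2 k) = 0.
    have := h (lshift 2 k); rewrite /J splitl (bigD1 (lshift 2 k))//= eqxx mulr1.
    by rewrite big1 ?addr0// => i /negPf ->; rewrite mulr0.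
  have sumr (g : 'I_(6 + 2) -> C) : \sum_i v ord0 i * g i =
      v ord0 (rshift 6 ord0) * g (rshift 6 ord0) + v ord0 (rshift 6 ord_max) * g (rshift 6 ord_max).
    rewrite big_split_ord/= big1 ?add0r; last by move=> i _; rewrite vl mul0r.
    exact: big_ord2.
  have h1 := h (rshift 6 ord0); rewrite /J splitr eqxx sumr g1y g1z in h1.
  have h2 := h (rshift 6 ord_max); rewrite /J splitr /= sumr g2y g2z in h2.
  rewrite /hessian -ya -za -!lama in hess.
  have vy : v ord0 (rshift 6 ord0) = 0.
    apply: (mulIf hess); rewrite mul0r.
    apply: etrans (_ : (12 * zx a ^+ 2 + 2 * lamx a 4 + 2 * lamx a 5 * yx a) * 0
       - (lamx a 3 + 2 * lamx a 5 * zx a) * 0 = 0); last by rewrite !mulr0 subrr.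
    by rewrite -{1}h1 -h2; ring.
  have vz : v ord0 (rshift 6 ord_max) = 0.
    apply: (mulIf hess); rewrite mul0r.
    apply: etrans (_ : (6 * yx a) * 0
       - (lamx a 3 + 2 * lamx a 5 * zx a) * 0 = 0); last by rewrite !mulr0 subrr.
    by rewrite -{2}h1 -h2; ring.
  apply/rowP => i; rewrite mxE -(fintype.splitK i); case: (fintype.split i) => k /=.
    exact: vl.
  by elim/ord2P: k.
have [G [Ga Gh FG _]] := inverse_function hF ker.
pose e l : Cover := row_mx l 0.
pose eG (j : 'I_(6 + 2)) l : C := match fintype.split j with inl k => l ord0 k | inr _ => 0 end.
have eE l : e l = \row_j eG j l.
  by apply/rowP => j; rewrite /eG !mxE; case: (fintype.split j) => k //; rewrite mxE.
have Fa : \row_j F j a = e l0.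
  rewrite eE; apply/rowP => j; rewrite !mxE /F /eG -(fintype.splitK j).
  case: (fintype.split j) => k /=; first by rewrite splitl /a row_mxEl.
  rewrite splitr; case: (k == ord0).
    by rewrite /crit_y ya za !lama.
  by rewrite /crit_z ya za !lama.
have heG j : hol (eG j) l0 (fun i => match fintype.split j with inl k => (i == k)%:R | inr _ => 0 end).
  by rewrite /eG; case: (fintype.split j) => k; [exact: hol_coord|exact: hol_cst].
have ec : continuous_at l0 e.
  apply: (near_eq_continuous_at (h := fun l => \row_j eG j l)).
    by apply: near_all => l; rewrite eE.
  by apply: continuous_at_row => j; exact: hol_continuous (heG j).
rewrite Fa in Ga Gh FG.
exists (fun l => rsubmx (G (e l))); split.
- have : \forall l \near l0, forall j : 'I_2, exists g,
      hol (fun l => rsubmx (G (e l)) ord0 j) l g.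
    apply: near_forall => j; have [g hg] := Gh (rshift 6 j).
    rewrite eE in hg; have h := hol_comp heG hg.
    apply: (hol_near (g := _)); apply: hol_eq h.
    by apply: near_all => l; rewrite mxE -eE.
  by apply: near_mono => l /choice[g hg]; exact: hol_differentiable_row hg.
- by rewrite Ga /a row_mxKr.
- have h : \forall l \near l0, \row_j F j (G (e l)) = e l by exact: ec _ FG.
  apply: near_mono h => l hl.
  have lE : lsubmx (G (e l)) = l.
    apply/rowP => k; have := congr1 (fun r : Cover => r ord0 (lshift 2 k)) hl.
    by rewrite /= mxE /F splitl /e row_mxEl => <-; rewrite mxE.
  have h (k : 'I_2) : F (rshift 6 k) (G (e l)) = 0.
    have := congr1 (fun r : Cover => r ord0 (rshift 6 k)) hl.
    by rewrite /= mxE => ->; rewrite /e row_mxEr mxE.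
  have h1 := h ord0; have h2 := h ord_max; rewrite /F !splitr /= in h1 h2.
  by rewrite -{1}lE; split; [exact: h1|exact: h2].
Qed.

End CriticalPoints.

(** * Nodes are critical points of value zero *)

Section Derivatives.
Variable K : numFieldType.

(** Relates the gradient of difference quotients to directional derivatives, in which
    the holomorphy in the definition of a germ equivalence is expressed. *)
Lemma hol_derive n (f : 'rV[K]_n -> K) a g v : hol f a g ->
  'D_v f a = \sum_i v ord0 i * g i.
Proof.
move=> [Q [Qg Qc Qe]].
pose c (t : K) : 'rV[K]_n * 'rV[K]_n := (t *: v + a, a).
have cc : continuous_at (0 : K) c.
  apply: continuous_at_pair; last exact: continuous_at_cst.
  rewrite (_ : (fun t : K => _) = fun t => \row_j (t * v ord0 j + a ord0 j)); last first.
    by apply/funext => t; apply/rowP => j; rewrite !mxE.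
  apply: continuous_at_row => j; apply: continuous_at_add; last exact: continuous_at_cst.
  by apply: continuous_at_mul; [exact: continuous_at_id|exact: continuous_at_cst].
have c0 : c 0 = (a, a) by rewrite /c scale0r add0r.
apply: cvg_lim => //.
have := nbhs_singleton Qc => Qaa.
have lim : \sum_i v ord0 i * Q i (c t) @[t --> 0^'] --> \sum_i v ord0 i * g i.
  apply: cvg_within_filter.
  have : continuous_at (0 : K) (fun t => \sum_i v ord0 i * Q i (c t)).
    apply: continuous_at_sum => i; apply: continuous_at_mul; first exact: continuous_at_cst.
    by apply: continuous_at_comp => //; rewrite c0; exact: Qaa.
  by rewrite /continuous_at c0; under eq_bigr do rewrite Qg.
apply: cvg_trans lim; apply: near_eq_cvg.
have h : \forall t \near (0 : K),
    f (c t).1 - f (c t).2 = \sum_i ((c t).1 ord0 i - (c t).2 ord0 i) * Q i (c t).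
  move: cc; rewrite /continuous_at c0 => cc; exact: cc _ Qe.
have h' : \forall t \near (0 : K)^',
    f (c t).1 - f (c t).2 = \sum_i ((c t).1 ord0 i - (c t).2 ord0 i) * Q i (c t).
  exact: cvg_within h.
have t0 : \forall t \near (0 : K)^', t != 0 by exact: nbhs_dnbhs_neq.
near=> t.
have tn : t != 0 by near: t.
have /= -> : f (c t).1 - f (c t).2 = \sum_i ((c t).1 ord0 i - (c t).2 ord0 i) * Q i (c t).
  by near: t.
rewrite scaler_sumr; apply: eq_bigr => i _.
by rewrite !mxE addrK /GRing.scale /= !mulrA mulVf// mul1r.
Unshelve. all: by end_near. Qed.

(** By the Leibniz and chain rules, pulling back by phi and multiplying by u
    preserve a vanishing value and a vanishing differential. *)
Lemma derive_mul_critical (V W : normedModType K) (phi : V -> W) (u G : W -> K) (a v : V) :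
  differentiable phi a -> differentiable u (phi a) -> differentiable G (phi a) ->
  G (phi a) = 0 -> (forall w, 'D_w G (phi a) = 0) ->
  'D_v (fun x => u (phi x) * G (phi x)) a = 0.
Proof.
move=> dphi du dG G0 dG0.
have duG : differentiable (u * G) (phi a) by exact: differentiableM.
have -> : (fun x => u (phi x) * G (phi x)) = (u * G) \o phi by [].
rewrite deriveE; last exact: differentiable_comp.
rewrite (diff_comp dphi duG) /= (diffM du dG).
change (u (phi a) * 'd G (phi a) ('d phi a v) + G (phi a) * 'd u (phi a) ('d phi a v) = 0).
by rewrite G0 mul0r addr0 -deriveE// dG0 mulr0.
Qed.

End Derivatives.

Section Nodal.
Variables (R : realType).
Local Notation C := (Cx R).

Lemma hol_squares N k (x : 'rV[C]_N.+1) :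
  hol (squares k) x (fun i => 2 * x ord0 i * (i < k)%:R).
Proof.
have h (j : 'I_N.+1) : hol (fun x : 'rV[C]_N.+1 => (j < k)%:R * x ord0 j ^+ 2) x _ :=
  hol_mul (hol_cst ((j < k)%:R) x) (hol_exp 2 (hol_coord j x)).
apply: hol_eq (hol_grad _ (hol_sum h)).
  apply: near_all => y; rewrite /squares big_mkcond; apply: eq_bigr => j _.
  by case: (j < k)%N; rewrite ?mul1r ?mul0r.
move=> i; rewrite (bigD1 i)//= eqxx big1 => [|j /negPf ji].
  by rewrite mulr1 mulr0 !addr0 mulrC.
by rewrite eq_sym ji !mulr0 addr0.
Qed.

(** The normal form of a node has a vanishing value and differential at 0. *)
Lemma type_A1_singular N (F : 'rV[C]_N.+1 -> C) a g : has_type (TypeA 1) F a ->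
  hol F a g -> F a = 0 /\ forall i, g i = 0.
Proof.
move=> [phi [psi [u [[dphi _ phia psi0] psiphi _ [du _] FG]]]] hF.
pose G : 'rV[C]_N.+1 -> C := normal_form (TypeA 1).
have hG : hol G 0 (fun=> 0).
  apply: hol_grad (hol_add (hol_squares N 0) (hol_exp 2 (hol_coord ord_max 0))) => i.
  by rewrite !mxE /= !(mulr0, mul0r) addr0.
have G0 : G 0 = 0.
  rewrite /G /normal_form /squares /zcoord big1 => [|i _]; rewrite !mxE expr0n ?addr0//.
have dG := hol_differentiable hG.
have FE : \forall x \near a, F x = u (phi x) * G (phi x).
  have pc : continuous_at a phi.
    by apply: differentiable_continuous; exact: nbhs_singleton dphi.
  move: pc; rewrite /continuous_at phia => pc.
  have := near_and psiphi (pc _ FG); apply: near_mono => x [h1] /=.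
  by rewrite h1.
split; first by rewrite (nbhs_singleton FE) phia G0 mulr0.
move=> i.
have := hol_derive (delta_mx ord0 i) hF.
rewrite (bigD1 i)//= !mxE !eqxx mul1r big1 ?addr0; last first.
  by move=> j /negPf ji; rewrite !mxE eqxx ji mul0r.
move=> <-; rewrite (near_eq_derive _ FE).
apply: derive_mul_critical (nbhs_singleton dphi) _ _ _ _; rewrite phia //.
  exact: nbhs_singleton du.
by move=> w; rewrite (hol_derive _ hG) big1// => j _; rewrite mulr0.
Qed.

(** A singular point of f_Lambda = 0 lies in the plane of y and z, because of the
    squares, and its coordinates there satisfy the critical equations. *)
Lemma nodal_critical N l (a : 'rV[C]_N.+1) : (0 < N)%N -> has_type (TypeA 1) (f_def l) a ->
  exists q, critical l q /\ crit_value l q = 0.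
Proof.
case: N a => // m a _ hA.
set y := ycoord a; set z := zcoord a.
have hy : hol (@ycoord R m.+1) a _ := hol_coord (inord m) a.
have hz : hol (@zcoord R m.+1) a _ := hol_coord ord_max a.
have hc (c : C) := hol_cst c a.
have hF : hol (f_def l) a _ :=
  hol_add (hol_add (hol_add (hol_add (hol_add (hol_add
    (hol_add (hol_add (hol_squares m a) (hol_exp 3 hy)) (hol_exp 4 hz)) (hc (lam l 0)))
    (hol_mul (hc (lam l 1)) hy)) (hol_mul (hc (lam l 2)) hz))
    (hol_mul (hol_mul (hc (lam l 3)) hy) hz)) (hol_mul (hc (lam l 4)) (hol_exp 2 hz)))
    (hol_mul (hol_mul (hc (lam l 5)) hy) (hol_exp 2 hz)).
have [F0 g0] := type_A1_singular hA hF.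
exists (\row_j (if j == ord0 then y else z)).
have yz : (inord m == ord_max :> 'I_m.+2) = false by rewrite -val_eqE /= inordK// ltn_eqF.
have a0 (i : 'I_m.+2) : (i < m)%N -> a ord0 i = 0.
  move=> im; have := g0 i; rewrite im.
  have -> : (i == inord m) = false by rewrite -val_eqE /= inordK// ltn_eqF.
  have -> : (i == ord_max) = false by rewrite -val_eqE /= ltn_eqF// ltnW.
  by rewrite !(mulr0, addr0, mulr1) => /eqP; rewrite mulf_eq0 pnatr_eq0 /= => /eqP.
have sq0 : squares m a = 0 by apply: big1 => i /a0 ->; rewrite expr0n.
split; last by rewrite -F0 /crit_value /f_def /= !mxE /= sq0 add0r.
rewrite /critical !mxE /=; split.
  have := g0 (inord m); rewrite yz eqxx inordK// ltnn => <-; rewrite -/y -/z /=; ring.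
have := g0 ord_max; rewrite eq_sym yz eqxx /= ltnNge leqnSn => <-; rewrite -/y -/z /=; ring.
Qed.

Lemma critical_at0 q : critical (0 : 'rV[C]_6) q -> q = 0.
Proof.
rewrite /critical /lam !mxE !(mul0r, mulr0, addr0) => -[/eqP + /eqP].
rewrite !mulf_eq0 !pnatr_eq0 /= !orbb => /eqP h0 /eqP h1.
by apply/rowP; apply: ord2P; rewrite !mxE.
Qed.

End Nodal.

(** * The union of the six hypersurfaces *)

Section Assembly.
Variables (R : realType) (N : nat).
Hypothesis N_gt0 : (0 < N)%N.
Local Notation C := (Cx R).
Local Notation T1 := 'rV[C]_6.

Lemma Lcal_row_mx (l : T1) q : critical l q -> Lcal R (row_mx l q) <-> crit_value l q = 0.
Proof. by move=> cq; rewrite /Lcal /= row_mxKl row_mxKr; split=> [[]|]. Qed.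

(** A polynomial that vanishes at the nodal parameters, pulled back to the cover,
    vanishes at the points of Lcal of type A_1, which are dense in Lcal. *)
Lemma nodal_of_Lcal x : Lcal R x -> zclosure (nodal R N) (lsubmx x).
Proof.
move=> Lx g g0.
have pg : polyfun (fun l : T1 => mpoly.meval (fun i => l ord0 i) g) by exists g.
have pgl : polyfun (fun x : 'rV[C]_(6 + 2) => mpoly.meval (fun i => lsubmx x ord0 i) g).
  apply: (polyfun_comp pg) => i.
  rewrite (_ : (fun _ => _) = fun x : 'rV[C]_(6 + 2) => x ord0 (lshift 2 i)).
    exact: polyfun_coord.
  by apply/funext => y; rewrite mxE.
apply: (zclosure_zero pgl _ (dense_A1 Lx)) => y [Ly Oy]; apply: g0.
by exists (pointN N (rsubmx y)); exact: type_A1.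
Qed.

Lemma cip_diagram_preimage (T T' : Type) (h : T -> T') (S : vertex -> set T') :
  cip_diagram S -> cip_diagram (fun v => h @^-1` S v).
Proof.
move=> [sub [q1 q2 q3 q4 q5] [r1 r2 r3 r4 r5]]; split.
- by move=> a b /sub; exact: preimage_subset.
- by split; try exact: preimage_subset; rewrite q5 preimage_setI.
- by split; try exact: preimage_subset; rewrite r5 preimage_setI.
Qed.

End Assembly.

Theorem theorem6p8 (R : realType) (N : nat) (hN : (1 <= N)%N) :
  (exists p : 'I_6 -> 'rV[Cx R]_6 -> 'rV[Cx R]_2,
    [/\ (* p 0, ..., p 5 enumerate the critical points *)
        (forall l q, critical l q <-> exists i, q = p i l),
        (* for generic l they are distinct and vary holomorphically *)
        (exists O : set 'rV[Cx R]_6,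
          [/\ zopen O, O !=set0,
              (forall l, O l -> injective (fun i => p i l)) &
              (forall l0 i, O l0 ->
                 exists c : 'rV[Cx R]_6 -> 'rV[Cx R]_2,
                   [/\ holo_near c l0, c l0 = p i l0 &
                       \forall l \near l0, critical l (c l)])]),
        (* the six equations multiply to a polynomial equation on T^1 *)
        (exists D : mpoly.mpoly 6 (Cx R), forall l : 'rV[Cx R]_6,
           mpoly.meval (fun i => l ord0 i) D
           = \prod_(i < 6) crit_value l (p i l)),
        (* the nodal locus is the union of the six hypersurfaces *)
        zclosure (nodal R N) = \bigcup_(i in [set: 'I_6]) along (p i) (Lcal R) &
        (* the diagram in T^1, for each of the six *)
        (forall i, cip_diagram (fun v => along (p i) (stratum R v))
                   /\ along (p i) (stratum R vE6) = [set 0])])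
  /\
  [/\ (forall v, zclosed (stratum R v)),
      cip_diagram (stratum R),
      verifies N arnold_arrow (stratum R) &
      (* W23 and W24t are reducible; elsewhere generic means dense *)
      (forall v, v <> vA3 -> v <> vA4 ->
         densely_generically (stratum R v)
           (type_at R N (vertex_type v)))].
Proof.
split; last first.
  split; [exact: zclosed_stratum|exact: cip_diagram_stratum|exact: verifies_stratum|].
  exact: densely_generic_stratum.
have [p [hdet htr hcrit]] := critical_points_exist R.
have crit_p l i : critical l (p i l) by apply/hcrit; exists i.
have value_prod l : \det (alg_mx l (value_expr l)) = \prod_i crit_value l (p i l).
  by rewrite hdet; apply: eq_bigr => i _; rewrite value_exprE.
exists p; split=> //.
- exists [set l | open_T1 l != 0]; split.
  + exact: zopen_neq0 (@polyfun_open_T1 R).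
  + by exists (good_l R); exact: open_T1_good.
  + move=> l; rewrite /= mulf_eq0 negb_or => /andP[_ /(sep_disc_inj (htr l)) inj] i j ij.
    by apply: inj; rewrite /= ij.
  + move=> l i /hessian_neq0 h; apply: critical_point_continuation => //.
    exact: h.
- by have [D hD] := polyfun_value R; exists D => l; rewrite -value_prod hD.
- apply/seteqP; split.
    move=> l hl.
    have : \det (alg_mx l (value_expr l)) = 0.
      apply: (zclosure_zero (polyfun_value R) _ hl) => k [a /(nodal_critical hN)[q [cq vq]]].
      have [i qi] := (hcrit k q).1 cq.
      by rewrite value_prod (bigD1 i)//= -qi vq mul0r.
    rewrite value_prod => /eqP/prodf_eq0[i _ /eqP vi].
    by exists i => //; rewrite /along /=; apply/Lcal_row_mx.
  move=> l [i _ Li]; have := nodal_of_Lcal hN Li.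
  by rewrite row_mxKl.
- move=> i; split; first exact: cip_diagram_preimage (cip_diagram_stratum R).
  apply/seteqP; split=> l /=.
    rewrite /along /= => e; have := congr1 lsubmx e.
    by rewrite row_mxKl => ->; apply/rowP => j; rewrite !mxE.
  move=> ->; rewrite /along /= (critical_at0 (crit_p 0 i)).
  by apply/rowP => j; rewrite !mxE; case: fintype.split => k; rewrite mxE.
Qed.
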